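(* There is an integer $m\ge 1$ such that the following holds. Let $u\in C^m([a,b]\times[c,d]\times[0,T];\mathbb{C})$ be an exact solution of $$i\,\partial_t u+\Delta u+\lambda u|u|^2-\nu|u|^4u+i\varepsilon u|u|^2=0\ \text{ in }\Omega\times(0,T),\qquad u(\cdot,0)=u_0\ \text{ in }\Omega,\qquad u=0\ \text{ on }\partial\Omega\times[0,T].$$ Then for every constant $C_0>0$ there exist constants $h_0>0$ and $C>0$, independent of $h$ and $\tau$, such that for every mesh size $h\le h_0$, every time step $\tau\le C_0h$, and every solution $\{U^n\}_{n=0}^N$ of the CNFD scheme, with $u^n_{j,k}:=u(x_j,y_k,t_n)$, $$\max_{1\le n\le N}\|u^n-U^n\|_{2,h}\le C(\tau^2+h^2),\qquad \max_{1\le n\le N}\|\delta^+(u^n-U^n)\|_{2,h}\le C(\tau^2+h^2).$$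
   Context: Constants: $\lambda\in\mathbb{R}$, $\nu>0$, $\varepsilon\ge 0$, $T>0$; $\Omega=(a,b)\times(c,d)\subset\mathbb{R}^2$; $u_0:\overline\Omega\to\mathbb{C}$ is the initial datum, vanishing on $\partial\Omega$ (by the boundary condition at $t=0$). Grid: $x_j=a+j\Delta x$, $\Delta x=(b-a)/J$, $y_k=c+k\Delta y$, $\Delta y=(d-c)/K$, for $0\le j\le J$, $0\le k\le K$, with $\Delta x=\Delta y=h$. Time grid: $t_n=n\tau$, $n=0,\dots,N$, $N\tau=T$. $\mathcal{T}_{JK}=\{(j,k):1\le j\le J-1,\ 1\le k\le K-1\}$. $X_{JK}$ is the space of complex grid functions $u=(u_{j,k})_{0\le j\le J,\,0\le k\le K}$ with $u_{0,k}=u_{J,k}=u_{j,0}=u_{j,K}=0$ for all $j,k$. Difference operators: $\delta_t^+u^n_{j,k}=(u^{n+1}_{j,k}-u^n_{j,k})/\tau$, $\delta_x^+u_{j,k}=(u_{j+1,k}-u_{j,k})/\Delta x$, $\delta_y^+u_{j,k}=(u_{j,k+1}-u_{j,k})/\Delta y$, $\delta^2u_{j,k}=\frac{u_{j+1,k}-2u_{j,k}+u_{j-1,k}}{(\Delta x)^2}+\frac{u_{j,k+1}-2u_{j,k}+u_{j,k-1}}{(\Delta y)^2}$. Norms: $\|u\|_{2,h}^2=\Delta x\Delta y\sum_{j=0}^{J-1}\sum_{k=0}^{K-1}|u_{j,k}|^2$, $\|\delta^+u\|_{2,h}^2=\|\delta_x^+u\|_{2,h}^2+\|\delta_y^+u\|_{2,h}^2$.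 For $z,w\in\mathbb{C}$: $\psi_1(z,w)=\frac{|z|^2+|w|^2}{2}\cdot\frac{z+w}{2}$, $\psi_2(z,w)=\frac{|z|^4+|z|^2|w|^2+|w|^4}{3}\cdot\frac{z+w}{2}$, $\varphi(z,w)=\left|\frac{z+w}{2}\right|^2\frac{z+w}{2}$. CNFD scheme: $\{U^n\}_{n=0}^N$ is a solution if $U^0_{j,k}=u_0(x_j,y_k)$, $U^{n+1}\in X_{JK}$ for $n=0,\dots,N-1$, and, with $U^{n+1/2}=\frac12(U^{n+1}+U^n)$, for all $(j,k)\in\mathcal{T}_{JK}$ and $n=0,\dots,N-1$, $$i\delta_t^+U^n_{j,k}+\delta^2U^{n+1/2}_{j,k}+\lambda\psi_1(U^{n+1}_{j,k},U^n_{j,k})-\nu\psi_2(U^{n+1}_{j,k},U^n_{j,k})+i\varepsilon\varphi(U^{n+1}_{j,k},U^n_{j,k})=0.$$ *)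

(* Defs.v *)
From Stdlib Require Import Reals.
From Coquelicot Require Import Coquelicot.

Local Open Scope R_scope.

(** * Classical solutions on a rectangle *)

Definition open_rect (a b c d x y : R) : Prop := a < x < b /\ c < y < d.

Definition closed_rect (a b c d x y : R) : Prop := a <= x <= b /\ c <= y <= d.

Definition rect_boundary (a b c d x y : R) : Prop :=
  closed_rect a b c d x y /\ ~ open_rect a b c d x y.

Definition closed_cylinder (a b c d T : R) (p : R * R * R) : Prop :=
  closed_rect a b c d (fst (fst p)) (snd (fst p)) /\ 0 <= snd p <= T.

(** Derivative of a complex-valued function of a real variable; the structures
    are explicit because [C] is also a normed module over itself. *)
Definition is_deriveC (f : R -> C) (x : R) (l : C) : Prop :=
  @is_derive R_AbsRing C_R_NormedModule f x l.

Definition is_derive2C (f : R -> C) (x : R) (l : C) : Prop :=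
  exists g : R -> C,
    locally x (fun s => is_deriveC f s (g s)) /\ is_deriveC g x l.

(** [u] is of class C^m on the closed box [a,b] x [c,d] x [0,T]: the partial
    derivatives of order at most [m] exist in the open box and extend
    continuously to the closed box.  [D p q r] is the extension of
    [d_x^p d_y^q d_t^r u].  Values of [u] outside the closed box are
    irrelevant. *)
Definition Cm_closed (m : nat) (a b c d T : R) (u : R -> R -> R -> C) : Prop :=
  exists D : nat -> nat -> nat -> R -> R -> R -> C,
    (forall x y t, closed_cylinder a b c d T (x, y, t) ->
       D 0%nat 0%nat 0%nat x y t = u x y t) /\
    (forall p q r : nat, (p + q + r <= m)%nat ->
       continuous_on (closed_cylinder a b c d T)
         (fun z : R * R * R => D p q r (fst (fst z)) (snd (fst z)) (snd z))) /\
    (forall p q r : nat, (p + q + r < m)%nat ->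
       forall x y t, open_rect a b c d x y -> 0 < t < T ->
         is_deriveC (fun s => D p q r s y t) x (D (S p) q r x y t) /\
         is_deriveC (fun s => D p q r x s t) y (D p (S q) r x y t) /\
         is_deriveC (fun s => D p q r x y s) t (D p q (S r) x y t)).

Definition exact_solution (lambda nu eps a b c d T : R)
    (u0 : R -> R -> C) (u : R -> R -> R -> C) : Prop :=
  (forall x y t, open_rect a b c d x y -> 0 < t < T ->
     exists ut uxx uyy : C,
       is_deriveC (fun s => u x y s) t ut /\
       is_derive2C (fun s => u s y t) x uxx /\
       is_derive2C (fun s => u x s t) y uyy /\
       (Ci * ut + (uxx + uyy)
        + RtoC lambda * u x y t * RtoC (Cmod (u x y t) ^ 2)
        - RtoC nu * RtoC (Cmod (u x y t) ^ 4) * u x y t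
        + Ci * RtoC eps * u x y t * RtoC (Cmod (u x y t) ^ 2)
        = RtoC 0)%C) /\
  (forall x y, open_rect a b c d x y -> u x y 0 = u0 x y) /\
  (forall x y t, rect_boundary a b c d x y -> 0 <= t <= T ->
     u x y t = RtoC 0).

(** * Grid functions *)

(** Only the values at indices [0 <= j <= J], [0 <= k <= K] are meaningful. *)
Definition gridfun := nat -> nat -> C.

Definition X_JK (J K : nat) (v : gridfun) : Prop :=
  (forall k, (k <= K)%nat -> v 0%nat k = RtoC 0 /\ v J k = RtoC 0) /\
  (forall j, (j <= J)%nat -> v j 0%nat = RtoC 0 /\ v j K = RtoC 0).

Definition dxp (dx : R) (v : gridfun) : gridfun :=
  fun j k => ((v (S j) k - v j k) / RtoC dx)%C.

Definition dyp (dy : R) (v : gridfun) : gridfun :=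
  fun j k => ((v j (S k) - v j k) / RtoC dy)%C.

Definition dtp (tau : R) (U : nat -> gridfun) (n : nat) : gridfun :=
  fun j k => ((U (S n) j k - U n j k) / RtoC tau)%C.

(** Only meaningful for [1 <= j] and [1 <= k], since [pred 0 = 0]. *)
Definition laph (dx dy : R) (v : gridfun) : gridfun :=
  fun j k =>
    ((v (S j) k - RtoC 2 * v j k + v (pred j) k) / RtoC (dx ^ 2)
     + (v j (S k) - RtoC 2 * v j k + v j (pred k)) / RtoC (dy ^ 2))%C.

(** [sum_n f n] is the sum of [f 0], ..., [f n], hence the [pred]. *)
Definition norm2h (dx dy : R) (J K : nat) (v : gridfun) : R :=
  sqrt (dx * dy *
        sum_n (fun j => sum_n (fun k => Cmod (v j k) ^ 2) (pred K)) (pred J)).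

Definition norm2h_grad (dx dy : R) (J K : nat) (v : gridfun) : R :=
  sqrt (norm2h dx dy J K (dxp dx v) ^ 2 + norm2h dx dy J K (dyp dy v) ^ 2).

(** * The CNFD scheme *)

Definition psi1 (z w : C) : C :=
  (RtoC ((Cmod z ^ 2 + Cmod w ^ 2) / 2) * ((z + w) / RtoC 2))%C.

Definition psi2 (z w : C) : C :=
  (RtoC ((Cmod z ^ 4 + Cmod z ^ 2 * Cmod w ^ 2 + Cmod w ^ 4) / 3)
   * ((z + w) / RtoC 2))%C.

Definition phi (z w : C) : C :=
  (RtoC (Cmod ((z + w) / RtoC 2) ^ 2) * ((z + w) / RtoC 2))%C.

Definition midlevel (U : nat -> gridfun) (n : nat) : gridfun :=
  fun j k => ((U (S n) j k + U n j k) / RtoC 2)%C.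

Definition CNFD_solution (lambda nu eps a c dx dy tau : R) (J K N : nat)
    (u0 : R -> R -> C) (U : nat -> gridfun) : Prop :=
  (forall j k, (j <= J)%nat -> (k <= K)%nat ->
     U 0%nat j k = u0 (a + INR j * dx) (c + INR k * dy)) /\
  (forall n, (n < N)%nat -> X_JK J K (U (S n))) /\
  (forall n j k, (n < N)%nat ->
     (1 <= j <= J - 1)%nat -> (1 <= k <= K - 1)%nat ->
     (Ci * dtp tau U n j k + laph dx dy (midlevel U n) j k
      + RtoC lambda * psi1 (U (S n) j k) (U n j k)
      - RtoC nu * psi2 (U (S n) j k) (U n j k)
      + Ci * RtoC eps * phi (U (S n) j k) (U n j k)
      = RtoC 0)%C).

Definition grid_error (a c dx dy tau : R) (u : R -> R -> R -> C)
    (U : nat -> gridfun) (n : nat) : gridfun :=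
  fun j k =>
    (u (a + INR j * dx)%R (c + INR k * dy)%R (INR n * tau)%R - U n j k)%C.

(* Main.v *)
Require Import Defs.
From Stdlib Require Import Reals Lra Lia Classical ClassicalEpsilon.
From Coquelicot Require Import Coquelicot.

Local Open Scope R_scope.

(** Put [e = u - U] at the grid nodes.  Then [i dt e + lap (mid e) + N = R], where
    [N] is the difference of the nonlinear terms and [R] the residual of the
    exact solution; all estimates come from pairing this equation, summed over
    the grid, with test functions that vanish on the boundary ([weak_form]).

    Any solution [U] of the scheme is bounded in the discrete energy space,
    because the scheme dissipates mass ([mass_decreasing]) and almost dissipates
    energy ([energy_step]): the positive quintic term dominates the cubic one
    ([dirichlet_le_energy], [gain_times_pow4_le]).

    In two dimensions this does not bound [U] in sup norm.  The pairing with
    [i mid e] nevertheless gives a recursion for the mass of [e] whose only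
    superquadratic terms are sums of [|e|^5] ([nonlin_dissipation],
    [mass_error_step]).  By the discrete Ladyzhenskaya inequality
    ([ladyzhenskaya]) and the energy bound these are at most a constant times [sup |e|]
    times the mass of [e], and [sup |e| = O(h^(-1/2))], so with [tau <= C0 h] one time
    step can only multiply the mass by a constant.  Then
    [sup |e| <= h^(-1) (tau^2 + h^2)] up to constants, which is below 1 for small
    [h], and the recursion becomes linear; Gronwall closes the induction
    ([mass_error_bound]).

    For the gradient, the equation is paired with [dt e].  The contribution of
    [N] is rewritten by pairing the equation with [i N], so that only the
    discrete gradient of [N] occurs; it is bounded by those of [e]
    ([nonlin_error_bound]).  This needs [N = 0] on the boundary, which [R] need not
    satisfy; the contribution of [R] is instead summed by parts in time
    ([dirichlet_error_bound]), so the time increments of [R] must be small too.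

    Smallness of [R] ([residual_estimates]) follows from Taylor estimates up to
    order five.  As the derivatives of [u] exist in the open box only, these are
    proved for [u] composed with contractions of the box towards its centre and
    passed to the limit ([smooth_box_difference_bounds]). *)


(** * Complex numbers as Euclidean vectors *)

(** The real inner product of [C].  Since [dot z (Ci * z) = 0], testing with [Ci]
    times a quantity plays the role of taking imaginary parts. *)
Definition dot (z w : C) : R := fst z * fst w + snd z * snd w.

Lemma Cmod_sqr (z : C) : Cmod z ^ 2 = dot z z.
Proof.
  unfold Cmod, dot. rewrite pow2_sqrt; [ring | nra].
Qed.

Lemma Cmod_pow4 (z : C) : Cmod z ^ 4 = dot z z ^ 2.
Proof. rewrite <- Cmod_sqr. ring. Qed.

Lemma Cdiv_RtoC (z : C) (r : R) :
  r <> 0 -> (z / RtoC r)%C = (fst z / r, snd z / r).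
Proof.
  intros Hr. unfold Cdiv, Cinv, Cmult, RtoC; cbn [fst snd].
  apply injective_projections; cbn [fst snd]; field; auto.
Qed.

Lemma dot_le_Cmod (z w : C) : Rabs (dot z w) <= Cmod z * Cmod w.
Proof.
  apply Rsqr_incr_0_var.
  2: apply Rmult_le_pos; apply Cmod_ge_0.
  rewrite <- Rsqr_abs, !Rsqr_pow2, Rpow_mult_distr, !Cmod_sqr.
  unfold dot. generalize (pow2_ge_0 (fst z * snd w - snd z * fst w)). lra.
Qed.

Lemma Cmod_le_components (z : C) : Cmod z <= Rabs (fst z) + Rabs (snd z).
Proof.
  assert (H1 := Rabs_pos (fst z)). assert (H2 := Rabs_pos (snd z)).
  apply Rsqr_incr_0_var; [| lra].
  rewrite !Rsqr_pow2, Cmod_sqr. unfold dot.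
  assert (E1 := pow2_abs (fst z)). assert (E2 := pow2_abs (snd z)). nra.
Qed.

Lemma components_le_Cmod (z : C) : Rabs (fst z) <= Cmod z /\ Rabs (snd z) <= Cmod z.
Proof.
  generalize (Rmax_Cmod z) (Rmax_l (Rabs (fst z)) (Rabs (snd z)))
    (Rmax_r (Rabs (fst z)) (Rabs (snd z))). lra.
Qed.

Lemma Cmod_triangle_minus (z w : C) : Cmod (z - w) <= Cmod z + Cmod w.
Proof. rewrite <- (Cmod_opp w). apply Cmod_triangle. Qed.

(** * Sums over the grid *)

(* Sums are taken in an abelian monoid whose carrier is only convertible to [R]. *)
Ltac ring_R :=
  match goal with |- @eq _ ?x ?y => change (@eq R x y) end;
  unfold plus, zero; simpl; ring.

Definition gsum (J K : nat) (f : nat -> nat -> R) : R :=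
  sum_n (fun j => sum_n (fun k => f j k) (pred K)) (pred J).

Lemma sum_n_le_loc (f g : nat -> R) (n : nat) :
  (forall i, (i <= n)%nat -> f i <= g i) -> sum_n f n <= sum_n g n.
Proof.
  induction n as [|n IH]; intros H.
  - rewrite !sum_O. apply H; lia.
  - rewrite !sum_Sn. apply Rplus_le_compat; [apply IH; intros; apply H; lia | apply H; lia].
Qed.

Lemma gsum_ext (J K : nat) (f g : nat -> nat -> R) :
  (1 <= J)%nat -> (1 <= K)%nat ->
  (forall j k, (j < J)%nat -> (k < K)%nat -> f j k = g j k) ->
  gsum J K f = gsum J K g.
Proof.
  intros HJ HK H. apply sum_n_ext_loc; intros j Hj.
  apply sum_n_ext_loc; intros k Hk. apply H; lia.
Qed.

Lemma gsum_le (J K : nat) (f g : nat -> nat -> R) :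
  (1 <= J)%nat -> (1 <= K)%nat ->
  (forall j k, (j < J)%nat -> (k < K)%nat -> f j k <= g j k) ->
  gsum J K f <= gsum J K g.
Proof.
  intros HJ HK H. apply sum_n_le_loc; intros j Hj.
  apply sum_n_le_loc; intros k Hk. apply H; lia.
Qed.

Lemma gsum_plus (J K : nat) (f g : nat -> nat -> R) :
  gsum J K (fun j k => f j k + g j k) = gsum J K f + gsum J K g.
Proof.
  unfold gsum. rewrite <- (sum_n_plus (G := R_AbelianMonoid)). apply sum_n_ext; intros j.
  apply (sum_n_plus (G := R_AbelianMonoid)).
Qed.

Lemma gsum_scal (J K : nat) (c : R) (f : nat -> nat -> R) :
  gsum J K (fun j k => c * f j k) = c * gsum J K f.
Proof.
  unfold gsum. rewrite <- (sum_n_mult_l (K := R_Ring)). apply sum_n_ext; intros j.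
  apply (sum_n_mult_l (K := R_Ring)).
Qed.

Lemma gsum_minus (J K : nat) (f g : nat -> nat -> R) :
  gsum J K (fun j k => f j k - g j k) = gsum J K f - gsum J K g.
Proof.
  replace (gsum J K f - gsum J K g) with (gsum J K f + (-1) * gsum J K g) by ring.
  rewrite <- gsum_scal, <- gsum_plus.
  apply sum_n_ext; intros j; apply sum_n_ext; intros k.
  change (f j k - g j k = f j k + (-1) * g j k). ring.
Qed.

Lemma sum_n_zero (n : nat) : sum_n (fun _ => 0) n = 0.
Proof. etransitivity; [apply sum_n_const | apply Rmult_0_r]. Qed.

Lemma gsum_zero (J K : nat) : gsum J K (fun _ _ => 0) = 0.
Proof.
  unfold gsum. rewrite (sum_n_ext _ (fun _ => 0)); [apply sum_n_zero | intros; apply sum_n_zero].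
Qed.

Lemma gsum_nonneg (J K : nat) (f : nat -> nat -> R) :
  (1 <= J)%nat -> (1 <= K)%nat ->
  (forall j k, (j < J)%nat -> (k < K)%nat -> 0 <= f j k) -> 0 <= gsum J K f.
Proof.
  intros HJ HK H. rewrite <- (gsum_zero J K). apply gsum_le; auto.
Qed.

Lemma gsum_const (J K : nat) (c : R) :
  (1 <= J)%nat -> (1 <= K)%nat -> gsum J K (fun _ _ => c) = INR J * INR K * c.
Proof.
  intros HJ HK. unfold gsum.
  rewrite (sum_n_ext _ (fun _ => INR K * c)).
  - etransitivity; [apply sum_n_const |].
    replace (S (pred J)) with J by lia. ring.
  - intros j. etransitivity; [apply sum_n_const |].
    replace (S (pred K)) with K by lia. reflexivity.
Qed.

Lemma gsum_switch (J K : nat) (f : nat -> nat -> R) :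
  gsum J K f = gsum K J (fun k j => f j k).
Proof. apply (sum_n_switch (G := R_AbelianMonoid)). Qed.

Lemma gsum_prod (J K : nat) (A B : nat -> R) :
  gsum J K (fun j k => A k * B j) = sum_n A (pred K) * sum_n B (pred J).
Proof.
  unfold gsum.
  rewrite (sum_n_ext _ (fun j => sum_n A (pred K) * B j)).
  - apply (sum_n_mult_l (K := R_Ring)).
  - intros j. apply (sum_n_mult_r (K := R_Ring)).
Qed.

Lemma sum_n_ge_term (f : nat -> R) (n i : nat) :
  (forall i, (i <= n)%nat -> 0 <= f i) -> (i <= n)%nat -> f i <= sum_n f n.
Proof.
  induction n as [|n IH]; intros Hf Hi.
  - replace i with 0%nat by lia. rewrite sum_O. lra.
  - rewrite sum_Sn. change plus with Rplus. destruct (Nat.eq_dec i (S n)) as [->|Hne].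
    + assert (H : 0 <= sum_n f n).
      { rewrite <- (sum_n_zero n). apply sum_n_le_loc. intros; apply Hf; lia. }
      simpl. unfold plus; simpl. lra.
    + assert (H : f i <= sum_n f n) by (apply IH; [intros; apply Hf; lia | lia]).
      assert (H' := Hf (S n) (le_n _)). unfold plus; simpl. lra.
Qed.

Lemma gsum_ge_term (J K : nat) (f : nat -> nat -> R) (j k : nat) :
  (forall j k, (j < J)%nat -> (k < K)%nat -> 0 <= f j k) ->
  (j < J)%nat -> (k < K)%nat -> f j k <= gsum J K f.
Proof.
  intros Hf Hj Hk.
  apply Rle_trans with (sum_n (fun k => f j k) (pred K)).
  - apply (sum_n_ge_term (fun k => f j k)); [intros; apply Hf; lia | lia].
  - apply (sum_n_ge_term (fun j => sum_n (fun k => f j k) (pred K))); [| lia].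
    intros i Hi. rewrite <- (sum_n_zero (pred K)). apply sum_n_le_loc.
    intros; apply Hf; lia.
Qed.

(** * Summation by parts *)

Lemma sum_by_parts_line (v w : nat -> C) (n : nat) :
  w 0%nat = RtoC 0 ->
  sum_n (fun j => dot (w (S j) - w j) (v (S j) - v j)
                  + dot (w j) (v (S j) - RtoC 2 * v j + v (pred j))) n
  = dot (w (S n)) (v (S n) - v n).
Proof.
  intros H0. induction n as [|n IH].
  - rewrite sum_O, H0. simpl. unfold dot; simpl. ring.
  - rewrite sum_Sn, IH. unfold plus; simpl. unfold dot; simpl. ring.
Qed.

Definition grad_dot (h : R) (v w : gridfun) (j k : nat) : R :=
  dot (dxp h v j k) (dxp h w j k) + dot (dyp h v j k) (dyp h w j k).

(** The meaningless values of [laph] at index 0 are multiplied by [w = 0]. *)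
Lemma sum_by_parts (J K : nat) (h : R) (v w : gridfun) :
  (1 <= J)%nat -> (1 <= K)%nat -> h <> 0 -> X_JK J K w ->
  gsum J K (fun j k => dot (laph h h v j k) (w j k))
  = - gsum J K (grad_dot h v w).
Proof.
  intros HJ HK Hh [Hx Hy].
  assert (E1 : gsum J K (fun j k => dot (w (S j) k - w j k) (v (S j) k - v j k)
              + dot (w j k) (v (S j) k - RtoC 2 * v j k + v (pred j) k)) = 0).
  { rewrite gsum_switch. unfold gsum.
    rewrite <- (sum_n_zero (pred K)). apply sum_n_ext_loc. intros k Hk.
    rewrite (sum_by_parts_line (fun j => v j k) (fun j => w j k)).
    - replace (S (pred J)) with J by lia.
      destruct (Hx k) as [_ ->]; [lia |]. unfold dot; simpl; ring.
    - apply Hx; lia. }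
  assert (E2 : gsum J K (fun j k => dot (w j (S k) - w j k) (v j (S k) - v j k)
              + dot (w j k) (v j (S k) - RtoC 2 * v j k + v j (pred k))) = 0).
  { unfold gsum.
    rewrite <- (sum_n_zero (pred J)). apply sum_n_ext_loc. intros j Hj.
    rewrite (sum_by_parts_line (fun k => v j k) (fun k => w j k)).
    - replace (S (pred K)) with K by lia.
      destruct (Hy j) as [_ ->]; [lia |]. unfold dot; simpl; ring.
    - apply Hy; lia. }
  assert (E : gsum J K (fun j k => dot (laph h h v j k) (w j k))
              + gsum J K (grad_dot h v w) = 0); [| lra].
  rewrite <- gsum_plus.
  transitivity (/ h ^ 2 * (0 + 0)); [| ring].
  rewrite <- E1 at 1. rewrite <- E2. rewrite <- gsum_plus, <- gsum_scal.
  apply gsum_ext; auto. intros j k _ _.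
  assert (Hh2 : h ^ 2 <> 0) by (apply pow_nonzero; auto).
  unfold grad_dot, laph, dxp, dyp. rewrite !Cdiv_RtoC by auto.
  unfold dot; simpl; field; auto.
Qed.

(** * Discrete Sobolev inequalities *)

Definition mass (h : R) (J K : nat) (v : gridfun) : R :=
  h * h * gsum J K (fun j k => Cmod (v j k) ^ 2).

Definition dirichlet (h : R) (J K : nat) (v : gridfun) : R :=
  h * h * gsum J K (grad_dot h v v).

Lemma dot_self_nonneg z : 0 <= dot z z.
Proof. unfold dot. nra. Qed.

Lemma grad_dot_self_nonneg h v j k : 0 <= grad_dot h v v j k.
Proof. unfold grad_dot. apply Rplus_le_le_0_compat; apply dot_self_nonneg. Qed.

Lemma mass_nonneg h J K v : (1 <= J)%nat -> (1 <= K)%nat -> 0 <= mass h J K v.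
Proof.
  intros. apply Rmult_le_pos; [nra |]. apply gsum_nonneg; auto.
  intros; apply pow2_ge_0.
Qed.

Lemma dirichlet_nonneg h J K v : (1 <= J)%nat -> (1 <= K)%nat -> 0 <= dirichlet h J K v.
Proof.
  intros. apply Rmult_le_pos; [nra |]. apply gsum_nonneg; auto.
  intros; apply grad_dot_self_nonneg.
Qed.

Lemma norm2h_mass h J K v : norm2h h h J K v = sqrt (mass h J K v).
Proof. reflexivity. Qed.

Lemma norm2h_grad_dirichlet h J K v :
  (1 <= J)%nat -> (1 <= K)%nat -> norm2h_grad h h J K v = sqrt (dirichlet h J K v).
Proof.
  intros HJ HK. unfold norm2h_grad. rewrite !norm2h_mass.
  rewrite !pow2_sqrt by (apply mass_nonneg; auto).
  f_equal. unfold mass, dirichlet. rewrite <- Rmult_plus_distr_l, <- gsum_plus.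
  f_equal. apply gsum_ext; auto. intros j k _ _. unfold grad_dot.
  rewrite !Cmod_sqr. reflexivity.
Qed.

Lemma sum_n_shift (f : nat -> R) (n : nat) :
  sum_n (fun i => f (S i)) n = sum_n f n + f (S n) - f 0%nat.
Proof.
  induction n as [|n IH].
  - rewrite !sum_O. ring_R.
  - rewrite !sum_Sn, IH. ring_R.
Qed.

Lemma Cmod_sqr_jump (z w : C) :
  Cmod z ^ 2 <= Cmod w ^ 2 + Cmod (z - w) * (Cmod z + Cmod w).
Proof.
  assert (H : Cmod z <= Cmod w + Cmod (z - w)).
  { replace z with (w + (z - w))%C at 1 by ring. apply Cmod_triangle. }
  assert (H1 := Cmod_ge_0 z). assert (H2 := Cmod_ge_0 w). nra.
Qed.

Lemma Cmod_sqr_le_variation (v : nat -> C) (n j : nat) :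
  v 0%nat = RtoC 0 -> (j <= S n)%nat ->
  Cmod (v j) ^ 2
  <= sum_n (fun i => Cmod (v (S i) - v i) * (Cmod (v (S i)) + Cmod (v i))) n.
Proof.
  intros H0 Hj.
  assert (Hpos : forall i, 0 <= Cmod (v (S i) - v i) * (Cmod (v (S i)) + Cmod (v i))).
  { intros i. apply Rmult_le_pos; [apply Cmod_ge_0 |].
    apply Rplus_le_le_0_compat; apply Cmod_ge_0. }
  assert (Hz : Cmod (v 0%nat) ^ 2 = 0).
  { rewrite H0, Cmod_0. ring. }
  revert j Hj. induction n as [|n IH]; intros j Hj.
  - rewrite sum_O. generalize (Cmod_sqr_jump (v 1%nat) (v 0%nat)) (Hpos 0%nat).
    destruct j as [|[|j]]; [| | lia]; lra.
  - rewrite sum_Sn. change plus with Rplus.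
    destruct (Nat.eq_dec j (S (S n))) as [->|Hne].
    + generalize (Cmod_sqr_jump (v (S (S n))) (v (S n))) (IH (S n) (le_n _)).
      unfold plus; simpl. lra.
    + generalize (IH j ltac:(lia)) (Hpos (S n)). unfold plus; simpl. lra.
Qed.

(** Bounds [Cmod (v j k) ^ 2] for all [j] on the grid line [k] at once, when [v]
    vanishes at the start of the line. *)
Definition variation (J : nat) (v : gridfun) (k : nat) : R :=
  sum_n (fun j => Cmod (v (S j) k - v j k) * (Cmod (v (S j) k) + Cmod (v j k))) (pred J).

Lemma young_variation (d x y h theta : R) :
  0 < h -> 0 < theta ->
  d * (x + y) <= / h * (h * h * (theta * (d / h) ^ 2) + h * h * / (2 * theta) * (x ^ 2 + y ^ 2)).
Proof.
  intros Hh Ht.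
  apply Rmult_le_reg_l with (h * theta); [nra |].
  replace (h * theta * (/ h * (h * h * (theta * (d / h) ^ 2) + h * h * / (2 * theta) * (x ^ 2 + y ^ 2))))
    with ((theta * d) ^ 2 + h ^ 2 * (x ^ 2 + y ^ 2) / 2) by (field; lra).
  generalize (pow2_ge_0 (theta * d - h * (x + y) / 2)) (pow2_ge_0 (h * (x - y))). nra.
Qed.

Lemma Cmod_div_sqr (z : C) (h : R) : 0 < h -> Cmod (z / RtoC h) ^ 2 = (Cmod z / h) ^ 2.
Proof.
  intros Hh. unfold Rdiv. rewrite Rpow_mult_distr, !Cmod_sqr, Cdiv_RtoC by lra.
  unfold dot; simpl. field. lra.
Qed.

Lemma gsum_shift_x (J K : nat) (v : gridfun) :
  (1 <= J)%nat -> (1 <= K)%nat ->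
  (forall k, (k <= K)%nat -> v 0%nat k = RtoC 0 /\ v J k = RtoC 0) ->
  gsum J K (fun j k => Cmod (v (S j) k) ^ 2) = gsum J K (fun j k => Cmod (v j k) ^ 2).
Proof.
  intros HJ HK Hv.
  rewrite gsum_switch, (gsum_switch J K (fun j k => Cmod (v j k) ^ 2)).
  unfold gsum. apply sum_n_ext_loc. intros k Hk.
  rewrite (sum_n_shift (fun j => Cmod (v j k) ^ 2)).
  replace (S (pred J)) with J by lia.
  destruct (Hv k) as [-> ->]; [lia |]. ring_R.
Qed.

Lemma gsum_shift_y (J K : nat) (v : gridfun) :
  (1 <= J)%nat -> (1 <= K)%nat ->
  (forall j, (j <= J)%nat -> v j 0%nat = RtoC 0 /\ v j K = RtoC 0) ->
  gsum J K (fun j k => Cmod (v j (S k)) ^ 2) = gsum J K (fun j k => Cmod (v j k) ^ 2).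
Proof.
  intros HJ HK Hv.
  rewrite gsum_switch, (gsum_switch J K (fun j k => Cmod (v j k) ^ 2)).
  apply (gsum_shift_x K J (fun k j => v j k)); auto.
Qed.

Lemma variation_sum_le (J K : nat) (h theta : R) (v : gridfun) :
  (1 <= J)%nat -> (1 <= K)%nat -> 0 < h -> 0 < theta ->
  (forall k, (k <= K)%nat -> v 0%nat k = RtoC 0 /\ v J k = RtoC 0) ->
  h * sum_n (variation J v) (pred K)
  <= theta * (h * h * gsum J K (fun j k => Cmod (dxp h v j k) ^ 2))
     + mass h J K v / theta.
Proof.
  intros HJ HK Hh Ht Hv.
  replace (sum_n (variation J v) (pred K)) with
    (gsum J K (fun j k => Cmod (v (S j) k - v j k) * (Cmod (v (S j) k) + Cmod (v j k)))).
  2: { rewrite gsum_switch. reflexivity. }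
  assert (Hshift := gsum_shift_x J K v HJ HK Hv).
  apply Rle_trans with
    (h * (/ h * gsum J K (fun j k => h * h * theta * Cmod (dxp h v j k) ^ 2
         + (h * h * / (2 * theta)) * (Cmod (v (S j) k) ^ 2 + Cmod (v j k) ^ 2)))).
  - apply Rmult_le_compat_l; [lra |]. rewrite <- gsum_scal. apply gsum_le; auto.
    intros j k _ _. unfold dxp. rewrite Cmod_div_sqr by auto.
    generalize (young_variation (Cmod (v (S j) k - v j k)) (Cmod (v (S j) k)) (Cmod (v j k)) h theta Hh Ht).
    intros H; eapply Rle_trans; [exact H |]. apply Req_le; ring.
  - rewrite gsum_plus, !gsum_scal, gsum_plus, Hshift. unfold mass.
    apply Req_le. field. lra.
Qed.

(** With [theta = sqrt S] Young's inequality replaces the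
    Cauchy-Schwarz inequality for double sums. *)
Lemma le_sqrt_of_young (X D S : R) :
  0 <= D -> 0 <= S -> (forall theta, 0 < theta -> X <= theta * D + S / theta) ->
  X <= sqrt S * (D + 1).
Proof.
  intros HD HS H.
  destruct (Req_dec S 0) as [->|HS'].
  - rewrite sqrt_0, Rmult_0_l. destruct (Rle_dec X 0) as [|HX]; [auto |].
    assert (Ht : 0 < X / (2 * (D + 1))) by (apply Rdiv_lt_0_compat; lra).
    specialize (H _ Ht).
    replace (0 / (X / (2 * (D + 1)))) with 0 in H by (field; lra).
    assert (E : X / (2 * (D + 1)) * D = X / 2 - X / (2 * (D + 1))) by (field; lra).
    lra.
  - assert (Hs : 0 < sqrt S) by (apply sqrt_lt_R0; lra).
    specialize (H _ Hs). rewrite <- (sqrt_sqrt S HS) in H at 2.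
    replace (sqrt S * sqrt S / sqrt S) with (sqrt S) in H by (field; lra). lra.
Qed.

Lemma mass_transpose h J K v : mass h K J (fun k j => v j k) = mass h J K v.
Proof. unfold mass. rewrite gsum_switch. reflexivity. Qed.

Lemma variation_le (J K : nat) (h : R) (v : gridfun) :
  (1 <= J)%nat -> (1 <= K)%nat -> 0 < h -> X_JK J K v ->
  h * sum_n (variation J v) (pred K) <= sqrt (mass h J K v) * (dirichlet h J K v + 1)
  /\ h * sum_n (variation K (fun k j => v j k)) (pred J)
     <= sqrt (mass h J K v) * (dirichlet h J K v + 1).
Proof.
  intros HJ HK Hh HX. split.
  - apply le_sqrt_of_young; [apply dirichlet_nonneg; auto | apply mass_nonneg; auto |].
    intros theta Ht. eapply Rle_trans; [apply (variation_sum_le J K h theta v); auto; apply HX |].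
    apply Rplus_le_compat_r, Rmult_le_compat_l; [lra |].
    apply Rmult_le_compat_l; [nra |]. apply gsum_le; auto. intros j k _ _.
    unfold grad_dot. rewrite Cmod_sqr. generalize (dot_self_nonneg (dyp h v j k)). lra.
  - apply le_sqrt_of_young; [apply dirichlet_nonneg; auto | apply mass_nonneg; auto |].
    intros theta Ht.
    eapply Rle_trans; [apply (variation_sum_le K J h theta (fun k j => v j k)); auto; apply HX |].
    rewrite mass_transpose.
    apply Rplus_le_compat_r, Rmult_le_compat_l; [lra |].
    apply Rmult_le_compat_l; [nra |].
    rewrite gsum_switch. apply gsum_le; auto. intros j k _ _.
    unfold grad_dot. rewrite Cmod_sqr. generalize (dot_self_nonneg (dxp h v j k)).
    unfold dxp, dyp. lra.
Qed.

Lemma variation_nonneg J v k : 0 <= variation J v k.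
Proof.
  unfold variation. rewrite <- (sum_n_zero (pred J)). apply sum_n_le_loc. intros.
  apply Rmult_le_pos; [apply Cmod_ge_0 |]. apply Rplus_le_le_0_compat; apply Cmod_ge_0.
Qed.

Lemma sup_le_dirichlet (J K : nat) (h : R) (v : gridfun) (j k : nat) :
  (1 <= J)%nat -> (1 <= K)%nat -> 0 < h -> X_JK J K v -> (j <= J)%nat -> (k < K)%nat ->
  h * Cmod (v j k) ^ 2 <= sqrt (mass h J K v) * (dirichlet h J K v + 1).
Proof.
  intros HJ HK Hh HX Hj Hk.
  destruct (variation_le J K h v HJ HK Hh HX) as [H _].
  eapply Rle_trans; [| exact H].
  apply Rmult_le_compat_l; [lra |].
  apply Rle_trans with (variation J v k).
  - apply (Cmod_sqr_le_variation (fun j => v j k)); [apply HX; lia | lia].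
  - apply (sum_n_ge_term (variation J v)); [intros; apply variation_nonneg | lia].
Qed.

(** [|v|^4] is at most the product of a function of [k] alone and a function of
    [j] alone, the variations along the two grid lines through the node, so its
    double sum factors. *)
Lemma ladyzhenskaya (J K : nat) (h : R) (v : gridfun) :
  (1 <= J)%nat -> (1 <= K)%nat -> 0 < h -> X_JK J K v ->
  h * h * gsum J K (fun j k => Cmod (v j k) ^ 4)
  <= mass h J K v * (dirichlet h J K v + 1) ^ 2.
Proof.
  intros HJ HK Hh HX.
  destruct (variation_le J K h v HJ HK Hh HX) as [H1 H2].
  assert (Hm := mass_nonneg h J K v HJ HK).
  apply Rle_trans with (h * h * gsum J K (fun j k => variation J v k * variation K (fun k j => v j k) j)).
  - apply Rmult_le_compat_l; [nra |]. apply gsum_le; auto. intros j k Hj Hk.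
    replace (Cmod (v j k) ^ 4) with (Cmod (v j k) ^ 2 * Cmod (v j k) ^ 2) by ring.
    apply Rmult_le_compat; try apply pow2_ge_0.
    + apply (Cmod_sqr_le_variation (fun j => v j k)); [apply HX; lia | lia].
    + apply (Cmod_sqr_le_variation (fun k => v j k)); [apply HX; lia | lia].
  - rewrite gsum_prod. rewrite <- (sqrt_sqrt _ Hm) at 1.
    set (A := sum_n (variation J v) (pred K)) in *.
    set (B := sum_n (variation K (fun k j => v j k)) (pred J)) in *.
    replace (h * h * (A * B)) with ((h * A) * (h * B)) by ring.
    replace (sqrt (mass h J K v) * sqrt (mass h J K v) * (dirichlet h J K v + 1) ^ 2)
      with ((sqrt (mass h J K v) * (dirichlet h J K v + 1)) * (sqrt (mass h J K v) * (dirichlet h J K v + 1))) by ring.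
    apply Rmult_le_compat; auto; apply Rmult_le_pos; try lra.
    + rewrite <- (sum_n_zero (pred K)). apply sum_n_le_loc. intros; apply variation_nonneg.
    + rewrite <- (sum_n_zero (pred J)). apply sum_n_le_loc. intros; apply variation_nonneg.
Qed.

(** * Structure of the scheme: weak form, mass and energy *)

Definition mid (z w : C) : C := ((z + w) / RtoC 2)%C.

(** The gauge-invariant part of the nonlinearity is the real factor [gain] times
    the mean of the two levels. *)
Definition gain (lambda nu : R) (z w : C) : R :=
  lambda * ((Cmod z ^ 2 + Cmod w ^ 2) / 2)
  - nu * ((Cmod z ^ 4 + Cmod z ^ 2 * Cmod w ^ 2 + Cmod w ^ 4) / 3).

Definition nonlin (lambda nu eps : R) (z w : C) : C :=
  (RtoC lambda * psi1 z w - RtoC nu * psi2 z w + Ci * RtoC eps * phi z w)%C.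

Lemma nonlin_gain lambda nu eps z w :
  nonlin lambda nu eps z w
  = (RtoC (gain lambda nu z w) * mid z w + Ci * RtoC eps * phi z w)%C.
Proof.
  unfold nonlin, psi1, psi2, gain, mid.
  rewrite RtoC_minus, !RtoC_mult. ring.
Qed.

Definition residual (lambda nu eps h tau : R) (V : nat -> gridfun) (n : nat) : gridfun :=
  fun j k => (Ci * dtp tau V n j k + laph h h (midlevel V n) j k
              + nonlin lambda nu eps (V (S n) j k) (V n j k))%C.

(** Used for the scheme itself, with [Rs = 0], and for the error equation. *)
Lemma weak_form (J K : nat) (h : R) (D V Nl Rs w : gridfun) :
  (1 <= J)%nat -> (1 <= K)%nat -> h <> 0 -> X_JK J K w ->
  (forall j k, (1 <= j <= J - 1)%nat -> (1 <= k <= K - 1)%nat ->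
     (Ci * D j k + laph h h V j k + Nl j k)%C = Rs j k) ->
  gsum J K (fun j k => dot (Ci * D j k) (w j k) + dot (Nl j k) (w j k)
                       - dot (Rs j k) (w j k))
  = gsum J K (grad_dot h V w).
Proof.
  intros HJ HK Hh Hw Heq.
  assert (H := sum_by_parts J K h V w HJ HK Hh Hw).
  assert (H' : gsum J K (fun j k => (dot (Ci * D j k) (w j k) + dot (Nl j k) (w j k)
                       - dot (Rs j k) (w j k)) + dot (laph h h V j k) (w j k)) = 0).
  { rewrite <- (gsum_zero J K). apply gsum_ext; auto. intros j k Hj Hk.
    destruct Hw as [Hx Hy].
    destruct (Nat.eq_dec j 0) as [->|Hj0].
    { destruct (Hx k) as [-> _]; [lia |]. unfold dot; simpl; ring. }
    destruct (Nat.eq_dec k 0) as [->|Hk0].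
    { destruct (Hy j) as [-> _]; [lia |]. unfold dot; simpl; ring. }
    rewrite <- Heq by lia. unfold dot; simpl; ring. }
  rewrite gsum_plus in H'. lra.
Qed.

Lemma X_JK_map2 J K (f : C -> C -> C) v w :
  f 0 0 = 0 -> X_JK J K v -> X_JK J K w -> X_JK J K (fun j k => f (v j k) (w j k)).
Proof.
  intros Hf [Hx Hy] [Hx' Hy']. split.
  - intros k Hk. destruct (Hx k Hk) as [-> ->]. destruct (Hx' k Hk) as [-> ->]. auto.
  - intros j Hj. destruct (Hy j Hj) as [-> ->]. destruct (Hy' j Hj) as [-> ->]. auto.
Qed.

Lemma X_JK_map J K (f : C -> C) v : f 0 = 0 -> X_JK J K v -> X_JK J K (fun j k => f (v j k)).
Proof. intros Hf Hv. apply (X_JK_map2 J K (fun z _ => f z) v v); auto. Qed.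

Lemma X_JK_midlevel J K U n : X_JK J K (U n) -> X_JK J K (U (S n)) -> X_JK J K (midlevel U n).
Proof.
  intros H0 H1. apply (X_JK_map2 J K (fun z w => (z + w) / RtoC 2)%C); auto.
  unfold Cdiv. ring.
Qed.

Lemma X_JK_dtp J K tau U n :
  X_JK J K (U n) -> X_JK J K (U (S n)) -> X_JK J K (dtp tau U n).
Proof.
  intros H0 H1. apply (X_JK_map2 J K (fun z w => (z - w) / RtoC tau)%C); auto.
  unfold Cdiv. ring.
Qed.

Definition cubic (z : C) : C := (RtoC (Cmod z ^ 2) * z)%C.

Lemma phi_cubic z w : phi z w = cubic (mid z w).
Proof. reflexivity. Qed.

Lemma cubic_0 : cubic 0 = 0.
Proof. unfold cubic. ring. Qed.

(** The source of the sign of the damping, in the energy estimate (with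
    differences in space) and in the error estimate (exact minus discrete). *)
Lemma cubic_monotone (z w : C) : 0 <= dot (z - w) (cubic z - cubic w).
Proof.
  unfold cubic. rewrite !Cmod_sqr.
  replace (dot (z - w) (RtoC (dot z z) * z - RtoC (dot w w) * w))
    with ((dot z z - dot w w) ^ 2 / 2 + (dot z z + dot w w) * dot (z - w) (z - w) / 2)
    by (unfold dot; simpl; field).
  generalize (dot_self_nonneg z) (dot_self_nonneg w) (dot_self_nonneg (z - w))
    (pow2_ge_0 (dot z z - dot w w)). intros.
  assert (0 <= (dot z z + dot w w) * dot (z - w) (z - w)) by (apply Rmult_le_pos; lra).
  lra.
Qed.

Lemma grad_dot_cubic_nonneg h (v : gridfun) j k :
  0 < h -> 0 <= grad_dot h v (fun j k => cubic (v j k)) j k.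
Proof.
  intros Hh.
  assert (E : forall z w, dot (z / RtoC h) (w / RtoC h) = dot z w / (h * h)).
  { intros z w. rewrite !Cdiv_RtoC by lra. unfold dot; simpl. field. lra. }
  unfold grad_dot, dxp, dyp. rewrite !E.
  apply Rplus_le_le_0_compat; (apply Rdiv_le_0_compat; [apply cubic_monotone | nra]).
Qed.

(** Testing with [i (U^{n+1} + U^n) / 2] kills the dispersion and the
    gauge-invariant part of the nonlinearity; only the damping is left. *)
Lemma mass_decreasing (lambda nu eps h tau : R) (J K n : nat) (U : nat -> gridfun) :
  (1 <= J)%nat -> (1 <= K)%nat -> 0 < h -> 0 < tau -> 0 <= eps ->
  X_JK J K (U n) -> X_JK J K (U (S n)) ->
  (forall j k, (1 <= j <= J - 1)%nat -> (1 <= k <= K - 1)%nat ->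
     residual lambda nu eps h tau U n j k = RtoC 0) ->
  mass h J K (U (S n)) <= mass h J K (U n).
Proof.
  intros HJ HK Hh Ht He X0 X1 Heq.
  assert (Xm := X_JK_midlevel J K U n X0 X1).
  assert (W := weak_form J K h (dtp tau U n) (midlevel U n)
    (fun j k => nonlin lambda nu eps (U (S n) j k) (U n j k)) (fun _ _ => RtoC 0)
    (fun j k => Ci * midlevel U n j k)%C HJ HK ltac:(lra)
    (X_JK_map J K (fun z => Ci * z)%C _ ltac:(apply Cmult_0_r) Xm) Heq).
  assert (G : gsum J K (grad_dot h (midlevel U n) (fun j k => Ci * midlevel U n j k)%C) = 0).
  { rewrite <- (gsum_zero J K). apply gsum_ext; auto. intros j k _ _.
    unfold grad_dot, dxp, dyp. rewrite !Cdiv_RtoC by lra. unfold dot; simpl. field. lra. }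
  rewrite G in W. clear G.
  assert (P : gsum J K (fun j k => / (2 * tau) * (Cmod (U (S n) j k) ^ 2 - Cmod (U n j k) ^ 2)) <= 0).
  { rewrite <- W. apply gsum_le; auto. intros j k _ _.
    rewrite nonlin_gain. unfold midlevel, dtp, phi. fold (mid (U (S n) j k) (U n j k)).
    assert (Hm := pow2_ge_0 (Cmod (mid (U (S n) j k) (U n j k)) ^ 2)).
    rewrite !Cmod_sqr in *. rewrite Cdiv_RtoC by lra.
    apply Rle_trans with (/ (2 * tau) * (dot (U (S n) j k) (U (S n) j k) - dot (U n j k) (U n j k))
       + eps * dot (mid (U (S n) j k) (U n j k)) (mid (U (S n) j k) (U n j k)) ^ 2); [nra |].
    apply Req_le. unfold mid. rewrite Cdiv_RtoC by lra. unfold dot; simpl. field. lra. }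
  rewrite gsum_scal, gsum_minus in P. unfold mass.
  assert (Hi : 0 < / (2 * tau)) by (apply Rinv_0_lt_compat; lra).
  apply Rmult_le_compat_l; [nra |]. nra.
Qed.

Definition potential (lambda nu : R) (z : C) : R :=
  lambda / 4 * Cmod z ^ 4 - nu / 6 * Cmod z ^ 6.

Definition energy (lambda nu h : R) (J K : nat) (v : gridfun) : R :=
  dirichlet h J K v / 2 - h * h * gsum J K (fun j k => potential lambda nu (v j k)).

(** [psi1] and [psi2] are chosen so that pairing with the time difference
    telescopes exactly. *)
Lemma gain_potential lambda nu z w tau :
  tau <> 0 ->
  dot (RtoC (gain lambda nu z w) * mid z w) ((z - w) / RtoC tau)
  = (potential lambda nu z - potential lambda nu w) / tau.
Proof.
  intros Ht. unfold gain, potential, mid.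
  replace (Cmod z ^ 6) with ((Cmod z ^ 2) ^ 3) by ring.
  replace (Cmod w ^ 6) with ((Cmod w ^ 2) ^ 3) by ring.
  rewrite !Cmod_pow4, !Cmod_sqr, !Cdiv_RtoC by (auto; lra).
  unfold dot; simpl. field. auto.
Qed.

Lemma grad_midlevel_dtp h tau U n j k :
  h <> 0 -> tau <> 0 ->
  grad_dot h (midlevel U n) (dtp tau U n) j k
  = / (2 * tau) * (grad_dot h (U (S n)) (U (S n)) j k - grad_dot h (U n) (U n) j k).
Proof.
  intros Hh Ht. unfold grad_dot, dxp, dyp, midlevel, dtp.
  rewrite !Cdiv_RtoC by (auto; lra). unfold dot; simpl. field. auto.
Qed.

(** The quintic term dominates the cubic one, so that the damping
    increases the energy at most linearly in the mass. *)
Lemma gain_times_pow4_le lambda nu z w :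
  0 < nu ->
  gain lambda nu z w * Cmod (mid z w) ^ 4
  <= Rabs lambda ^ 3 / nu ^ 2 * ((Cmod z ^ 2 + Cmod w ^ 2) / 2).
Proof.
  intros Hnu.
  assert (Hp : Cmod (mid z w) ^ 2 <= (Cmod z ^ 2 + Cmod w ^ 2) / 2).
  { unfold mid. rewrite !Cmod_sqr, Cdiv_RtoC by lra. unfold dot; simpl.
    generalize (pow2_ge_0 (fst z - fst w)) (pow2_ge_0 (snd z - snd w)). lra. }
  assert (Hp0 := pow2_ge_0 (Cmod (mid z w))).
  replace (Cmod (mid z w) ^ 4) with (Cmod (mid z w) ^ 2 * Cmod (mid z w) ^ 2) by ring.
  set (p := Cmod (mid z w) ^ 2) in *.
  assert (Hg : gain lambda nu z w <= lambda * ((Cmod z ^ 2 + Cmod w ^ 2) / 2)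
     - nu * ((Cmod z ^ 2 + Cmod w ^ 2) / 2) ^ 2).
  { unfold gain. generalize (pow2_ge_0 (Cmod z ^ 2 - Cmod w ^ 2)). intros.
    assert (0 <= nu * (Cmod z ^ 2 - Cmod w ^ 2) ^ 2) by nra. lra. }
  set (g := (Cmod z ^ 2 + Cmod w ^ 2) / 2) in *.
  set (l := Rabs lambda). assert (Hl : lambda <= l) by apply Rle_abs.
  assert (Hl0 : 0 <= l) by apply Rabs_pos.
  assert (HC : 0 <= l ^ 3 / nu ^ 2).
  { apply Rdiv_le_0_compat; [apply pow_le; auto | apply pow_lt; auto]. }
  destruct (Rle_dec g (l / nu)) as [Hs|Hb].
  - (* small amplitude: bound two of the three factors by [l / nu] *)
    apply Rle_trans with (l * g * (p * p)).
    + apply Rmult_le_compat_r; nra.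
    + apply Rle_trans with (l * g * ((l / nu) * (l / nu))).
      * apply Rmult_le_compat_l; [apply Rmult_le_pos; lra |]. apply Rmult_le_compat; lra.
      * apply Req_le. field. lra.
  - (* large amplitude: the gain is negative *)
    assert (Hneg : gain lambda nu z w <= 0).
    { assert (l < nu * g).
      { apply Rnot_le_lt in Hb. apply (Rmult_lt_compat_l nu) in Hb; [| auto].
        replace (nu * (l / nu)) with l in Hb by (field; lra). auto. }
      nra. }
    apply Rle_trans with 0; [| apply Rmult_le_pos; lra].
    assert (0 <= p * p) by nra. nra.
Qed.

(** Testing with the time difference gives the energy balance.  The damping
    contribution contains a time difference, which the scheme, tested with
    [cubic (mid U)], replaces by a monotone gradient term and by
    [gain * |mid U|^4]. *)
Lemma energy_step (lambda nu eps h tau : R) (J K n : nat) (U : nat -> gridfun) :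
  (1 <= J)%nat -> (1 <= K)%nat -> 0 < h -> 0 < tau -> 0 < nu -> 0 <= eps ->
  X_JK J K (U n) -> X_JK J K (U (S n)) ->
  (forall j k, (1 <= j <= J - 1)%nat -> (1 <= k <= K - 1)%nat ->
     residual lambda nu eps h tau U n j k = RtoC 0) ->
  energy lambda nu h J K (U (S n))
  <= energy lambda nu h J K (U n)
     + tau * (eps * (Rabs lambda ^ 3 / nu ^ 2) * mass h J K (U n)).
Proof.
  intros HJ HK Hh Ht Hnu He X0 X1 Heq.
  assert (Hmass := mass_decreasing lambda nu eps h tau J K n U HJ HK Hh Ht He X0 X1 Heq).
  assert (Xm := X_JK_midlevel J K U n X0 X1).
  assert (Xd := X_JK_dtp J K tau U n X0 X1).
  set (Nl := fun j k => nonlin lambda nu eps (U (S n) j k) (U n j k)).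
  set (G := fun j k => gain lambda nu (U (S n) j k) (U n j k)).
  set (M4 := fun j k => Cmod (mid (U (S n) j k) (U n j k)) ^ 4).
  assert (W1 := weak_form J K h (dtp tau U n) (midlevel U n) Nl (fun _ _ => RtoC 0)
    (dtp tau U n) HJ HK ltac:(lra) Xd Heq).
  assert (W2 := weak_form J K h (dtp tau U n) (midlevel U n) Nl (fun _ _ => RtoC 0)
    (fun j k => cubic (midlevel U n j k)) HJ HK ltac:(lra)
    (X_JK_map J K cubic _ cubic_0 Xm) Heq).
  assert (E1 : gsum J K (grad_dot h (midlevel U n) (dtp tau U n))
     + eps * gsum J K (grad_dot h (midlevel U n) (fun j k => cubic (midlevel U n j k)))
     = / tau * (gsum J K (fun j k => potential lambda nu (U (S n) j k))
                - gsum J K (fun j k => potential lambda nu (U n j k)))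
       + eps * gsum J K (fun j k => G j k * M4 j k)).
  { rewrite <- W1, <- W2, <- gsum_minus, <- !gsum_scal, <- !gsum_plus.
    apply gsum_ext; auto. intros j k _ _.
    replace (/ tau * (potential lambda nu (U (S n) j k) - potential lambda nu (U n j k)))
      with ((potential lambda nu (U (S n) j k) - potential lambda nu (U n j k)) / tau)
      by (field; lra).
    rewrite <- gain_potential by lra.
    unfold Nl, G, M4, dtp, midlevel. rewrite nonlin_gain, phi_cubic.
    fold (mid (U (S n) j k) (U n j k)).
    set (d := ((U (S n) j k - U n j k) / RtoC tau)%C).
    set (m := mid (U (S n) j k) (U n j k)). set (g := gain _ _ _ _).
    unfold cubic. rewrite Cmod_pow4, Cmod_sqr. unfold dot; simpl. ring. }
  assert (E2 : gsum J K (grad_dot h (midlevel U n) (dtp tau U n))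
     = / (2 * tau) * (gsum J K (grad_dot h (U (S n)) (U (S n))) - gsum J K (grad_dot h (U n) (U n)))).
  { rewrite <- gsum_minus, <- gsum_scal. apply gsum_ext; auto. intros j k _ _.
    apply grad_midlevel_dtp; lra. }
  assert (E3 : 0 <= gsum J K (grad_dot h (midlevel U n) (fun j k => cubic (midlevel U n j k)))).
  { apply gsum_nonneg; auto. intros; apply grad_dot_cubic_nonneg; auto. }
  set (c := Rabs lambda ^ 3 / nu ^ 2) in *.
  assert (Hc : 0 <= c).
  { apply Rdiv_le_0_compat; [apply pow_le, Rabs_pos | apply pow_lt; auto]. }
  assert (E4 : h * h * gsum J K (fun j k => G j k * M4 j k) <= c * mass h J K (U n)).
  { apply Rle_trans with (c * ((mass h J K (U (S n)) + mass h J K (U n)) / 2)); [| nra].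
    unfold mass. rewrite <- Rmult_plus_distr_l, <- gsum_plus.
    replace (c * (h * h * gsum J K (fun j k => Cmod (U (S n) j k) ^ 2 + Cmod (U n j k) ^ 2) / 2))
      with (h * h * (c / 2 * gsum J K (fun j k => Cmod (U (S n) j k) ^ 2 + Cmod (U n j k) ^ 2))) by field.
    apply Rmult_le_compat_l; [nra |]. rewrite <- gsum_scal. apply gsum_le; auto. intros j k _ _.
    unfold G, M4. generalize (gain_times_pow4_le lambda nu (U (S n) j k) (U n j k) Hnu).
    fold c. lra. }
  unfold energy, dirichlet.
  set (D1 := gsum J K (grad_dot h (U (S n)) (U (S n)))) in *.
  set (D0 := gsum J K (grad_dot h (U n) (U n))) in *.
  set (P1 := gsum J K (fun j k => potential lambda nu (U (S n) j k))) in *.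
  set (P0 := gsum J K (fun j k => potential lambda nu (U n j k))) in *.
  set (GM := gsum J K (fun j k => G j k * M4 j k)) in *.
  set (Q := gsum J K (grad_dot h (midlevel U n) (fun j k => cubic (midlevel U n j k)))) in *.
  rewrite E2 in E1.
  assert (E5 : (D1 - D0) / 2 - (P1 - P0) = tau * eps * (GM - Q)).
  { apply Rmult_eq_reg_l with (/ tau); [| apply Rinv_neq_0_compat; lra].
    replace (/ tau * (tau * eps * (GM - Q))) with (eps * GM - eps * Q) by (field; lra).
    assert (/ tau * ((D1 - D0) / 2) = / (2 * tau) * (D1 - D0)) by (field; lra). lra. }
  assert (Hte : 0 <= tau * eps) by (apply Rmult_le_pos; lra).
  assert (Hh2 : 0 < h * h) by nra.
  assert (E6 : h * h * (tau * eps * (GM - Q)) <= tau * (eps * c * mass h J K (U n))).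
  { replace (h * h * (tau * eps * (GM - Q))) with (tau * eps * (h * h * GM) - tau * eps * (h * h * Q)) by ring.
    assert (0 <= tau * eps * (h * h * Q)) by (repeat apply Rmult_le_pos; lra).
    assert (tau * eps * (h * h * GM) <= tau * eps * (c * mass h J K (U n))) by (apply Rmult_le_compat_l; auto).
    lra. }
  rewrite <- E5 in E6. lra.
Qed.

Lemma dirichlet_le_energy lambda nu h J K v :
  (1 <= J)%nat -> (1 <= K)%nat -> 0 < nu ->
  dirichlet h J K v <= 2 * energy lambda nu h J K v
                       + 3 * lambda ^ 2 / (16 * nu) * mass h J K v.
Proof.
  intros HJ HK Hnu. unfold energy.
  assert (h * h * gsum J K (fun j k => potential lambda nu (v j k))
          <= 3 * lambda ^ 2 / (32 * nu) * mass h J K v).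
  { unfold mass. replace (3 * lambda ^ 2 / (32 * nu) * (h * h * gsum J K (fun j k => Cmod (v j k) ^ 2)))
      with (h * h * (3 * lambda ^ 2 / (32 * nu) * gsum J K (fun j k => Cmod (v j k) ^ 2))) by ring.
    apply Rmult_le_compat_l; [nra |]. rewrite <- gsum_scal. apply gsum_le; auto. intros j k _ _.
    unfold potential. set (x := Cmod (v j k) ^ 2).
    replace (Cmod (v j k) ^ 4) with (x ^ 2) by (unfold x; ring).
    replace (Cmod (v j k) ^ 6) with (x ^ 3) by (unfold x; ring).
    assert (Hx : 0 <= x) by apply pow2_ge_0.
    (* completing the square in [nu / 6 x^2 - lambda / 4 x] *)
    replace (3 * lambda ^ 2 / (32 * nu) * x) with
      (lambda / 4 * x ^ 2 - nu / 6 * x ^ 3 + x * (nu / 6 * (x - 3 * lambda / (4 * nu)) ^ 2))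
      by (field; lra).
    assert (0 <= x * (nu / 6 * (x - 3 * lambda / (4 * nu)) ^ 2)).
    { apply Rmult_le_pos; auto. apply Rmult_le_pos; [lra | apply pow2_ge_0]. }
    lra. }
  replace (3 * lambda ^ 2 / (16 * nu)) with (2 * (3 * lambda ^ 2 / (32 * nu))) by (field; lra).
  lra.
Qed.

(** * Pointwise estimates of the nonlinearity *)

Lemma Cmod_sqr_perturb (M : R) (z e : C) :
  Cmod z <= M ->
  Rabs (Cmod z ^ 2 - Cmod (z - e) ^ 2) <= Cmod e * (2 * M + Cmod e)
  /\ Cmod (z - e) <= M + Cmod e.
Proof.
  intros Hz.
  assert (H1 : Cmod (z - e) <= Cmod z + Cmod e) by apply Cmod_triangle_minus.
  assert (H2 : Cmod z <= Cmod (z - e) + Cmod e).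
  { replace z with ((z - e) + e)%C at 1 by ring. apply Cmod_triangle. }
  assert (H3 := Cmod_ge_0 z). assert (H4 := Cmod_ge_0 (z - e)). assert (H5 := Cmod_ge_0 e).
  split; [| lra]. apply Rabs_le. nra.
Qed.

Lemma pow5_sum_le (x y : R) : 0 <= x -> 0 <= y -> (x + y) ^ 5 <= 16 * (x ^ 5 + y ^ 5).
Proof.
  intros Hx Hy.
  assert (H2 : (x + y) ^ 2 <= 2 * (x ^ 2 + y ^ 2)) by (generalize (pow2_ge_0 (x - y)); nra).
  assert (H4 : (x + y) ^ 4 <= 8 * (x ^ 4 + y ^ 4)).
  { generalize (pow2_ge_0 (x ^ 2 - y ^ 2)) (pow2_ge_0 (x + y)) (pow2_ge_0 x) (pow2_ge_0 y). nra. }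
  assert (H : (x ^ 4 - y ^ 4) * (x - y) >= 0).
  { replace ((x ^ 4 - y ^ 4) * (x - y)) with ((x - y) ^ 2 * ((x + y) * (x ^ 2 + y ^ 2))) by ring.
    apply Rle_ge, Rmult_le_pos; [apply pow2_ge_0 |]. apply Rmult_le_pos; nra. }
  replace ((x + y) ^ 5) with ((x + y) * (x + y) ^ 4) by ring.
  apply Rle_trans with ((x + y) * (8 * (x ^ 4 + y ^ 4))); [apply Rmult_le_compat_l; lra |]. nra.
Qed.

Lemma growth_poly (x y : R) :
  0 <= x -> 0 <= y ->
  (x + y) ^ 2 * (1 + (x + y)) ^ 3 <= 64 * (x ^ 2 + y ^ 2 + (x ^ 5 + y ^ 5)).
Proof.
  intros Hx Hy. set (X := x + y). assert (HX : 0 <= X) by (unfold X; lra).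
  assert (H3 : (1 + X) ^ 3 <= 4 * (1 + X ^ 3)) by (generalize (pow2_ge_0 (1 - X)); nra).
  assert (H2 : X ^ 2 <= 2 * (x ^ 2 + y ^ 2)) by (unfold X; generalize (pow2_ge_0 (x - y)); nra).
  assert (H5 : X ^ 5 <= 16 * (x ^ 5 + y ^ 5)) by (apply pow5_sum_le; auto).
  assert (0 <= x ^ 2) by apply pow2_ge_0. assert (0 <= y ^ 2) by apply pow2_ge_0.
  apply Rle_trans with (X ^ 2 * (4 * (1 + X ^ 3))).
  - apply Rmult_le_compat_l; [apply pow2_ge_0 | auto].
  - replace (X ^ 2 * (4 * (1 + X ^ 3))) with (4 * X ^ 2 + 4 * X ^ 5) by ring. lra.
Qed.

Lemma gain_perturb (lambda nu M : R) (z w e f : C) :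
  0 < nu -> 1 <= M -> Cmod z <= M -> Cmod w <= M ->
  Rabs (gain lambda nu z w - gain lambda nu (z - e) (w - f))
  <= 2 * M * (Rabs lambda + 2 * nu * M ^ 2)
     * ((Cmod e + Cmod f) * (1 + (Cmod e + Cmod f)) ^ 3).
Proof.
  intros Hnu HM Hz Hw.
  destruct (Cmod_sqr_perturb M z e Hz) as [Da Ha'].
  destruct (Cmod_sqr_perturb M w f Hw) as [Db Hb'].
  assert (He := Cmod_ge_0 e). assert (Hf := Cmod_ge_0 f).
  set (X := Cmod e + Cmod f).
  assert (HX : 0 <= X) by (unfold X; lra).
  assert (HeX : Cmod e <= X) by (unfold X; lra). assert (HfX : Cmod f <= X) by (unfold X; lra).
  assert (HMX : X <= M * X) by nra.
  assert (Hz0 := Cmod_ge_0 z). assert (Hw0 := Cmod_ge_0 w).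
  assert (Hz1 := Cmod_ge_0 (z - e)). assert (Hw1 := Cmod_ge_0 (w - f)).
  unfold gain.
  set (a := Cmod z ^ 2) in *. set (b := Cmod w ^ 2) in *.
  set (a' := Cmod (z - e) ^ 2) in *. set (b' := Cmod (w - f) ^ 2) in *.
  replace (Cmod z ^ 4) with (a ^ 2) by (unfold a; ring).
  replace (Cmod w ^ 4) with (b ^ 2) by (unfold b; ring).
  replace (Cmod (z - e) ^ 4) with (a' ^ 2) by (unfold a'; ring).
  replace (Cmod (w - f) ^ 4) with (b' ^ 2) by (unfold b'; ring).
  set (Y := M ^ 2 * (1 + X) ^ 2).
  assert (BY : forall r, 0 <= r <= M + X -> 0 <= r ^ 2 <= Y).
  { intros r Hr. split; [apply pow2_ge_0 |]. unfold Y. rewrite <- Rpow_mult_distr. apply pow_incr. nra. }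
  assert (Ba : 0 <= a <= Y) by (apply BY; lra). assert (Bb : 0 <= b <= Y) by (apply BY; lra).
  assert (Ba' : 0 <= a' <= Y) by (apply BY; lra). assert (Bb' : 0 <= b' <= Y) by (apply BY; lra).
  clearbody a b a' b'.
  set (d := 2 * M * (X * (1 + X))).
  assert (Hda : Rabs (a - a') <= d).
  { eapply Rle_trans; [exact Da |]. unfold d, X in *; nra. }
  assert (Hdb : Rabs (b - b') <= d).
  { eapply Rle_trans; [exact Db |]. unfold d, X in *; nra. }
  assert (Hd : 0 <= d) by (eapply Rle_trans; [apply Rabs_pos | exact Hda]).
  replace (lambda * ((a + b) / 2) - nu * ((a ^ 2 + a * b + b ^ 2) / 3)
           - (lambda * ((a' + b') / 2) - nu * ((a' ^ 2 + a' * b' + b' ^ 2) / 3)))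
    with (lambda * (((a - a') + (b - b')) / 2)
          - nu / 3 * ((a - a') * (a + a' + b) + (b - b') * (a' + b + b'))) by field.
  assert (T1 : Rabs (lambda * (((a - a') + (b - b')) / 2)) <= Rabs lambda * d).
  { rewrite Rabs_mult. apply Rmult_le_compat_l; [apply Rabs_pos |].
    apply Rabs_le. apply Rabs_le_between in Hda. apply Rabs_le_between in Hdb. lra. }
  assert (T2 : Rabs ((a - a') * (a + a' + b) + (b - b') * (a' + b + b')) <= d * (3 * Y) + d * (3 * Y)).
  { eapply Rle_trans; [apply Rabs_triang |]. rewrite !Rabs_mult.
    apply Rplus_le_compat; (apply Rmult_le_compat; try apply Rabs_pos; auto; apply Rabs_le; lra). }
  assert (T3 : Rabs (nu / 3 * ((a - a') * (a + a' + b) + (b - b') * (a' + b + b'))) <= nu / 3 * (d * (3 * Y) + d * (3 * Y))).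
  { rewrite Rabs_mult, (Rabs_pos_eq (nu / 3)) by lra. apply Rmult_le_compat_l; lra. }
  eapply Rle_trans; [apply Rabs_triang |]. rewrite Rabs_Ropp.
  apply Rle_trans with (Rabs lambda * d * (1 + X) ^ 2 + nu / 3 * (d * (3 * Y) + d * (3 * Y))).
  - apply Rplus_le_compat; [| exact T3]. eapply Rle_trans; [exact T1 |].
    assert (0 <= Rabs lambda * d) by (apply Rmult_le_pos; [apply Rabs_pos | auto]).
    assert (1 <= (1 + X) ^ 2) by nra. nra.
  - apply Req_le. unfold d, Y. field.
Qed.

(** Only the variation of the real factor [gain] contributes when the
    nonlinear difference is tested with [i] times the error: this lowers the
    growth of the pairing from the sixth to the fifth power of the error, and the
    damping has a sign. *)
Lemma nonlin_dissipation (lambda nu eps M : R) (z w e f : C) :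
  0 < nu -> 0 <= eps -> 1 <= M -> Cmod z <= M -> Cmod w <= M ->
  - dot (nonlin lambda nu eps z w - nonlin lambda nu eps (z - e) (w - f)) (Ci * mid e f)
  <= 64 * (M ^ 2 * (Rabs lambda + 2 * nu * M ^ 2))
     * (Cmod e ^ 2 + Cmod f ^ 2 + (Cmod e ^ 5 + Cmod f ^ 5)).
Proof.
  intros Hnu Heps HM Hz Hw.
  assert (HG := gain_perturb lambda nu M z w e f Hnu HM Hz Hw).
  rewrite !nonlin_gain, !phi_cubic.
  assert (Hmid : mid (z - e) (w - f) = (mid z w - mid e f)%C).
  { unfold mid. rewrite !Cdiv_RtoC by lra. apply injective_projections; simpl; field. }
  assert (Hcub := cubic_monotone (mid z w) (mid (z - e) (w - f))).
  set (g := gain lambda nu z w) in *. set (g' := gain lambda nu (z - e) (w - f)) in *.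
  replace (mid z w - mid (z - e) (w - f))%C with (mid e f) in Hcub by (rewrite Hmid; ring).
  set (c1 := cubic (mid z w)) in *. set (c2 := cubic (mid (z - e) (w - f))) in *.
  set (m := mid z w) in *. set (d := mid e f) in *.
  replace (- dot (RtoC g * m + Ci * RtoC eps * c1 - (RtoC g' * mid (z - e) (w - f) + Ci * RtoC eps * c2)) (Ci * d))
    with (- ((g - g') * dot m (Ci * d)) - eps * dot d (c1 - c2)).
  2: { rewrite Hmid. unfold dot; simpl. ring. }
  assert (Hm : Cmod m <= M).
  { unfold m, mid. unfold Cdiv. rewrite Cmod_mult, <- RtoC_inv, Cmod_R, Rabs_pos_eq by lra.
    generalize (Cmod_triangle z w). lra. }
  assert (Hd : Cmod (Ci * d) <= (Cmod e + Cmod f) / 2).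
  { rewrite Cmod_mult. unfold d, mid, Cdiv. rewrite Cmod_mult, <- RtoC_inv, Cmod_R, Rabs_pos_eq by lra.
    rewrite Cmod_Ci. generalize (Cmod_triangle e f). lra. }
  assert (Hdot : Rabs (dot m (Ci * d)) <= M * ((Cmod e + Cmod f) / 2)).
  { eapply Rle_trans; [apply dot_le_Cmod |]. apply Rmult_le_compat; auto; apply Cmod_ge_0. }
  assert (He := Cmod_ge_0 e). assert (Hf := Cmod_ge_0 f).
  assert (Hprod : - ((g - g') * dot m (Ci * d)) <=
    (2 * M * (Rabs lambda + 2 * nu * M ^ 2)
     * ((Cmod e + Cmod f) * (1 + (Cmod e + Cmod f)) ^ 3)) * (M * ((Cmod e + Cmod f) / 2))).
  { eapply Rle_trans; [apply Rle_abs |]. rewrite Rabs_Ropp, Rabs_mult.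
    apply Rmult_le_compat; auto; apply Rabs_pos. }
  assert (0 <= eps * dot d (c1 - c2)) by (apply Rmult_le_pos; auto).
  apply Rle_trans with (M ^ 2 * (Rabs lambda + 2 * nu * M ^ 2) *
     ((Cmod e + Cmod f) ^ 2 * (1 + (Cmod e + Cmod f)) ^ 3)).
  - eapply Rle_trans; [| eapply Rle_trans; [exact Hprod | apply Req_le; field]]. lra.
  - assert (HK : 0 <= M ^ 2 * (Rabs lambda + 2 * nu * M ^ 2)).
    { generalize (Rabs_pos lambda); intros. repeat apply Rmult_le_pos; try nra. }
    generalize (Rmult_le_compat_l _ _ _ HK (growth_poly _ _ He Hf)). lra.
Qed.

(** [paired A h eta E p p' q q']: [p], [p'] are the values at two neighbouring
    nodes of a quantity built from the exact solution, [q], [q'] those of the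
    same quantity built from the scheme; [eta] measures the errors and [E] the
    errors together with their difference quotients.  The predicate is stable
    under the operations that build the nonlinearity; products need [eta <= 1]. *)
Definition paired (A h eta E : R) (p p' q q' : C) : Prop :=
  Cmod p <= A /\ Cmod p' <= A /\
  Cmod (p - q) <= A * eta /\ Cmod (p' - q') <= A * eta /\
  Cmod (p' - p) <= A * h /\ Cmod ((p' - q') - (p - q)) <= A * h * E.

Lemma paired_plus A B h eta E p p' q q' P P' Q Q' :
  paired A h eta E p p' q q' -> paired B h eta E P P' Q Q' ->
  paired (A + B) h eta E (p + P) (p' + P') (q + Q) (q' + Q').
Proof.
  intros (H1 & H2 & H3 & H4 & H5 & H6) (K1 & K2 & K3 & K4 & K5 & K6).
  assert (T : forall x y a b, Cmod x <= a -> Cmod y <= b -> Cmod (x + y) <= a + b).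
  { intros x y a b Hx Hy. generalize (Cmod_triangle x y). lra. }
  repeat split; rewrite ?Rmult_plus_distr_r; auto.
  - replace (p + P - (q + Q))%C with ((p - q) + (P - Q))%C by ring. auto.
  - replace (p' + P' - (q' + Q'))%C with ((p' - q') + (P' - Q'))%C by ring. auto.
  - replace (p' + P' - (p + P))%C with ((p' - p) + (P' - P))%C by ring. auto.
  - replace (p' + P' - (q' + Q') - (p + P - (q + Q)))%C
      with ((p' - q' - (p - q)) + (P' - Q' - (P - Q)))%C by ring. auto.
Qed.

Lemma Cmod_mult_le x y a b : Cmod x <= a -> Cmod y <= b -> Cmod (x * y) <= a * b.
Proof.
  intros. rewrite Cmod_mult. apply Rmult_le_compat; auto; apply Cmod_ge_0.
Qed.

Lemma Cmod_plus_le x y a b : Cmod x <= a -> Cmod y <= b -> Cmod (x + y) <= a + b.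
Proof. intros Hx Hy. generalize (Cmod_triangle x y). lra. Qed.

Lemma paired_mult A B h eta E p p' q q' P P' Q Q' :
  0 <= h -> 0 <= eta <= 1 -> eta <= E ->
  paired A h eta E p p' q q' -> paired B h eta E P P' Q Q' ->
  paired (6 * (A * B)) h eta E (p * P) (p' * P') (q * Q) (q' * Q').
Proof.
  intros Hh Heta HE (H1 & H2 & H3 & H4 & H5 & H6) (K1 & K2 & K3 & K4 & K5 & K6).
  assert (HA : 0 <= A) by (generalize (Cmod_ge_0 p); lra).
  assert (HB : 0 <= B) by (generalize (Cmod_ge_0 P); lra).
  assert (HAB : 0 <= A * B) by (apply Rmult_le_pos; auto).
  assert (HABe : 0 <= A * B * eta) by (apply Rmult_le_pos; lra).
  assert (HABh : 0 <= A * B * h) by (apply Rmult_le_pos; lra).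
  assert (HABhE : 0 <= A * B * h * E) by (apply Rmult_le_pos; lra).
  assert (Hq : Cmod q <= A + A * eta).
  { replace q with (p - (p - q))%C by ring. eapply Rle_trans; [apply Cmod_triangle_minus |]. lra. }
  assert (Hq' : Cmod q' <= A + A * eta).
  { replace q' with (p' - (p' - q'))%C by ring. eapply Rle_trans; [apply Cmod_triangle_minus |]. lra. }
  assert (Hdq : Cmod (q' - q) <= A * h + A * h * E).
  { replace (q' - q)%C with ((p' - p) - (p' - q' - (p - q)))%C by ring.
    eapply Rle_trans; [apply Cmod_triangle_minus |]. lra. }
  assert (He2 : A * B * eta * eta <= A * B * eta) by nra.
  assert (HAhE : 0 <= A * h) by (apply Rmult_le_pos; auto).
  repeat split.
  - eapply Rle_trans; [apply (Cmod_mult_le _ _ A B); auto |]. lra.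
  - eapply Rle_trans; [apply (Cmod_mult_le _ _ A B); auto |]. lra.
  - replace (p * P - q * Q)%C with ((p - q) * P + q * (P - Q))%C by ring.
    eapply Rle_trans; [apply Cmod_plus_le; apply Cmod_mult_le; eassumption |]. nra.
  - replace (p' * P' - q' * Q')%C with ((p' - q') * P' + q' * (P' - Q'))%C by ring.
    eapply Rle_trans; [apply Cmod_plus_le; apply Cmod_mult_le; eassumption |]. nra.
  - replace (p' * P' - p * P)%C with ((p' - p) * P' + p * (P' - P))%C by ring.
    eapply Rle_trans; [apply Cmod_plus_le; apply Cmod_mult_le; eassumption |]. nra.
  - replace (p' * P' - q' * Q' - (p * P - q * Q))%C with
      (((p' - q' - (p - q)) * P' + (p - q) * (P' - P))
       + ((q' - q) * (P' - Q') + q * (P' - Q' - (P - Q))))%C by ring.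
    eapply Rle_trans.
    + apply Cmod_plus_le; apply Cmod_plus_le; apply Cmod_mult_le; eassumption.
    + replace (A * h * E * B + A * eta * (B * h) + ((A * h + A * h * E) * (B * eta) + (A + A * eta) * (B * h * E)))
        with (A * B * h * E * 2 + 2 * (A * B * h * eta) + 2 * (A * B * h * E * eta)) by ring.
      assert (A * B * h * eta <= A * B * h * E) by (apply Rmult_le_compat_l; auto).
      assert (A * B * h * E * eta <= A * B * h * E * 1) by (apply Rmult_le_compat_l; lra).
      lra.
Qed.

Lemma paired_const c h eta E : 0 <= h -> 0 <= eta -> 0 <= E ->
  paired (Cmod c) h eta E c c c c.
Proof.
  intros. assert (Hc := Cmod_ge_0 c).
  assert (0 <= Cmod c * eta) by (apply Rmult_le_pos; auto).
  assert (0 <= Cmod c * h) by (apply Rmult_le_pos; auto).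
  assert (0 <= Cmod c * h * E) by (apply Rmult_le_pos; auto).
  repeat split; try lra;
  (match goal with |- Cmod ?x <= _ => replace x with (RtoC 0) by ring end; rewrite Cmod_0; auto).
Qed.

Lemma Cconj_minus z w : Cconj (z - w) = (Cconj z - Cconj w)%C.
Proof. apply injective_projections; simpl; ring. Qed.

Lemma paired_conj A h eta E p p' q q' :
  paired A h eta E p p' q q' -> paired A h eta E (Cconj p) (Cconj p') (Cconj q) (Cconj q').
Proof.
  intros (H1 & H2 & H3 & H4 & H5 & H6).
  repeat split; rewrite <- ?Cconj_minus, ?Cmod_conj; auto.
Qed.

(** In this polynomial form the closure properties of [paired] and [slow] apply
    factor by factor. *)
Lemma nonlin_poly lambda nu eps z w :
  nonlin lambda nu eps z w =
  ((RtoC (lambda / 4) * (z * Cconj z + w * Cconj w)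
    + RtoC (- nu / 6) * ((z * Cconj z) * (z * Cconj z) + (z * Cconj z) * (w * Cconj w)
                         + (w * Cconj w) * (w * Cconj w))
    + (Ci * RtoC (eps / 8)) * ((z + w) * (Cconj z + Cconj w))) * (z + w))%C.
Proof.
  unfold nonlin, psi1, psi2, phi.
  rewrite !Cmod_pow4, !Cmod_sqr, !Cdiv_RtoC by lra.
  unfold dot. apply injective_projections; simpl; field.
Qed.

(** Controls the nonlinear difference at a node, and its difference between two
    neighbouring nodes, by the errors and their differences. *)
Lemma nonlin_paired (lambda nu eps A : R) :
  exists B, forall h eta E z z' w w' Z Z' W W',
    0 <= h -> 0 <= eta <= 1 -> eta <= E ->
    paired A h eta E z z' Z Z' -> paired A h eta E w w' W W' ->
    paired B h eta E (nonlin lambda nu eps z w) (nonlin lambda nu eps z' w')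
                     (nonlin lambda nu eps Z W) (nonlin lambda nu eps Z' W').
Proof.
  eexists. intros h eta E z z' w w' Z Z' W W' Hh Heta HE Hz Hw.
  rewrite !nonlin_poly.
  repeat first
    [ exact Hh | exact Heta | exact HE | lra | exact Hz | exact Hw
    | eapply paired_plus | eapply paired_mult | eapply paired_conj | eapply paired_const ].
Qed.

(** [slow k A tau X X']: [X] and [X'], values at successive time levels, are
    [O(tau ^ k)] and differ by one more power of [tau].  Products add the
    exponents, so that the consistency error and its time increment are bounded
    by one computation. *)
Definition slow (k : nat) (A tau : R) (X X' : C) : Prop :=
  Cmod X <= A * tau ^ k /\ Cmod X' <= A * tau ^ k /\ Cmod (X' - X) <= A * tau ^ (S k).

Lemma slow_plus k A B tau X X' Y Y' :
  slow k A tau X X' -> slow k B tau Y Y' -> slow k (A + B) tau (X + Y) (X' + Y').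
Proof.
  intros (H1 & H2 & H3) (K1 & K2 & K3).
  repeat split; rewrite Rmult_plus_distr_r.
  - apply Cmod_plus_le; auto.
  - apply Cmod_plus_le; auto.
  - replace (X' + Y' - (X + Y))%C with ((X' - X) + (Y' - Y))%C by ring. apply Cmod_plus_le; auto.
Qed.

Lemma slow_mult k l A B tau X X' Y Y' :
  0 <= tau ->
  slow k A tau X X' -> slow l B tau Y Y' -> slow (k + l) (2 * (A * B)) tau (X * Y) (X' * Y').
Proof.
  intros Ht (H1 & H2 & H3) (K1 & K2 & K3).
  assert (HX : 0 <= A * tau ^ k) by (eapply Rle_trans; [apply Cmod_ge_0 | exact H1]).
  assert (HY : 0 <= B * tau ^ l) by (eapply Rle_trans; [apply Cmod_ge_0 | exact K1]).
  assert (HP : 0 <= A * tau ^ k * (B * tau ^ l)) by (apply Rmult_le_pos; auto).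
  repeat split.
  - rewrite pow_add. eapply Rle_trans; [apply Cmod_mult_le; eassumption |]. nra.
  - rewrite pow_add. eapply Rle_trans; [apply Cmod_mult_le; eassumption |]. nra.
  - replace (X' * Y' - X * Y)%C with ((X' - X) * Y' + X * (Y' - Y))%C by ring.
    eapply Rle_trans; [apply Cmod_plus_le; apply Cmod_mult_le; eassumption |].
    apply Req_le. simpl. rewrite pow_add. ring.
Qed.

Lemma slow_refl k A tau X : 0 <= tau -> Cmod X <= A * tau ^ k -> slow k A tau X X.
Proof.
  intros Ht HX. repeat split; auto.
  replace (X - X)%C with (RtoC 0) by ring. rewrite Cmod_0. simpl.
  assert (0 <= A * tau ^ k) by (eapply Rle_trans; [apply Cmod_ge_0 | exact HX]). nra.
Qed.

Lemma slow_const c tau : 0 <= tau -> slow 0 (Cmod c) tau c c.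
Proof. intros Ht. apply slow_refl; auto. simpl. lra. Qed.

Lemma slow_conj k A tau X X' : slow k A tau X X' -> slow k A tau (Cconj X) (Cconj X').
Proof.
  intros (H1 & H2 & H3). repeat split; rewrite <- ?Cconj_minus, ?Cmod_conj; auto.
Qed.

Definition pointwise_nonlin (lambda nu eps : R) (z : C) : C := nonlin lambda nu eps z z.

(** The two-level nonlinearity differs from the average of its values at the
    two levels by products of two time differences, because it is symmetric
    in its arguments. *)
Lemma nonlin_consistency_poly lambda nu eps z w :
  (nonlin lambda nu eps z w
   - (pointwise_nonlin lambda nu eps z + pointwise_nonlin lambda nu eps w) / RtoC 2)%C
  = (let d := z + RtoC (-1) * w in
     let s := z + w in
     let a := z * Cconj z in
     let b := w * Cconj w in
     let ab := d * Cconj z + w * Cconj d in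
     RtoC (- lambda / 4) * (ab * d)
     + RtoC (nu / 12) * (ab * (RtoC 3 * (a + b) * d + ab * s))
     + Ci * RtoC (- eps / 8) * (RtoC 2 * (d * Cconj d) * s + d * d * Cconj s))%C.
Proof.
  unfold pointwise_nonlin. cbv zeta. rewrite !nonlin_poly, Cdiv_RtoC by lra.
  apply injective_projections; simpl; field.
Qed.

Lemma nonlin_consistency (lambda nu eps A : R) :
  exists B, forall tau z z' w w',
    0 <= tau ->
    slow 0 A tau z z' -> slow 0 A tau w w' ->
    slow 1 A tau (z + RtoC (-1) * w)%C (z' + RtoC (-1) * w')%C ->
    slow 2 B tau
      (nonlin lambda nu eps z w
       - (pointwise_nonlin lambda nu eps z + pointwise_nonlin lambda nu eps w) / RtoC 2)%C
      (nonlin lambda nu eps z' w'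
       - (pointwise_nonlin lambda nu eps z' + pointwise_nonlin lambda nu eps w') / RtoC 2)%C.
Proof.
  eexists. intros tau z z' w w' Ht Hz Hw Hd.
  rewrite !nonlin_consistency_poly. cbv zeta.
  assert (Hab : slow 1 (2 * (A * A) + 2 * (A * A)) tau
     ((z + RtoC (-1) * w) * Cconj z + w * Cconj (z + RtoC (-1) * w))%C
     ((z' + RtoC (-1) * w') * Cconj z' + w' * Cconj (z' + RtoC (-1) * w'))%C).
  { apply slow_plus.
    - apply (slow_mult 1 0); auto. apply slow_conj; auto.
    - apply (slow_mult 0 1); auto. apply slow_conj; auto. }
  assert (Hs := slow_plus _ _ _ _ _ _ _ _ Hz Hw).
  assert (Haa := slow_mult _ _ _ _ _ _ _ _ _ Ht Hz (slow_conj _ _ _ _ _ Hz)).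
  assert (Hbb := slow_mult _ _ _ _ _ _ _ _ _ Ht Hw (slow_conj _ _ _ _ _ Hw)).
  assert (Hdd := slow_conj _ _ _ _ _ Hd).
  assert (Hss := slow_conj _ _ _ _ _ Hs).
  eapply slow_plus; [eapply slow_plus |].
  - eapply (slow_mult 0 2); [auto | apply slow_const; auto |].
    eapply (slow_mult 1 1); eassumption.
  - eapply (slow_mult 0 2); [auto | apply slow_const; auto |].
    eapply (slow_mult 1 1); [auto | eassumption |].
    eapply slow_plus.
    + eapply (slow_mult 0 1); [auto | | eassumption].
      eapply (slow_mult 0 0); [auto | apply slow_const; auto |].
      eapply slow_plus; eassumption.
    + eapply (slow_mult 1 0); eassumption.
  - eapply (slow_mult 0 2); [auto | apply slow_const; auto |].
    eapply slow_plus.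
    + eapply (slow_mult 2 0); [auto | | eassumption].
      eapply (slow_mult 0 2); [auto | apply slow_const; auto |].
      eapply (slow_mult 1 1); eassumption.
    + eapply (slow_mult 2 0); [auto | | eassumption].
      eapply (slow_mult 1 1); eassumption.
Qed.

(** * Discrete Gronwall inequality *)

Lemma exp_monotone (x y : R) : x <= y -> exp x <= exp y.
Proof. intros [H | ->]; [left; apply exp_increasing; auto | lra]. Qed.

(** For the implicit step [z + rho / 2] grows at most by the factor
    [(1 + q) / (1 - q)], [q = kappa * tau], and this is below [1 + 4 * q] for
    [q <= 1 / 2]. *)
Lemma discrete_gronwall (kappa tau rho : R) (z : nat -> R) (N : nat) :
  0 <= kappa -> 0 <= tau -> kappa * tau <= / 2 -> 0 <= rho ->
  (forall n, (n <= N)%nat -> 0 <= z n) ->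
  (forall n, (n < N)%nat -> z (S n) <= z n + tau * (kappa * (z n + z (S n) + rho))) ->
  forall n, (n <= N)%nat -> z n <= (z 0%nat + rho) * exp (4 * kappa * (INR n * tau)).
Proof.
  intros Hk Ht Hkt Hrho Hz Hstep.
  assert (Hkt0 : 0 <= kappa * tau) by (apply Rmult_le_pos; auto).
  set (q := kappa * tau) in *.
  assert (H : forall n, (n <= N)%nat -> z n + rho / 2 <= (z 0%nat + rho / 2) * exp (4 * kappa * (INR n * tau))).
  { induction n as [|n IH]; intros Hn.
    - simpl. rewrite Rmult_0_l, Rmult_0_r, exp_0. lra.
    - specialize (IH ltac:(lia)). specialize (Hstep n ltac:(lia)).
      assert (Hzn := Hz n ltac:(lia)). assert (HzS := Hz (S n) Hn).
      rewrite S_INR.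
      replace (4 * kappa * ((INR n + 1) * tau)) with (4 * kappa * (INR n * tau) + 4 * q) by (unfold q; ring).
      rewrite exp_plus, <- Rmult_assoc.
      assert (Hexp : 1 + 4 * q <= exp (4 * q)).
      { destruct (Req_dec q 0) as [->|Hq]; [rewrite Rmult_0_r, exp_0; lra |].
        left. apply exp_ineq1. lra. }
      apply Rle_trans with ((z n + rho / 2) * (1 + 4 * q)).
      + replace (tau * (kappa * (z n + z (S n) + rho))) with (q * (z n + z (S n) + rho)) in Hstep
          by (unfold q; ring).
        assert (H1 : (z (S n) + rho / 2) * (1 - q) <= (z n + rho / 2) * (1 + q)) by lra.
        assert (H2 : 1 + q <= (1 + 4 * q) * (1 - q)) by nra.
        apply Rmult_le_reg_r with (1 - q); [lra |].
        eapply Rle_trans; [exact H1 |]. rewrite Rmult_assoc. apply Rmult_le_compat_l; lra.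
      + apply Rmult_le_compat; lra. }
  intros n Hn. specialize (H n Hn).
  assert (He := exp_pos (4 * kappa * (INR n * tau))).
  assert (0 <= rho / 2 * exp (4 * kappa * (INR n * tau))) by (apply Rmult_le_pos; lra).
  lra.
Qed.

(** * Error analysis on the grid *)

(** Everything the error analysis knows about the sampled exact solution [V] and
    a solution [U] of the scheme.  The mesh comes after the constants
    [lambda .. M], which fixes what the constants of the estimates depend on. *)
Record comparison (lambda nu eps Lx Ly T M h tau : R) (J K N : nat)
    (V U : nat -> gridfun) : Prop := {
  cmp_J : (1 <= J)%nat;
  cmp_K : (1 <= K)%nat;
  cmp_h : 0 < h;
  cmp_tau : 0 < tau;
  cmp_Lx : INR J * h = Lx;
  cmp_Ly : INR K * h = Ly;
  cmp_T : INR N * tau = T;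
  cmp_XV : forall n, (n <= N)%nat -> X_JK J K (V n);
  cmp_XU : forall n, (n <= N)%nat -> X_JK J K (U n);
  cmp_bound : forall n j k, (n <= N)%nat -> (j <= J)%nat -> (k <= K)%nat ->
    Cmod (V n j k) <= M;
  cmp_dx : forall n j k, (n <= N)%nat -> (j < J)%nat -> (k <= K)%nat ->
    Cmod (V n (S j) k - V n j k) <= M * h;
  cmp_dy : forall n j k, (n <= N)%nat -> (j <= J)%nat -> (k < K)%nat ->
    Cmod (V n j (S k) - V n j k) <= M * h;
  cmp_res : forall n j k, (n < N)%nat -> (1 <= j <= J - 1)%nat -> (1 <= k <= K - 1)%nat ->
    Cmod (residual lambda nu eps h tau V n j k) <= M * (tau ^ 2 + h ^ 2);
  cmp_dres : forall n j k, (S n < N)%nat -> (1 <= j <= J - 1)%nat -> (1 <= k <= K - 1)%nat ->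
    Cmod (residual lambda nu eps h tau V (S n) j k - residual lambda nu eps h tau V n j k)
    <= M * tau * (tau ^ 2 + h ^ 2);
  cmp_init : forall j k, (j <= J)%nat -> (k <= K)%nat -> U 0%nat j k = V 0%nat j k;
  cmp_scheme : forall n j k, (n < N)%nat -> (1 <= j <= J - 1)%nat -> (1 <= k <= K - 1)%nat ->
    residual lambda nu eps h tau U n j k = RtoC 0
}.

Arguments cmp_J {_ _ _ _ _ _ _ _ _ _ _ _ _ _}.
Arguments cmp_K {_ _ _ _ _ _ _ _ _ _ _ _ _ _}.
Arguments cmp_h {_ _ _ _ _ _ _ _ _ _ _ _ _ _}.
Arguments cmp_tau {_ _ _ _ _ _ _ _ _ _ _ _ _ _}.
Arguments cmp_Lx {_ _ _ _ _ _ _ _ _ _ _ _ _ _}.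
Arguments cmp_Ly {_ _ _ _ _ _ _ _ _ _ _ _ _ _}.
Arguments cmp_T {_ _ _ _ _ _ _ _ _ _ _ _ _ _}.
Arguments cmp_XV {_ _ _ _ _ _ _ _ _ _ _ _ _ _}.
Arguments cmp_XU {_ _ _ _ _ _ _ _ _ _ _ _ _ _}.
Arguments cmp_bound {_ _ _ _ _ _ _ _ _ _ _ _ _ _}.
Arguments cmp_dx {_ _ _ _ _ _ _ _ _ _ _ _ _ _}.
Arguments cmp_dy {_ _ _ _ _ _ _ _ _ _ _ _ _ _}.
Arguments cmp_init {_ _ _ _ _ _ _ _ _ _ _ _ _ _}.
Arguments cmp_scheme {_ _ _ _ _ _ _ _ _ _ _ _ _ _}.

Ltac comparison_facts H :=
  assert (HJ := cmp_J H); assert (HK := cmp_K H); assert (Hh := cmp_h H); assert (Ht := cmp_tau H);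
  assert (HLx' := cmp_Lx H); assert (HLy' := cmp_Ly H); assert (HNT := cmp_T H);
  assert (Hinit := cmp_init H).

Definition error (V U : nat -> gridfun) (n : nat) : gridfun :=
  fun j k => (V n j k - U n j k)%C.

Lemma dot_minus_self_le z w : dot (z - w) (z - w) <= 2 * dot z z + 2 * dot w w.
Proof.
  replace (2 * dot z z + 2 * dot w w) with (dot (z - w) (z - w) + dot (z + w) (z + w))
    by (unfold dot; simpl; ring).
  generalize (dot_self_nonneg (z + w)). lra.
Qed.

Lemma mass_minus_le h J K v w : (1 <= J)%nat -> (1 <= K)%nat ->
  mass h J K (fun j k => v j k - w j k)%C <= 2 * mass h J K v + 2 * mass h J K w.
Proof.
  intros HJ HK. unfold mass.
  replace (2 * (h * h * gsum J K (fun j k => Cmod (v j k) ^ 2)) + 2 * (h * h * gsum J K (fun j k => Cmod (w j k) ^ 2)))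
    with (h * h * (2 * gsum J K (fun j k => Cmod (v j k) ^ 2) + 2 * gsum J K (fun j k => Cmod (w j k) ^ 2))) by ring.
  apply Rmult_le_compat_l; [nra |]. rewrite <- !gsum_scal, <- gsum_plus.
  apply gsum_le; auto. intros. rewrite !Cmod_sqr. apply dot_minus_self_le.
Qed.

Lemma dirichlet_minus_le h J K v w : (1 <= J)%nat -> (1 <= K)%nat ->
  dirichlet h J K (fun j k => v j k - w j k)%C <= 2 * dirichlet h J K v + 2 * dirichlet h J K w.
Proof.
  intros HJ HK. unfold dirichlet.
  replace (2 * (h * h * gsum J K (grad_dot h v v)) + 2 * (h * h * gsum J K (grad_dot h w w)))
    with (h * h * (2 * gsum J K (grad_dot h v v) + 2 * gsum J K (grad_dot h w w))) by ring.
  apply Rmult_le_compat_l; [nra |]. rewrite <- !gsum_scal, <- gsum_plus.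
  apply gsum_le; auto. intros j k _ _. unfold grad_dot, dxp, dyp.
  generalize (dot_minus_self_le ((v (S j) k - v j k) / RtoC h)%C ((w (S j) k - w j k) / RtoC h)%C)
    (dot_minus_self_le ((v j (S k) - v j k) / RtoC h)%C ((w j (S k) - w j k) / RtoC h)%C).
  unfold Cdiv.
  replace ((v (S j) k - v j k) * / RtoC h - (w (S j) k - w j k) * / RtoC h)%C
    with ((v (S j) k - w (S j) k - (v j k - w j k)) * / RtoC h)%C by ring.
  replace ((v j (S k) - v j k) * / RtoC h - (w j (S k) - w j k) * / RtoC h)%C
    with ((v j (S k) - w j (S k) - (v j k - w j k)) * / RtoC h)%C by ring.
  lra.
Qed.

Lemma weighted_const_le (J K : nat) (h c : R) (f : nat -> nat -> R) :
  (1 <= J)%nat -> (1 <= K)%nat ->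
  (forall j k, (j < J)%nat -> (k < K)%nat -> f j k <= c) ->
  h * h * gsum J K f <= INR J * h * (INR K * h) * c.
Proof.
  intros HJ HK Hf.
  replace (INR J * h * (INR K * h) * c) with (h * h * (INR J * INR K * c)) by ring.
  apply Rmult_le_compat_l; [nra |]. rewrite <- gsum_const by auto. apply gsum_le; auto.
Qed.

Lemma regular_mass_le M h J K v : (1 <= J)%nat -> (1 <= K)%nat ->
  (forall j k, (j <= J)%nat -> (k <= K)%nat -> Cmod (v j k) <= M) ->
  mass h J K v <= INR J * h * (INR K * h) * M ^ 2.
Proof.
  intros HJ HK Hv. apply weighted_const_le; auto. intros j k Hj Hk.
  apply pow_incr. split; [apply Cmod_ge_0 | apply Hv; lia].
Qed.

Lemma regular_dirichlet_le M h J K v : (1 <= J)%nat -> (1 <= K)%nat -> 0 < h ->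
  (forall j k, (j < J)%nat -> (k <= K)%nat -> Cmod (v (S j) k - v j k) <= M * h) ->
  (forall j k, (j <= J)%nat -> (k < K)%nat -> Cmod (v j (S k) - v j k) <= M * h) ->
  dirichlet h J K v <= INR J * h * (INR K * h) * (2 * M ^ 2).
Proof.
  intros HJ HK Hh Hx Hy. apply weighted_const_le; auto. intros j k Hj Hk.
  unfold grad_dot, dxp, dyp. rewrite <- !Cmod_sqr, !Cmod_div_sqr by auto.
  assert (E : forall z, Cmod z <= M * h -> (Cmod z / h) ^ 2 <= M ^ 2).
  { intros z Hz. apply pow_incr. split.
    - apply Rdiv_le_0_compat; [apply Cmod_ge_0 | auto].
    - apply Rle_div_l; auto. }
  generalize (E _ (Hx j k ltac:(lia) ltac:(lia))) (E _ (Hy j k ltac:(lia) ltac:(lia))). lra.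
Qed.

Lemma regular_energy_le lambda nu M h J K v : (1 <= J)%nat -> (1 <= K)%nat -> 0 < h -> 0 < nu -> 0 <= M ->
  (forall j k, (j <= J)%nat -> (k <= K)%nat -> Cmod (v j k) <= M) ->
  (forall j k, (j < J)%nat -> (k <= K)%nat -> Cmod (v (S j) k - v j k) <= M * h) ->
  (forall j k, (j <= J)%nat -> (k < K)%nat -> Cmod (v j (S k) - v j k) <= M * h) ->
  energy lambda nu h J K v
  <= INR J * h * (INR K * h) * (M ^ 2 + (Rabs lambda / 4 * M ^ 4 + nu / 6 * M ^ 6)).
Proof.
  intros HJ HK Hh Hnu HM Hv Hx Hy. unfold energy.
  assert (H1 := regular_dirichlet_le M h J K v HJ HK Hh Hx Hy).
  assert (H2 : h * h * gsum J K (fun j k => (-1) * potential lambda nu (v j k))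
    <= INR J * h * (INR K * h) * (Rabs lambda / 4 * M ^ 4 + nu / 6 * M ^ 6)).
  { apply weighted_const_le; auto. intros j k Hj Hk. unfold potential.
    assert (Hb : 0 <= Cmod (v j k) <= M) by (split; [apply Cmod_ge_0 | apply Hv; lia]).
    assert (H4 := pow_incr _ _ 4 Hb). assert (H6 := pow_incr _ _ 6 Hb).
    assert (P4 : 0 <= Cmod (v j k) ^ 4) by (apply pow_le; lra).
    assert (L : - lambda <= Rabs lambda) by (rewrite <- Rabs_Ropp; apply Rle_abs).
    assert (L0 := Rabs_pos lambda). nra. }
  rewrite gsum_scal in H2. lra.
Qed.

(** The balance laws of mass and energy bound every solution of the scheme in
    the discrete energy space, uniformly in the mesh. *)
Lemma error_energy_space_bound (lambda nu eps Lx Ly T M : R) :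
  0 < nu -> 0 <= eps -> 0 < Lx -> 0 < Ly -> 0 < T -> 1 <= M ->
  exists B, 0 < B /\
    forall h tau J K N V U, comparison lambda nu eps Lx Ly T M h tau J K N V U ->
    forall n, (n <= N)%nat ->
      mass h J K (error V U n) <= B /\ dirichlet h J K (error V U n) <= B.
Proof.
  intros Hnu Heps HLx HLy HT HM.
  set (m0 := Lx * Ly * M ^ 2).
  set (e0 := Lx * Ly * (M ^ 2 + (Rabs lambda / 4 * M ^ 4 + nu / 6 * M ^ 6))).
  set (c := eps * (Rabs lambda ^ 3 / nu ^ 2)).
  set (l := 3 * lambda ^ 2 / (16 * nu)).
  assert (Hm0 : 0 < m0).
  { unfold m0. apply Rmult_lt_0_compat; [nra | apply pow_lt; lra]. }
  assert (He0 : 0 <= e0).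
  { unfold e0. apply Rmult_le_pos; [apply Rmult_le_pos; lra |].
    assert (0 <= M ^ 2) by (apply pow_le; lra). assert (0 <= M ^ 4) by (apply pow_le; lra).
    assert (0 <= M ^ 6) by (apply pow_le; lra). assert (L0 := Rabs_pos lambda).
    assert (0 <= Rabs lambda / 4 * M ^ 4) by (apply Rmult_le_pos; lra).
    assert (0 <= nu / 6 * M ^ 6) by (apply Rmult_le_pos; lra). lra. }
  assert (Hc : 0 <= c).
  { apply Rmult_le_pos; auto. apply Rdiv_le_0_compat; [apply pow_le, Rabs_pos | apply pow_lt; auto]. }
  assert (Hl : 0 <= l).
  { apply Rdiv_le_0_compat; [|lra]. generalize (pow2_ge_0 lambda). lra. }
  assert (Hcm0 : 0 <= c * m0) by (apply Rmult_le_pos; lra).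
  assert (Hcm : 0 <= T * (c * m0)) by (apply Rmult_le_pos; lra).
  assert (Hlm : 0 <= l * m0) by (apply Rmult_le_pos; lra).
  exists (4 * m0 + 2 * (2 * (e0 + T * (c * m0)) + l * m0)).
  split; [lra |].
  intros h tau J K N V U Hcmp n Hn. destruct Hcmp.
  assert (HV : forall n, (n <= N)%nat -> mass h J K (V n) <= m0 /\ dirichlet h J K (V n) <= 2 * m0).
  { intros i Hi. split.
    - unfold m0. rewrite <- cmp_Lx0, <- cmp_Ly0. apply regular_mass_le; auto.
    - unfold m0. rewrite <- cmp_Lx0, <- cmp_Ly0.
      eapply Rle_trans; [apply (regular_dirichlet_le M); auto |]. lra. }
  assert (HU0 : mass h J K (U 0%nat) = mass h J K (V 0%nat)
                /\ energy lambda nu h J K (U 0%nat) = energy lambda nu h J K (V 0%nat)).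
  { split.
    - unfold mass. f_equal. apply gsum_ext; auto. intros. rewrite cmp_init0 by lia. auto.
    - unfold energy, dirichlet.
      rewrite (gsum_ext J K (grad_dot h (U 0%nat) (U 0%nat)) (grad_dot h (V 0%nat) (V 0%nat))); auto.
      + rewrite (gsum_ext J K (fun j k => potential lambda nu (U 0%nat j k))
                              (fun j k => potential lambda nu (V 0%nat j k))); auto.
        intros. rewrite cmp_init0 by lia. auto.
      + intros. unfold grad_dot, dxp, dyp. rewrite !cmp_init0 by lia. auto. }
  assert (HU : mass h J K (U n) <= m0
               /\ energy lambda nu h J K (U n) <= e0 + INR n * tau * (c * m0)).
  { induction n as [|n IH].
    - destruct HU0 as [-> ->]. split; [exact (proj1 (HV 0%nat (Nat.le_0_l N))) |].
      simpl. rewrite !Rmult_0_l, Rplus_0_r. unfold e0. rewrite <- cmp_Lx0, <- cmp_Ly0.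
      apply regular_energy_le; auto; lra.
    - destruct IH as [IHm IHe]; [lia |]. split.
      + eapply Rle_trans; [| exact IHm].
        apply (mass_decreasing lambda nu eps h tau); auto; apply cmp_XU0; lia.
      + eapply Rle_trans.
        { apply (energy_step lambda nu eps h tau); auto; apply cmp_XU0; lia. }
        fold c. rewrite S_INR.
        assert (tau * (c * mass h J K (U n)) <= tau * (c * m0)).
        { apply Rmult_le_compat_l; [lra |]. apply Rmult_le_compat_l; auto. }
        lra. }
  destruct HU as [HUm HUe]. destruct (HV n Hn) as [HVm HVd].
  assert (Hnt : INR n * tau * (c * m0) <= T * (c * m0)).
  { apply Rmult_le_compat_r; [apply Rmult_le_pos; lra |]. rewrite <- cmp_T0.
    apply Rmult_le_compat_r; [lra |]. apply le_INR; auto. }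
  assert (HUd := dirichlet_le_energy lambda nu h J K (U n) cmp_J0 cmp_K0 Hnu). fold l in HUd.
  assert (l * mass h J K (U n) <= l * m0) by (apply Rmult_le_compat_l; auto).
  unfold error. split.
  - eapply Rle_trans; [apply mass_minus_le; auto |]. lra.
  - eapply Rle_trans; [apply dirichlet_minus_le; auto |]. lra.
Qed.

Definition nonlin_error (lambda nu eps : R) (V U : nat -> gridfun) (n : nat) : gridfun :=
  fun j k => (nonlin lambda nu eps (V (S n) j k) (V n j k)
              - nonlin lambda nu eps (U (S n) j k) (U n j k))%C.

(** The residual is only small at interior nodes; test functions vanish elsewhere. *)
Definition interior_part (f : gridfun) : gridfun :=
  fun j k => match j, k with 0%nat, _ => RtoC 0 | _, 0%nat => RtoC 0 | _, _ => f j k end.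

Lemma interior_part_bound (J K : nat) (c : R) (f : gridfun) :
  0 <= c ->
  (forall j k, (1 <= j <= J - 1)%nat -> (1 <= k <= K - 1)%nat -> Cmod (f j k) <= c) ->
  forall j k, (j < J)%nat -> (k < K)%nat -> Cmod (interior_part f j k) <= c.
Proof.
  intros Hc Hf j k Hj Hk. destruct j; [simpl; rewrite Cmod_0; auto |].
  destruct k; [simpl; rewrite Cmod_0; auto |]. apply Hf; lia.
Qed.

Lemma error_equation lambda nu eps Lx Ly T M h tau J K N V U n :
  comparison lambda nu eps Lx Ly T M h tau J K N V U -> (n < N)%nat ->
  forall j k, (1 <= j <= J - 1)%nat -> (1 <= k <= K - 1)%nat ->
  (Ci * dtp tau (error V U) n j k + laph h h (midlevel (error V U) n) j k
   + nonlin_error lambda nu eps V U n j k)%C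
  = interior_part (residual lambda nu eps h tau V n) j k.
Proof.
  intros Hcmp Hn j k Hj Hk. destruct j as [|j]; [lia |]. destruct k as [|k]; [lia |].
  unfold interior_part.
  replace (residual lambda nu eps h tau V n (S j) (S k)) with
    (residual lambda nu eps h tau V n (S j) (S k) - residual lambda nu eps h tau U n (S j) (S k))%C.
  2: { rewrite (cmp_scheme Hcmp n) by auto. ring. }
  unfold residual, nonlin_error, laph, midlevel, dtp, error, Cdiv. ring.
Qed.
Arguments error_equation {_ _ _ _ _ _ _ _ _ _ _ _ _ _}.

Lemma X_JK_error lambda nu eps Lx Ly T M h tau J K N V U n :
  comparison lambda nu eps Lx Ly T M h tau J K N V U -> (n <= N)%nat ->
  X_JK J K (error V U n).
Proof.
  intros Hcmp Hn. apply (X_JK_map2 J K Cminus); [ring | eapply cmp_XV | eapply cmp_XU]; eauto.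
Qed.
Arguments X_JK_error {_ _ _ _ _ _ _ _ _ _ _ _ _ _}.

Lemma dot_young z w : dot z w <= (Cmod z ^ 2 + Cmod w ^ 2) / 2.
Proof.
  rewrite !Cmod_sqr. generalize (dot_self_nonneg (z - w)).
  unfold dot; simpl. lra.
Qed.

Lemma Cmod_mid_sqr z w : Cmod (mid z w) ^ 2 <= (Cmod z ^ 2 + Cmod w ^ 2) / 2.
Proof.
  unfold mid. rewrite !Cmod_sqr, Cdiv_RtoC by lra.
  generalize (dot_self_nonneg (z - w)). unfold dot; simpl. lra.
Qed.

Definition quintic (h : R) (J K : nat) (v : gridfun) : R :=
  h * h * gsum J K (fun j k => Cmod (v j k) ^ 5).

(** The error equation tested with [i] times the mean of the error at the two
    levels: the Laplacian drops out. *)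
Lemma mass_error_step (lambda nu eps Lx Ly T M : R) :
  0 < nu -> 0 <= eps -> 0 < Lx -> 0 < Ly -> 1 <= M ->
  exists kappa, 0 < kappa /\
    forall h tau J K N V U, comparison lambda nu eps Lx Ly T M h tau J K N V U ->
    forall n, (n < N)%nat ->
      mass h J K (error V U (S n))
      <= mass h J K (error V U n)
         + tau * (kappa * (mass h J K (error V U n) + mass h J K (error V U (S n))
                           + quintic h J K (error V U n) + quintic h J K (error V U (S n))
                           + (tau ^ 2 + h ^ 2) ^ 2)).
Proof.
  intros Hnu Heps HLx HLy HM.
  set (c := 64 * (M ^ 2 * (Rabs lambda + 2 * nu * M ^ 2))).
  assert (Hc : 0 <= c).
  { unfold c. generalize (Rabs_pos lambda) (pow2_ge_0 M); intros.
    assert (0 <= nu * M ^ 2) by nra. assert (0 <= M ^ 2 * (Rabs lambda + 2 * nu * M ^ 2)) by (apply Rmult_le_pos; lra). lra. }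
  assert (HA : 0 < Lx * Ly * M ^ 2).
  { apply Rmult_lt_0_compat; [nra | apply pow_lt; lra]. }
  exists (2 * c + 1 + Lx * Ly * M ^ 2). split; [lra |].
  intros h tau J K N V U Hcmp n Hn.
  assert (Heq := error_equation n Hcmp Hn).
  assert (X0 := X_JK_error n Hcmp ltac:(lia)).
  assert (X1 := X_JK_error (S n) Hcmp ltac:(lia)).
  assert (Xm := X_JK_midlevel J K (error V U) n X0 X1).
  set (e := error V U) in *. set (rho := tau ^ 2 + h ^ 2).
  set (Rs := interior_part (residual lambda nu eps h tau V n)) in *.
  comparison_facts Hcmp.
  assert (Hrho : 0 <= rho) by (unfold rho; generalize (pow2_ge_0 tau) (pow2_ge_0 h); lra).
  assert (HR : forall j k, (j < J)%nat -> (k < K)%nat -> Cmod (Rs j k) ^ 2 <= M ^ 2 * rho ^ 2).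
  { intros j k Hj Hk. rewrite <- Rpow_mult_distr. apply pow_incr. split; [apply Cmod_ge_0 |].
    apply (interior_part_bound J K); auto; [apply Rmult_le_pos; lra |].
    intros; eapply cmp_res; eauto. }
  assert (W := weak_form J K h (dtp tau e n) (midlevel e n) (nonlin_error lambda nu eps V U n) Rs
    (fun j k => Ci * midlevel e n j k)%C HJ HK ltac:(lra)
    (X_JK_map J K (fun z => Ci * z)%C _ ltac:(apply Cmult_0_r) Xm) Heq).
  assert (G : gsum J K (grad_dot h (midlevel e n) (fun j k => Ci * midlevel e n j k)%C) = 0).
  { rewrite <- (gsum_zero J K). apply gsum_ext; auto. intros j k _ _.
    unfold grad_dot, dxp, dyp. rewrite !Cdiv_RtoC by lra. unfold dot; simpl. field. lra. }
  rewrite G in W. clear G.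
  assert (P : gsum J K (fun j k => / (2 * tau) * (Cmod (e (S n) j k) ^ 2 - Cmod (e n j k) ^ 2))
    <= gsum J K (fun j k =>
         (c + / 2) * ((Cmod (e n j k) ^ 2 + Cmod (e (S n) j k) ^ 2)
                      + (Cmod (e n j k) ^ 5 + Cmod (e (S n) j k) ^ 5))
         + M ^ 2 * rho ^ 2 / 2)).
  { apply Rle_trans with (gsum J K (fun j k =>
         / (2 * tau) * (Cmod (e (S n) j k) ^ 2 - Cmod (e n j k) ^ 2)
       - (dot (Ci * dtp tau e n j k) (Ci * midlevel e n j k)
          + dot (nonlin_error lambda nu eps V U n j k) (Ci * midlevel e n j k)
          - dot (Rs j k) (Ci * midlevel e n j k)))).
    { rewrite gsum_minus, W. lra. }
    apply gsum_le; auto. intros j k Hj Hk.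
    assert (E1 : dot (Ci * dtp tau e n j k) (Ci * midlevel e n j k)
       = / (2 * tau) * (Cmod (e (S n) j k) ^ 2 - Cmod (e n j k) ^ 2)).
    { unfold dtp, midlevel. rewrite !Cdiv_RtoC, !Cmod_sqr by lra. unfold dot; simpl. field. lra. }
    assert (E2 : - dot (nonlin_error lambda nu eps V U n j k) (Ci * midlevel e n j k)
       <= c * (Cmod (e (S n) j k) ^ 2 + Cmod (e n j k) ^ 2
               + (Cmod (e (S n) j k) ^ 5 + Cmod (e n j k) ^ 5))).
    { unfold nonlin_error, midlevel. fold (mid (e (S n) j k) (e n j k)).
      replace (U (S n) j k) with (V (S n) j k - e (S n) j k)%C by (unfold e, error; ring).
      replace (U n j k) with (V n j k - e n j k)%C by (unfold e, error; ring).
      apply nonlin_dissipation; auto; eapply cmp_bound; eauto; lia. }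
    assert (E3 : dot (Rs j k) (Ci * midlevel e n j k)
       <= M ^ 2 * rho ^ 2 / 2 + (Cmod (e (S n) j k) ^ 2 + Cmod (e n j k) ^ 2) / 4).
    { eapply Rle_trans; [apply dot_young |]. rewrite Cmod_mult, Cmod_Ci, Rmult_1_l.
      generalize (HR j k Hj Hk) (Cmod_mid_sqr (e (S n) j k) (e n j k)).
      unfold midlevel, mid. lra. }
    assert (P2 : 0 <= Cmod (e n j k) ^ 2 + Cmod (e (S n) j k) ^ 2)
      by (generalize (pow2_ge_0 (Cmod (e n j k))) (pow2_ge_0 (Cmod (e (S n) j k))); lra).
    assert (P5 : 0 <= Cmod (e n j k) ^ 5 + Cmod (e (S n) j k) ^ 5)
      by (apply Rplus_le_le_0_compat; apply pow_le, Cmod_ge_0).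
    rewrite E1. lra. }
  rewrite gsum_scal, gsum_plus, gsum_scal, !gsum_plus, gsum_minus, gsum_const in P by auto.
  assert (P' : h * h * (gsum J K (fun j k => Cmod (e (S n) j k) ^ 2) - gsum J K (fun j k => Cmod (e n j k) ^ 2))
    <= tau * ((2 * c + 1) * (mass h J K (e n) + mass h J K (e (S n)) + (quintic h J K (e n) + quintic h J K (e (S n))))
       + Lx * Ly * M ^ 2 * rho ^ 2)).
  { apply (Rmult_le_compat_l (h * h * (2 * tau))) in P; [| repeat apply Rmult_le_pos; lra].
    replace (h * h * (2 * tau) * (/ (2 * tau) *
       (gsum J K (fun j k => Cmod (e (S n) j k) ^ 2) - gsum J K (fun j k => Cmod (e n j k) ^ 2))))
      with (h * h * (gsum J K (fun j k => Cmod (e (S n) j k) ^ 2) - gsum J K (fun j k => Cmod (e n j k) ^ 2))) in P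
      by (field; lra).
    eapply Rle_trans; [exact P |]. rewrite <- HLx', <- HLy'. unfold mass, quintic. apply Req_le. field. }
  assert (Q5 : forall i, 0 <= quintic h J K (e i)).
  { intros i. apply Rmult_le_pos; [nra |]. apply gsum_nonneg; auto. intros; apply pow_le, Cmod_ge_0. }
  assert (Q2 : forall i, 0 <= mass h J K (e i)) by (intros; apply mass_nonneg; auto).
  generalize (Q5 n) (Q5 (S n)) (Q2 n) (Q2 (S n)). intros.
  assert (Hr2 : 0 <= rho ^ 2) by apply pow2_ge_0.
  set (S1 := mass h J K (e (S n))) in *. set (S0 := mass h J K (e n)) in *.
  assert (P2 : S1 - S0 <= tau * ((2 * c + 1) * (S0 + S1 + (quintic h J K (e n) + quintic h J K (e (S n))))
       + Lx * Ly * M ^ 2 * rho ^ 2)).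
  { eapply Rle_trans; [| exact P']. apply Req_le. unfold S1, S0, mass. ring. }
  set (q := S0 + S1 + (quintic h J K (e n) + quintic h J K (e (S n)))) in *.
  assert (Hq : 0 <= q) by (unfold q; lra).
  replace (S0 + S1 + quintic h J K (e n) + quintic h J K (e (S n)) + rho ^ 2) with (q + rho ^ 2) by (unfold q; ring).
  assert (tau * ((2 * c + 1) * q + Lx * Ly * M ^ 2 * rho ^ 2)
          <= tau * ((2 * c + 1 + Lx * Ly * M ^ 2) * (q + rho ^ 2))).
  { apply Rmult_le_compat_l; [lra |]. nra. }
  lra.
Qed.

Lemma sup_sqr_le_mass h J K v j k :
  (j < J)%nat -> (k < K)%nat -> h * h * Cmod (v j k) ^ 2 <= mass h J K v.
Proof.
  intros Hj Hk. apply Rmult_le_compat_l; [nra |].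
  apply (gsum_ge_term J K (fun j k => Cmod (v j k) ^ 2)); auto.
  intros; apply pow2_ge_0.
Qed.

Lemma quintic_le (b h : R) (J K : nat) (v : gridfun) :
  (1 <= J)%nat -> (1 <= K)%nat -> 0 <= b ->
  (forall j k, (j < J)%nat -> (k < K)%nat -> Cmod (v j k) <= b) ->
  quintic h J K v <= b * (h * h * gsum J K (fun j k => Cmod (v j k) ^ 4)).
Proof.
  intros HJ HK Hb Hv. unfold quintic.
  replace (b * (h * h * gsum J K (fun j k => Cmod (v j k) ^ 4)))
    with (h * h * (b * gsum J K (fun j k => Cmod (v j k) ^ 4))) by ring.
  apply Rmult_le_compat_l; [nra |]. rewrite <- gsum_scal. apply gsum_le; auto.
  intros j k Hj Hk. replace (Cmod (v j k) ^ 5) with (Cmod (v j k) * Cmod (v j k) ^ 4) by ring.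
  apply Rmult_le_compat_r; auto. apply pow_le, Cmod_ge_0.
Qed.

Lemma quintic_le_mass (h : R) (J K : nat) (v : gridfun) :
  (1 <= J)%nat -> (1 <= K)%nat ->
  (forall j k, (j < J)%nat -> (k < K)%nat -> Cmod (v j k) <= 1) ->
  quintic h J K v <= mass h J K v.
Proof.
  intros HJ HK Hv. apply Rmult_le_compat_l; [nra |]. apply gsum_le; auto.
  intros j k Hj Hk. specialize (Hv j k Hj Hk). assert (H0 := Cmod_ge_0 (v j k)).
  replace (Cmod (v j k) ^ 5) with (Cmod (v j k) ^ 2 * Cmod (v j k) ^ 3) by ring.
  assert (H3 : Cmod (v j k) ^ 3 <= 1).
  { rewrite <- (pow1 3). apply pow_incr. lra. }
  generalize (pow2_ge_0 (Cmod (v j k))). nra.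
Qed.

(** The time step for which the error is not yet known to be small is the only
    place where the energy-space bound enters: there
    [Cmod e ^ 5 <= sup (Cmod e) * Cmod e ^ 4], the fourth powers are controlled by
    the mass of the error and [tau * sup (Cmod e)] is small because the sup norm
    is [O(h^(-1/2))].  The resulting crude bound makes the error small in sup norm,
    and the sharp recursion applies. *)
Lemma mass_error_bound (lambda nu eps Lx Ly T M C0 : R) :
  0 < nu -> 0 <= eps -> 0 < Lx -> 0 < Ly -> 0 < T -> 1 <= M -> 0 < C0 ->
  exists h0 G, 0 < h0 /\ 0 < G /\
    forall h tau J K N V U, comparison lambda nu eps Lx Ly T M h tau J K N V U ->
    h <= h0 -> tau <= C0 * h ->
    forall n, (n <= N)%nat ->
      mass h J K (error V U n) <= G * (tau ^ 2 + h ^ 2) ^ 2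
      /\ forall j k, (j <= J)%nat -> (k <= K)%nat -> Cmod (error V U n j k) <= 1.
Proof.
  intros Hnu Heps HLx HLy HT HM HC0.
  destruct (error_energy_space_bound lambda nu eps Lx Ly T M) as (B & HB & Henergy); auto.
  destruct (mass_error_step lambda nu eps Lx Ly T M) as (kap & Hkap & Hstep); auto.
  set (G := exp (4 * (2 * kap) * T)).
  assert (HG : 0 < G) by apply exp_pos.
  set (e0 := / (4 * (kap * (B + 1) ^ 2))).
  assert (HkB : 0 < kap * (B + 1) ^ 2) by (apply Rmult_lt_0_compat; [auto | apply pow_lt; lra]).
  assert (He0 : 0 < e0) by (apply Rinv_0_lt_compat; lra).
  set (beta := sqrt B * (B + 1)).
  assert (Hbeta : 0 < beta) by (apply Rmult_lt_0_compat; [apply sqrt_lt_R0; auto | lra]).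
  set (x1 := 4 * kap * C0). set (x2 := C0 ^ 2 * beta / e0 ^ 2).
  set (x3 := (3 * G + 1) * (C0 ^ 2 + 1) ^ 2).
  assert (H1 : 0 <= x1) by (unfold x1; nra).
  assert (H2 : 0 <= x2).
  { apply Rdiv_le_0_compat; [apply Rmult_le_pos; [apply pow2_ge_0 | lra] | apply pow_lt; auto]. }
  assert (H3 : 0 <= x3) by (apply Rmult_le_pos; [lra | apply pow2_ge_0]).
  exists (/ (1 + x1 + x2 + x3)), G.
  split; [apply Rinv_0_lt_compat; lra |]. split; [exact HG |].
  intros h tau J K N V U Hcmp Hh0 HtC.
  specialize (Henergy h tau J K N V U Hcmp). specialize (Hstep h tau J K N V U Hcmp).
  assert (HXe := fun n => X_JK_error n Hcmp).
  comparison_facts Hcmp.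
  assert (Hsum : h * (1 + x1 + x2 + x3) <= 1).
  { apply Rmult_le_compat_r with (r := 1 + x1 + x2 + x3) in Hh0; [| lra].
    rewrite Rinv_l in Hh0; lra. }
  assert (Hhx1 : h * x1 <= 1) by nra. assert (Hhx2 : h * x2 <= 1) by nra.
  assert (Hhx3 : h * x3 <= 1) by nra. assert (Hh1 : h <= 1) by nra.
  assert (Hkt : kap * tau <= / 4).
  { apply Rle_trans with (kap * (C0 * h)); [apply Rmult_le_compat_l; lra |]. unfold x1 in Hhx1. lra. }
  set (rho := tau ^ 2 + h ^ 2) in *.
  assert (Hr2 : 0 <= rho ^ 2) by apply pow2_ge_0.
  assert (Hrho : 0 <= rho <= (C0 ^ 2 + 1) * h ^ 2).
  { split; [unfold rho; generalize (pow2_ge_0 tau) (pow2_ge_0 h); lra |].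
    assert (tau ^ 2 <= (C0 * h) ^ 2) by (apply pow_incr; lra).
    rewrite Rpow_mult_distr in H. unfold rho. lra. }
  assert (Hm : forall n, 0 <= mass h J K (error V U n)) by (intros; apply mass_nonneg; auto).
  set (e := error V U) in *.
  assert (Hsmall : forall n, (n <= N)%nat ->
     (forall i j k, (i <= n)%nat -> (j < J)%nat -> (k < K)%nat -> Cmod (e i j k) <= 1) ->
     mass h J K (e n) <= G * rho ^ 2).
  { intros n Hn Hle.
    assert (Hgr := discrete_gronwall (2 * kap) tau (rho ^ 2) (fun n => mass h J K (e n)) n).
    specialize (Hgr ltac:(lra) ltac:(lra) ltac:(lra) Hr2 ltac:(intros; apply Hm)).
    eapply Rle_trans; [apply Hgr; [| lia] |].
    - intros i Hi. eapply Rle_trans; [apply Hstep; lia |].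
      apply Rplus_le_compat_l, Rmult_le_compat_l; [lra |].
      assert (Q0 : quintic h J K (e i) <= mass h J K (e i))
        by (apply quintic_le_mass; auto; intros; apply Hle; auto; lia).
      assert (Q1 : quintic h J K (e (S i)) <= mass h J K (e (S i)))
        by (apply quintic_le_mass; auto; intros; apply Hle; auto; lia).
      fold rho. nra.
    - assert (E : mass h J K (e 0%nat) = 0).
      { unfold mass. rewrite (gsum_ext J K _ (fun _ _ => 0)); auto.
        - rewrite gsum_zero. ring.
        - intros j k Hj Hk. unfold e, error. rewrite Hinit by lia.
          replace (V 0%nat j k - V 0%nat j k)%C with (RtoC 0) by ring. rewrite Cmod_0. ring. }
      rewrite E, Rplus_0_l, Rmult_comm. apply Rmult_le_compat_r; auto.
      unfold G. apply exp_monotone. apply Rmult_le_compat_l; [lra |]. rewrite <- HNT.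
      apply Rmult_le_compat_r; [lra |]. apply le_INR; auto. }
  assert (Hone : forall n, (n <= N)%nat ->
     forall i j k, (i <= n)%nat -> (j < J)%nat -> (k < K)%nat -> Cmod (e i j k) <= 1).
  { induction n as [|n IH]; intros Hn i j k Hi Hj Hk.
    - replace i with 0%nat by lia. unfold e, error. rewrite Hinit by lia.
      replace (V 0%nat j k - V 0%nat j k)%C with (RtoC 0) by ring. rewrite Cmod_0. lra.
    - specialize (IH ltac:(lia)).
      destruct (Nat.eq_dec i (S n)) as [->|Hne]; [| apply IH; auto; lia].
      assert (Sn := Hsmall n ltac:(lia) IH).
      destruct (Henergy (S n) Hn) as [Bm Bd].
      assert (Hsup : forall j k, (j < J)%nat -> (k < K)%nat -> Cmod (e (S n) j k) <= e0 / tau).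
      { intros j' k' Hj' Hk'. apply Rle_div_r; auto.
        apply Rsqr_incr_0_var; [| lra]. rewrite !Rsqr_pow2, Rpow_mult_distr.
        assert (Hs := sup_le_dirichlet J K h (e (S n)) j' k' HJ HK Hh (HXe (S n) Hn) ltac:(lia) Hk').
        assert (Hb : sqrt (mass h J K (e (S n))) * (dirichlet h J K (e (S n)) + 1) <= beta).
        { apply Rmult_le_compat; try apply sqrt_pos.
          - generalize (dirichlet_nonneg h J K (e (S n)) HJ HK). lra.
          - apply sqrt_le_1_alt; auto.
          - lra. }
        set (c2 := Cmod (e (S n) j' k') ^ 2) in *.
        assert (Hc2 : 0 <= c2) by apply pow2_ge_0.
        assert (Ht2 : tau ^ 2 <= C0 ^ 2 * h ^ 2)
          by (rewrite <- Rpow_mult_distr; apply pow_incr; lra).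
        apply Rle_trans with (c2 * (C0 ^ 2 * h ^ 2)); [apply Rmult_le_compat_l; auto |].
        apply Rle_trans with (C0 ^ 2 * h * beta).
        - replace (c2 * (C0 ^ 2 * h ^ 2)) with (C0 ^ 2 * h * (h * c2)) by ring.
          apply Rmult_le_compat_l; [apply Rmult_le_pos; [apply pow2_ge_0 | lra] |]. lra.
        - replace (C0 ^ 2 * h * beta) with (h * x2 * e0 ^ 2) by (unfold x2; field; lra).
          generalize (pow2_ge_0 e0). nra. }
      assert (Hb0 : 0 <= e0 / tau) by (apply Rdiv_le_0_compat; lra).
      assert (HQ1 := quintic_le _ h J K (e (S n)) HJ HK Hb0 Hsup).
      assert (HL := ladyzhenskaya J K h (e (S n)) HJ HK Hh (HXe (S n) Hn)).
      assert (HQ2 : quintic h J K (e (S n)) <= e0 / tau * (mass h J K (e (S n)) * (B + 1) ^ 2)).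
      { eapply Rle_trans; [exact HQ1 |]. apply Rmult_le_compat_l; auto.
        eapply Rle_trans; [exact HL |]. apply Rmult_le_compat_l; [apply Hm |].
        apply pow_incr. generalize (dirichlet_nonneg h J K (e (S n)) HJ HK). lra. }
      assert (HQ3 : tau * kap * quintic h J K (e (S n)) <= mass h J K (e (S n)) / 4).
      { apply Rle_trans with (tau * kap * (e0 / tau * (mass h J K (e (S n)) * (B + 1) ^ 2))).
        - apply Rmult_le_compat_l; auto. apply Rmult_le_pos; lra.
        - apply Req_le. unfold e0. field. repeat split; try lra. }
      assert (HQ0 : quintic h J K (e n) <= mass h J K (e n))
        by (apply quintic_le_mass; auto).
      specialize (Hstep n ltac:(lia)). fold rho in Hstep.
      assert (HS : mass h J K (e (S n)) <= 3 * mass h J K (e n) + rho ^ 2).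
      { assert (A1 : tau * kap * (mass h J K (e n) + mass h J K (e (S n)) + quintic h J K (e n) + rho ^ 2)
           <= / 4 * (mass h J K (e n) + mass h J K (e (S n)) + mass h J K (e n) + rho ^ 2)).
        { generalize (Hm n) (Hm (S n)). intros.
          assert (0 <= quintic h J K (e n)).
          { apply Rmult_le_pos; [nra |]. apply gsum_nonneg; auto. intros; apply pow_le, Cmod_ge_0. }
          apply Rmult_le_compat; lra || (apply Rmult_le_pos; lra). }
        generalize (Hm n) (Hm (S n)). lra. }
      assert (Hhs := sup_sqr_le_mass h J K (e (S n)) j k Hj Hk).
      assert (HSr : mass h J K (e (S n)) <= (3 * G + 1) * rho ^ 2) by lra.
      assert (Hfin : h * h * Cmod (e (S n) j k) ^ 2 <= h * h * 1).
      { eapply Rle_trans; [exact Hhs |]. eapply Rle_trans; [exact HSr |].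
        apply Rle_trans with ((3 * G + 1) * ((C0 ^ 2 + 1) * h ^ 2) ^ 2).
        - apply Rmult_le_compat_l; [lra |]. apply pow_incr; auto.
        - replace ((3 * G + 1) * ((C0 ^ 2 + 1) * h ^ 2) ^ 2) with (h * h * (h * x3 * h))
            by (unfold x3; ring).
          apply Rmult_le_compat_l; [nra |].
          assert (0 <= h * x3) by (apply Rmult_le_pos; lra). nra. }
      apply Rmult_le_reg_l in Hfin; [| nra].
      apply Rsqr_incr_0_var; [| lra]. rewrite !Rsqr_pow2. lra. }
  intros n Hn. split; [apply Hsmall; auto; intros; apply (Hone n); auto |].
  intros j k Hj Hk.
  destruct (HXe n Hn) as [Hx Hy].
  destruct (Nat.eq_dec j J) as [->|HneJ].
  { destruct (Hx k Hk) as [_ ->]. rewrite Cmod_0. lra. }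
  destruct (Nat.eq_dec k K) as [->|HneK].
  { destruct (Hy j Hj) as [_ ->]. rewrite Cmod_0. lra. }
  apply (Hone n); auto; lia.
Qed.

(** The second bound carries no sup norm of difference quotients: those of [U]
    are those of [V], bounded by [M], minus those of the error, and the latter are
    multiplied by errors that are at most 1. *)
Lemma nonlin_increment (lambda nu eps M : R) :
  1 <= M ->
  exists B, 0 <= B /\
    forall h z z' w w' e e' f f', 0 < h ->
      Cmod z <= M -> Cmod z' <= M -> Cmod w <= M -> Cmod w' <= M ->
      Cmod (z' - z) <= M * h -> Cmod (w' - w) <= M * h ->
      Cmod e <= 1 -> Cmod e' <= 1 -> Cmod f <= 1 -> Cmod f' <= 1 ->
      let N1 := (nonlin lambda nu eps z w - nonlin lambda nu eps (z - e) (w - f))%C in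
      let N2 := (nonlin lambda nu eps z' w' - nonlin lambda nu eps (z' - e') (w' - f'))%C in
      let S := Cmod e + Cmod e' + Cmod f + Cmod f' in
      Cmod N1 <= B * S /\
      Cmod (N2 - N1) <= B * (S + Cmod (e' - e) / h + Cmod (f' - f) / h) * h.
Proof.
  intros HM. destruct (nonlin_paired lambda nu eps (M + 4)) as [B HB].
  exists (Rabs B). split; [apply Rabs_pos |].
  intros h z z' w w' e e' f f' Hh Hz Hz' Hw Hw' Hdz Hdw He He' Hf Hf' N1 N2 S.
  assert (P1 := Cmod_ge_0 e). assert (P2 := Cmod_ge_0 e').
  assert (P3 := Cmod_ge_0 f). assert (P4 := Cmod_ge_0 f').
  assert (P5 : 0 <= Cmod (e' - e) / h) by (apply Rdiv_le_0_compat; [apply Cmod_ge_0 | auto]).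
  assert (P6 : 0 <= Cmod (f' - f) / h) by (apply Rdiv_le_0_compat; [apply Cmod_ge_0 | auto]).
  assert (Q5 : Cmod (e' - e) / h * h = Cmod (e' - e)) by (field; lra).
  assert (Q6 : Cmod (f' - f) / h * h = Cmod (f' - f)) by (field; lra).
  (* the factor 4 makes [eta <= 1]; the constant [M + 4] compensates for it *)
  set (eta := S / 4). set (E := S + Cmod (e' - e) / h + Cmod (f' - f) / h).
  assert (HS : 0 <= S <= 4) by (unfold S; lra).
  assert (HE : S <= E) by (unfold E; lra).
  assert (Heta : 0 <= eta <= 1) by (unfold eta; lra).
  assert (Paired : forall x x' d d', Cmod x <= M -> Cmod x' <= M -> Cmod (x' - x) <= M * h ->
     Cmod d <= S -> Cmod d' <= S -> Cmod (d' - d) <= h * E ->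
     paired (M + 4) h eta E x x' (x - d) (x' - d')).
  { intros x x' d d' Hx Hx' Hdx Hd Hd' Hdd.
    assert (M4 : S <= (M + 4) * eta) by (unfold eta; nra).
    assert (HhE : 0 <= h * E) by (apply Rmult_le_pos; lra).
    repeat split; try lra.
    - replace (x - (x - d))%C with d by ring. lra.
    - replace (x' - (x' - d'))%C with d' by ring. lra.
    - replace (x' - (x' - d') - (x - (x - d)))%C with (d' - d)%C by ring.
      assert (0 <= M * (h * E)) by (apply Rmult_le_pos; lra). lra. }
  assert (Hp := HB h eta E z z' w w' (z - e)%C (z' - e')%C (w - f)%C (w' - f')%C
    ltac:(lra) Heta ltac:(unfold eta; lra)).
  destruct Hp as (_ & _ & K1 & _ & _ & K2).
  - apply Paired; auto; try (unfold S; lra).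
    apply Rle_trans with (Cmod (e' - e) / h * h); [lra |].
    rewrite Rmult_comm. apply Rmult_le_compat_l; unfold E; lra.
  - apply Paired; auto; try (unfold S; lra).
    apply Rle_trans with (Cmod (f' - f) / h * h); [lra |].
    rewrite Rmult_comm. apply Rmult_le_compat_l; unfold E; lra.
  - assert (HBa := Rle_abs B). split.
    + eapply Rle_trans; [exact K1 |]. apply Rle_trans with (Rabs B * eta).
      * apply Rmult_le_compat_r; lra.
      * apply Rmult_le_compat_l; [apply Rabs_pos | unfold eta; lra].
    + eapply Rle_trans; [exact K2 |].
      fold E. replace (Rabs B * E * h) with (Rabs B * h * E) by ring.
      apply Rmult_le_compat_r; [lra |]. apply Rmult_le_compat_r; lra.
Qed.

Lemma sqr_sum4_le (a b c d : R) : (a + b + c + d) ^ 2 <= 4 * (a ^ 2 + b ^ 2 + c ^ 2 + d ^ 2).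
Proof.
  generalize (pow2_ge_0 (a - b)) (pow2_ge_0 (a - c)) (pow2_ge_0 (a - d))
    (pow2_ge_0 (b - c)) (pow2_ge_0 (b - d)) (pow2_ge_0 (c - d)). nra.
Qed.

Lemma sqr_sum3_le (s p q : R) :
  (s + p + q) ^ 2 <= 3 * (s ^ 2 + p ^ 2 + q ^ 2).
Proof.
  generalize (pow2_ge_0 (s - p)) (pow2_ge_0 (s - q)) (pow2_ge_0 (p - q)). nra.
Qed.

Lemma X_JK_nonlin_error lambda nu eps Lx Ly T M h tau J K N V U n :
  comparison lambda nu eps Lx Ly T M h tau J K N V U -> (n < N)%nat ->
  X_JK J K (nonlin_error lambda nu eps V U n).
Proof.
  intros Hcmp Hn.
  assert (Z : nonlin lambda nu eps 0 0 = 0).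
  { rewrite nonlin_poly. apply injective_projections; simpl; ring. }
  apply (X_JK_map2 J K Cminus); [ring | |];
    apply (X_JK_map2 J K (nonlin lambda nu eps)); auto; first [apply (cmp_XV Hcmp) | apply (cmp_XU Hcmp)]; lia.
Qed.
Arguments X_JK_nonlin_error {_ _ _ _ _ _ _ _ _ _ _ _ _ _}.

Lemma Cmod_div_le (z : C) (h b : R) : 0 < h -> Cmod z <= b * h -> Cmod (z / RtoC h) <= b.
Proof.
  intros Hh Hz. rewrite Cmod_div by (intros E; apply RtoC_inj in E; lra).
  rewrite Cmod_R, Rabs_pos_eq by lra. apply Rle_div_l; auto.
Qed.

Lemma nonlin_error_bound (lambda nu eps Lx Ly T M : R) :
  1 <= M ->
  exists B, 0 <= B /\
    forall h tau J K N V U, comparison lambda nu eps Lx Ly T M h tau J K N V U ->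
    forall n, (n < N)%nat ->
    (forall i j k, (i <= N)%nat -> (j <= J)%nat -> (k <= K)%nat -> Cmod (error V U i j k) <= 1) ->
    let total := mass h J K (error V U n) + mass h J K (error V U (S n))
                 + dirichlet h J K (error V U n) + dirichlet h J K (error V U (S n)) in
    mass h J K (nonlin_error lambda nu eps V U n) <= B * total
    /\ dirichlet h J K (nonlin_error lambda nu eps V U n) <= B * total.
Proof.
  intros HM. destruct (nonlin_increment lambda nu eps M HM) as (B & HB & Hinc).
  exists (48 * B ^ 2). split; [generalize (pow2_ge_0 B); lra |].
  intros h tau J K N V U Hcmp n Hn Hone total.
  assert (X0 := X_JK_error n Hcmp ltac:(lia)).
  assert (X1 := X_JK_error (S n) Hcmp ltac:(lia)).
  comparison_facts Hcmp.
  assert (Hb := cmp_bound Hcmp).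
  assert (Hdx := cmp_dx Hcmp).
  assert (Hdy := cmp_dy Hcmp).
  assert (HU : forall i j k, U i j k = (V i j k - error V U i j k)%C)
    by (intros; unfold error; ring).
  set (e := error V U) in *.
  set (sq := fun i j k => Cmod (e i j k) ^ 2).
  set (gx := fun i j k => Cmod (dxp h (e i) j k) ^ 2).
  set (gy := fun i j k => Cmod (dyp h (e i) j k) ^ 2).
  assert (HB2 := pow2_ge_0 B).
  assert (Sx : forall i, (i = n \/ i = S n) ->
     gsum J K (fun j k => sq i (S j) k) = gsum J K (sq i)).
  { intros i [-> | ->]; apply gsum_shift_x; auto; [apply X0 | apply X1]. }
  assert (Sy : forall i, (i = n \/ i = S n) ->
     gsum J K (fun j k => sq i j (S k)) = gsum J K (sq i)).
  { intros i [-> | ->]; apply gsum_shift_y; auto; [apply X0 | apply X1]. }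
  set (Nl := nonlin_error lambda nu eps V U n).
  assert (Pair : forall j k j' k', (j <= J)%nat -> (k <= K)%nat -> (j' <= J)%nat -> (k' <= K)%nat ->
     (forall i, (i <= N)%nat -> Cmod (V i j' k' - V i j k) <= M * h) ->
     let s := sq n j k + sq n j' k' + sq (S n) j k + sq (S n) j' k' in
     Cmod (Nl j k) ^ 2 <= 4 * B ^ 2 * s
     /\ Cmod ((Nl j' k' - Nl j k) / RtoC h) ^ 2
        <= 12 * B ^ 2 * (s + Cmod ((e n j' k' - e n j k) / RtoC h) ^ 2
                           + Cmod ((e (S n) j' k' - e (S n) j k) / RtoC h) ^ 2)).
  { intros j k j' k' Hj Hk Hj' Hk' Hd s.
    destruct (Hinc h (V (S n) j k) (V (S n) j' k') (V n j k) (V n j' k')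
      (e (S n) j k) (e (S n) j' k') (e n j k) (e n j' k') Hh) as [N1 N2];
      try (apply Hb; lia); try (apply Hd; lia); try (apply Hone; lia).
    assert (A := sqr_sum4_le (Cmod (e (S n) j k)) (Cmod (e (S n) j' k')) (Cmod (e n j k)) (Cmod (e n j' k'))).
    unfold Nl, nonlin_error. rewrite !HU. split.
    - assert (A2 := pow_incr _ _ 2 (conj (Cmod_ge_0 _) N1)). rewrite Rpow_mult_distr in A2.
      eapply Rle_trans; [exact A2 |]. unfold s, sq. nra.
    - apply Cmod_div_le in N2; auto.
      assert (A2 := pow_incr _ _ 2 (conj (Cmod_ge_0 _) N2)). rewrite Rpow_mult_distr in A2.
      eapply Rle_trans; [exact A2 |]. rewrite !Cmod_div_sqr by auto.
      eapply Rle_trans; [apply Rmult_le_compat_l; [auto | apply sqr_sum3_le] |].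
      unfold s, sq.
      generalize (pow2_ge_0 (Cmod (e (S n) j' k' - e (S n) j k) / h))
        (pow2_ge_0 (Cmod (e n j' k' - e n j k) / h)). nra. }
  assert (Px : forall j k, (j < J)%nat -> (k < K)%nat ->
     Cmod (Nl j k) ^ 2 <= 4 * B ^ 2 * (sq n j k + sq n (S j) k + sq (S n) j k + sq (S n) (S j) k)
     /\ Cmod (dxp h Nl j k) ^ 2
       <= 12 * B ^ 2 * (sq n j k + sq n (S j) k + sq (S n) j k + sq (S n) (S j) k + gx n j k + gx (S n) j k)).
  { intros j k Hj Hk. apply (Pair j k (S j) k); try lia. intros; apply Hdx; lia. }
  assert (Py : forall j k, (j < J)%nat -> (k < K)%nat ->
     Cmod (dyp h Nl j k) ^ 2
       <= 12 * B ^ 2 * (sq n j k + sq n j (S k) + sq (S n) j k + sq (S n) j (S k) + gy n j k + gy (S n) j k)).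
  { intros j k Hj Hk. apply (Pair j k j (S k)); try lia. intros; apply Hdy; lia. }
  assert (Hm : forall i, mass h J K (e i) = h * h * gsum J K (sq i)) by reflexivity.
  assert (Hd : forall i, dirichlet h J K (e i) = h * h * (gsum J K (gx i) + gsum J K (gy i))).
  { intros i. unfold dirichlet. rewrite <- gsum_plus. f_equal. apply gsum_ext; auto.
    intros. unfold grad_dot, gx, gy. rewrite !Cmod_sqr. auto. }
  assert (Q : forall i, 0 <= gsum J K (sq i) /\ 0 <= gsum J K (gx i) /\ 0 <= gsum J K (gy i)).
  { intros i. repeat split; apply gsum_nonneg; auto; intros; apply pow2_ge_0. }
  destruct (Q n) as (q1 & q2 & q3). destruct (Q (S n)) as (q4 & q5 & q6).
  unfold total. rewrite !Hm, !Hd.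
  replace (48 * B ^ 2 * (h * h * gsum J K (sq n) + h * h * gsum J K (sq (S n))
      + h * h * (gsum J K (gx n) + gsum J K (gy n)) + h * h * (gsum J K (gx (S n)) + gsum J K (gy (S n)))))
    with (h * h * (48 * B ^ 2 * (gsum J K (sq n) + gsum J K (sq (S n))
      + (gsum J K (gx n) + gsum J K (gy n)) + (gsum J K (gx (S n)) + gsum J K (gy (S n)))))) by ring.
  split.
  - apply Rmult_le_compat_l; [nra |].
    eapply Rle_trans; [apply gsum_le; auto; intros j k Hj Hk; apply (Px j k Hj Hk) |].
    rewrite gsum_scal, !gsum_plus, !Sx by auto.
    assert (0 <= B ^ 2 * (gsum J K (sq n) + gsum J K (sq (S n)))) by (apply Rmult_le_pos; lra).
    assert (0 <= B ^ 2 * (gsum J K (gx n) + gsum J K (gy n) + gsum J K (gx (S n)) + gsum J K (gy (S n))))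
      by (apply Rmult_le_pos; lra).
    lra.
  - apply Rmult_le_compat_l; [nra |].
    apply Rle_trans with (gsum J K (fun j k =>
       12 * B ^ 2 * (sq n j k + sq n (S j) k + sq (S n) j k + sq (S n) (S j) k + gx n j k + gx (S n) j k)
       + 12 * B ^ 2 * (sq n j k + sq n j (S k) + sq (S n) j k + sq (S n) j (S k) + gy n j k + gy (S n) j k))).
    + apply gsum_le; auto. intros j k Hj Hk. unfold grad_dot. rewrite <- !Cmod_sqr.
      generalize (proj2 (Px j k Hj Hk)) (Py j k Hj Hk). lra.
    + rewrite !gsum_plus, !gsum_scal, !gsum_plus, !Sx, !Sy by auto.
      assert (0 <= B ^ 2 * (gsum J K (sq n) + gsum J K (sq (S n)))) by (apply Rmult_le_pos; lra).
      assert (0 <= B ^ 2 * (gsum J K (gx n) + gsum J K (gy n) + gsum J K (gx (S n)) + gsum J K (gy (S n))))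
        by (apply Rmult_le_pos; lra).
      lra.
Qed.

Lemma dot_Ci_young z w : dot z (Ci * w) <= (Cmod z ^ 2 + Cmod w ^ 2) / 2.
Proof.
  eapply Rle_trans; [apply dot_young |]. rewrite Cmod_mult, Cmod_Ci, Rmult_1_l. lra.
Qed.

(** Testing with the time difference of the error produces the Dirichlet energy.
    Testing with [i] times the nonlinear difference, which vanishes on the
    boundary, then removes the time difference from the nonlinear term. *)
Lemma dirichlet_error_identity lambda nu eps Lx Ly T M h tau J K N V U n :
  comparison lambda nu eps Lx Ly T M h tau J K N V U -> (n < N)%nat ->
  let e := error V U in
  let Nl := nonlin_error lambda nu eps V U n in
  let Rs := interior_part (residual lambda nu eps h tau V n) in
  dirichlet h J K (e (S n)) - dirichlet h J K (e n)
  = 2 * tau * (h * h * (gsum J K (grad_dot h (midlevel e n) (fun j k => Ci * Nl j k)%C)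
                        + gsum J K (fun j k => dot (Rs j k) (Ci * Nl j k))))
    - 2 * (h * h * gsum J K (fun j k => dot (Rs j k) (e (S n) j k - e n j k))).
Proof.
  intros Hcmp Hn e Nl Rs.
  assert (Heq := error_equation n Hcmp Hn).
  assert (X0 := X_JK_error n Hcmp ltac:(lia)).
  assert (X1 := X_JK_error (S n) Hcmp ltac:(lia)).
  assert (XN := X_JK_nonlin_error n Hcmp Hn).
  comparison_facts Hcmp.
  fold e in Heq, X0, X1. fold Nl in Heq, XN. fold Rs in Heq.
  assert (W1 := weak_form J K h (dtp tau e n) (midlevel e n) Nl Rs (dtp tau e n) HJ HK ltac:(lra)
    (X_JK_dtp J K tau e n X0 X1) Heq).
  assert (W2 := weak_form J K h (dtp tau e n) (midlevel e n) Nl Rs (fun j k => Ci * Nl j k)%C HJ HK ltac:(lra)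
    (X_JK_map J K (fun z => Ci * z)%C _ ltac:(apply Cmult_0_r) XN) Heq).
  assert (E2 : gsum J K (grad_dot h (midlevel e n) (dtp tau e n))
     = / (2 * tau) * (gsum J K (grad_dot h (e (S n)) (e (S n))) - gsum J K (grad_dot h (e n) (e n)))).
  { rewrite <- gsum_minus, <- gsum_scal. apply gsum_ext; auto. intros j k _ _.
    apply grad_midlevel_dtp; lra. }
  rewrite E2 in W1.
  assert (E3 : / (2 * tau) * (gsum J K (grad_dot h (e (S n)) (e (S n))) - gsum J K (grad_dot h (e n) (e n)))
    = gsum J K (grad_dot h (midlevel e n) (fun j k => Ci * Nl j k)%C)
      + gsum J K (fun j k => dot (Rs j k) (Ci * Nl j k))
      - / tau * gsum J K (fun j k => dot (Rs j k) (e (S n) j k - e n j k))).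
  { rewrite <- W1, <- W2, <- gsum_scal, <- gsum_plus, <- gsum_minus.
    apply gsum_ext; auto. intros j k _ _. unfold dtp. rewrite Cdiv_RtoC by lra.
    unfold dot; simpl. field. lra. }
  unfold dirichlet.
  apply (f_equal (Rmult (2 * tau * (h * h)))) in E3.
  replace (2 * tau * (h * h) * (/ (2 * tau) * (gsum J K (grad_dot h (e (S n)) (e (S n))) - gsum J K (grad_dot h (e n) (e n)))))
    with (h * h * gsum J K (grad_dot h (e (S n)) (e (S n))) - h * h * gsum J K (grad_dot h (e n) (e n))) in E3
    by (field; lra).
  rewrite E3.
  set (x := gsum J K (grad_dot _ _ _)). set (y := gsum J K _). set (z := gsum J K _).
  clearbody x y z. field. lra.
Qed.
Arguments dirichlet_error_identity {_ _ _ _ _ _ _ _ _ _ _ _ _ _}.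

(** The term pairing the residual with the time difference of the error is
    summed by parts in time: this costs a time difference of the residual, which
    is small, whereas summing by parts in space would involve its boundary
    values. *)
Lemma dirichlet_error_bound (lambda nu eps Lx Ly T M C0 : R) :
  0 < nu -> 0 <= eps -> 0 < Lx -> 0 < Ly -> 0 < T -> 1 <= M -> 0 < C0 ->
  exists h0 G, 0 < h0 /\ 0 < G /\
    forall h tau J K N V U, comparison lambda nu eps Lx Ly T M h tau J K N V U ->
    h <= h0 -> tau <= C0 * h ->
    forall n, (n <= N)%nat ->
      mass h J K (error V U n) <= G * (tau ^ 2 + h ^ 2) ^ 2
      /\ dirichlet h J K (error V U n) <= G * (tau ^ 2 + h ^ 2) ^ 2.
Proof.
  intros Hnu Heps HLx HLy HT HM HC0.
  destruct (mass_error_bound lambda nu eps Lx Ly T M C0) as (h1 & G & Hh1 & HG & Hmass); auto.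
  destruct (nonlin_error_bound lambda nu eps Lx Ly T M) as (B & HB & HN); auto.
  set (A := Lx * Ly * M ^ 2).
  assert (HA : 0 < A) by (unfold A; apply Rmult_lt_0_compat; [nra | apply pow_lt; lra]).
  (* [P] bounds the pairing of residual and error *)
  set (P := (A + G) / 2).
  set (kap := (1 + 3 * B) * (1 + 2 * G) + A + P).
  assert (Hkap : 0 < kap).
  { unfold kap, P. assert (0 <= (1 + 3 * B) * (1 + 2 * G)) by (apply Rmult_le_pos; lra). lra. }
  set (G2 := (2 * P + 1) * exp (4 * (2 * kap) * T)).
  assert (HG2 : 0 < G2) by (apply Rmult_lt_0_compat; [unfold P; lra | apply exp_pos]).
  exists (Rmin h1 (/ (4 * kap * C0))), (G + G2).
  assert (HkC : 0 < 4 * kap * C0) by (apply Rmult_lt_0_compat; lra).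
  split; [apply Rmin_glb_lt; auto; apply Rinv_0_lt_compat; auto |]. split; [lra |].
  intros h tau J K N V U Hcmp Hh0 HtC.
  assert (Hhh1 : h <= h1) by (eapply Rle_trans; [exact Hh0 | apply Rmin_l]).
  assert (Hhk : h <= / (4 * kap * C0)) by (eapply Rle_trans; [exact Hh0 | apply Rmin_r]).
  specialize (Hmass h tau J K N V U Hcmp Hhh1 HtC).
  comparison_facts Hcmp.
  assert (HNb := fun n Hn => HN h tau J K N V U Hcmp n Hn
     (fun i j k Hi Hj Hk => proj2 (Hmass i Hi) j k Hj Hk)).
  assert (Hid := fun n => dirichlet_error_identity n Hcmp).
  cbv zeta in HNb, Hid.
  set (rho := tau ^ 2 + h ^ 2) in *.
  assert (Hrho : 0 <= rho) by (unfold rho; generalize (pow2_ge_0 tau) (pow2_ge_0 h); lra).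
  assert (Hr2 : 0 <= rho ^ 2) by apply pow2_ge_0.
  set (Rs := fun n => interior_part (residual lambda nu eps h tau V n)).
  assert (HR : forall n j k, (n < N)%nat -> (j < J)%nat -> (k < K)%nat -> Cmod (Rs n j k) ^ 2 <= M ^ 2 * rho ^ 2).
  { intros n j k Hn Hj Hk. rewrite <- Rpow_mult_distr. apply pow_incr. split; [apply Cmod_ge_0 |].
    apply (interior_part_bound J K); auto; [apply Rmult_le_pos; lra |].
    intros; eapply cmp_res; eauto. }
  assert (HdR : forall n j k, (S n < N)%nat -> (j < J)%nat -> (k < K)%nat ->
     Cmod (Rs (S n) j k - Rs n j k) <= tau * (M * rho)).
  { intros n j k Hn Hj Hk. unfold Rs.
    replace (interior_part (residual lambda nu eps h tau V (S n)) j k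
             - interior_part (residual lambda nu eps h tau V n) j k)%C
      with (interior_part (fun j k => residual lambda nu eps h tau V (S n) j k
                                      - residual lambda nu eps h tau V n j k)%C j k).
    2: { destruct j; [simpl; ring |]. destruct k; [simpl; ring |]. reflexivity. }
    replace (tau * (M * rho)) with (M * tau * rho) by ring.
    apply (interior_part_bound J K); auto; [repeat apply Rmult_le_pos; lra |].
    intros; eapply cmp_dres; eauto. }
  set (e := error V U) in *.
  assert (He0 : forall j k, (j <= J)%nat -> (k <= K)%nat -> e 0%nat j k = RtoC 0).
  { intros j k Hj Hk. unfold e, error. rewrite Hinit by auto. ring. }
  assert (Hmn : forall n, 0 <= mass h J K (e n)) by (intros; apply mass_nonneg; auto).
  assert (Hdn : forall n, 0 <= dirichlet h J K (e n)) by (intros; apply dirichlet_nonneg; auto).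
  assert (Hdot : forall (f g : gridfun) s,
     (forall j k, (j < J)%nat -> (k < K)%nat ->
        Cmod (f j k) * Cmod (g j k) <= s * (M ^ 2 * rho ^ 2 + Cmod (g j k) ^ 2) / 2) ->
     Rabs (h * h * gsum J K (fun j k => dot (f j k) (g j k))) <= s * (A * rho ^ 2 + mass h J K g) / 2).
  { intros f g s Hf.
    assert (Hs : forall sg, (sg = 1 \/ sg = -1) ->
      sg * (h * h * gsum J K (fun j k => dot (f j k) (g j k))) <= s * (A * rho ^ 2 + mass h J K g) / 2).
    { intros sg Hsg.
      replace (sg * (h * h * gsum J K (fun j k => dot (f j k) (g j k))))
        with (h * h * (sg * gsum J K (fun j k => dot (f j k) (g j k)))) by ring.
      replace (s * (A * rho ^ 2 + mass h J K g) / 2) with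
        (h * h * (s / 2 * (INR J * INR K * (M ^ 2 * rho ^ 2) + gsum J K (fun j k => Cmod (g j k) ^ 2))))
        by (unfold mass, A; rewrite <- HLx', <- HLy'; field).
      apply Rmult_le_compat_l; [nra |].
      rewrite <- gsum_const, <- gsum_plus, <- !gsum_scal by auto. apply gsum_le; auto.
      intros j k Hj Hk. generalize (Hf j k Hj Hk) (proj1 (Rabs_le_between _ _) (dot_le_Cmod (f j k) (g j k))).
      destruct Hsg as [-> | ->]; lra. }
    apply Rabs_le. generalize (Hs 1 ltac:(auto)) (Hs (-1) ltac:(auto)). lra. }
  assert (HdotR : forall n (g : gridfun), (n < N)%nat ->
     Rabs (h * h * gsum J K (fun j k => dot (Rs n j k) (g j k))) <= (A * rho ^ 2 + mass h J K g) / 2).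
  { intros n g Hn. rewrite <- (Rmult_1_l (A * rho ^ 2 + mass h J K g)). apply Hdot. intros j k Hj Hk.
    generalize (HR n j k Hn Hj Hk) (pow2_ge_0 (Cmod (Rs n j k) - Cmod (g j k))). lra. }
  (* [pred] moves the residual one level back; at level 0 the error vanishes *)
  set (Q := fun n => h * h * gsum J K (fun j k => dot (Rs (pred n) j k) (e n j k))).
  assert (HQ : forall n, (1 <= N)%nat -> (n <= N)%nat -> - (P * rho ^ 2) <= Q n <= P * rho ^ 2).
  { intros n HN1 Hn. destruct (Hmass n Hn) as [Hm _].
    apply Rabs_le_between. eapply Rle_trans; [apply HdotR; lia |]. unfold P. lra. }
  assert (HQstep : forall n, (n < N)%nat ->
     - (h * h * gsum J K (fun j k => dot (Rs n j k) (e (S n) j k - e n j k)))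
     <= Q n - Q (S n) + tau * (P * rho ^ 2)).
  { intros n Hn.
    assert (HPt : 0 <= tau * (P * rho ^ 2)) by (repeat apply Rmult_le_pos; unfold P; lra).
    assert (E : - (h * h * gsum J K (fun j k => dot (Rs n j k) (e (S n) j k - e n j k)))
       = Q n - Q (S n) + h * h * gsum J K (fun j k => dot (Rs n j k - Rs (pred n) j k) (e n j k))).
    { unfold Q.
      replace (h * h * gsum J K (fun j k => dot (Rs (pred n) j k) (e n j k)) -
         h * h * gsum J K (fun j k => dot (Rs (pred (S n)) j k) (e (S n) j k)) +
         h * h * gsum J K (fun j k => dot (Rs n j k - Rs (pred n) j k) (e n j k)))
        with (h * h * (gsum J K (fun j k => dot (Rs (pred n) j k) (e n j k)) -
         gsum J K (fun j k => dot (Rs (pred (S n)) j k) (e (S n) j k)) +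
         gsum J K (fun j k => dot (Rs n j k - Rs (pred n) j k) (e n j k)))) by ring.
      rewrite <- gsum_minus, <- gsum_plus, Ropp_mult_distr_r. f_equal.
      replace (- gsum J K (fun j k => dot (Rs n j k) (e (S n) j k - e n j k)))
        with ((-1) * gsum J K (fun j k => dot (Rs n j k) (e (S n) j k - e n j k))) by ring.
      rewrite <- gsum_scal. apply gsum_ext; auto. intros j k _ _.
      change (pred (S n)) with n. unfold dot; simpl; ring. }
    rewrite E. apply Rplus_le_compat_l.
    destruct n as [|n].
    - rewrite (gsum_ext J K _ (fun _ _ => 0)); auto.
      + rewrite gsum_zero. lra.
      + intros j k Hj Hk. rewrite He0 by lia. unfold dot; simpl; ring.
    - change (pred (S n)) with n.
      assert (H := Hdot (fun j k => Rs (S n) j k - Rs n j k)%C (e (S n)) tau).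
      destruct (Hmass (S n) ltac:(lia)) as [Hm _].
      eapply Rle_trans; [apply Rle_abs |]. eapply Rle_trans; [apply H |].
      + intros j k Hj Hk.
        assert (H1 := HdR n j k Hn Hj Hk). assert (H2 := Cmod_ge_0 (e (S n) j k)).
        apply Rle_trans with (tau * (M * rho) * Cmod (e (S n) j k)); [apply Rmult_le_compat_r; auto |].
        assert (H3 := pow2_ge_0 (M * rho - Cmod (e (S n) j k))).
        replace (tau * (M ^ 2 * rho ^ 2 + Cmod (e (S n) j k) ^ 2) / 2)
          with (tau * (M * rho) * Cmod (e (S n) j k) + tau * ((M * rho - Cmod (e (S n) j k)) ^ 2) / 2) by field.
        assert (0 <= tau * ((M * rho - Cmod (e (S n) j k)) ^ 2)) by (apply Rmult_le_pos; lra). lra.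
      + unfold P. assert (tau * mass h J K (e (S n)) <= tau * (G * rho ^ 2)) by (apply Rmult_le_compat_l; lra).
        lra. }
  assert (Hmain : forall n, (n < N)%nat ->
     h * h * (gsum J K (grad_dot h (midlevel e n) (fun j k => Ci * nonlin_error lambda nu eps V U n j k)%C)
              + gsum J K (fun j k => dot (Rs n j k) (Ci * nonlin_error lambda nu eps V U n j k)))
     <= kap * (dirichlet h J K (e n) + dirichlet h J K (e (S n)) + rho ^ 2) - P * rho ^ 2).
  { intros n Hn. destruct (HNb n Hn) as [N1 N2].
    set (Nl := nonlin_error lambda nu eps V U n) in *.
    set (tot := mass h J K (e n) + mass h J K (e (S n)) + dirichlet h J K (e n) + dirichlet h J K (e (S n))) in *.
    assert (I1 : h * h * gsum J K (grad_dot h (midlevel e n) (fun j k => Ci * Nl j k)%C)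
      <= (dirichlet h J K (e n) + dirichlet h J K (e (S n))) / 4 + dirichlet h J K Nl / 2).
    { apply Rle_trans with (h * h * ((/ 4) * (gsum J K (grad_dot h (e n) (e n)) + gsum J K (grad_dot h (e (S n)) (e (S n))))
        + / 2 * gsum J K (grad_dot h Nl Nl))).
      - apply Rmult_le_compat_l; [nra |]. rewrite <- gsum_plus, <- !gsum_scal, <- gsum_plus.
        apply gsum_le; auto. intros j k _ _. unfold grad_dot.
        assert (Y : forall z w x : C, dot (mid z w) (Ci * x) <= / 4 * (dot w w + dot z z) + / 2 * dot x x).
        { intros z w x. eapply Rle_trans; [apply dot_Ci_young |].
          generalize (Cmod_mid_sqr z w). rewrite !Cmod_sqr. lra. }
        assert (Yx : dxp h (midlevel e n) j k = mid (dxp h (e (S n)) j k) (dxp h (e n) j k)).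
        { unfold dxp, midlevel, mid, Cdiv. ring. }
        assert (Yy : dyp h (midlevel e n) j k = mid (dyp h (e (S n)) j k) (dyp h (e n) j k)).
        { unfold dyp, midlevel, mid, Cdiv. ring. }
        assert (Zx : dxp h (fun j k => Ci * Nl j k)%C j k = (Ci * dxp h Nl j k)%C).
        { unfold dxp, Cdiv. ring. }
        assert (Zy : dyp h (fun j k => Ci * Nl j k)%C j k = (Ci * dyp h Nl j k)%C).
        { unfold dyp, Cdiv. ring. }
        rewrite Yx, Yy, Zx, Zy.
        generalize (Y (dxp h (e (S n)) j k) (dxp h (e n) j k) (dxp h Nl j k))
          (Y (dyp h (e (S n)) j k) (dyp h (e n) j k) (dyp h Nl j k)). lra.
      - unfold dirichlet. apply Req_le. field. }
    assert (I2 : h * h * gsum J K (fun j k => dot (Rs n j k) (Ci * Nl j k)) <= (A * rho ^ 2 + mass h J K Nl) / 2).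
    { assert (E : mass h J K (fun j k => Ci * Nl j k)%C = mass h J K Nl).
      { unfold mass. f_equal. apply gsum_ext; auto. intros. rewrite Cmod_mult, Cmod_Ci, Rmult_1_l. auto. }
      rewrite <- E. eapply Rle_trans; [apply Rle_abs | apply HdotR; auto]. }
    destruct (Hmass n ltac:(lia)) as [Hm0 _]. destruct (Hmass (S n) ltac:(lia)) as [Hm1 _].
    assert (Htot : tot <= 2 * G * rho ^ 2 + (dirichlet h J K (e n) + dirichlet h J K (e (S n))))
      by (unfold tot; lra).
    assert (HBt : B * tot <= B * (2 * G * rho ^ 2 + (dirichlet h J K (e n) + dirichlet h J K (e (S n)))))
      by (apply Rmult_le_compat_l; auto).
    set (D := dirichlet h J K (e n) + dirichlet h J K (e (S n))) in *.
    assert (HD : 0 <= D) by (unfold D; generalize (Hdn n) (Hdn (S n)); lra).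
    replace (dirichlet h J K (e n) + dirichlet h J K (e (S n)) + rho ^ 2) with (D + rho ^ 2) by (unfold D; ring).
    rewrite Rmult_plus_distr_l.
    apply Rle_trans with (D / 4 + B * (2 * G * rho ^ 2 + D) + A * rho ^ 2 / 2); [lra |].
    unfold kap, P.
    assert (0 <= B * D) by (apply Rmult_le_pos; auto).
    assert (0 <= G * D) by (apply Rmult_le_pos; lra).
    assert (0 <= A * D) by (apply Rmult_le_pos; lra).
    assert (0 <= B * (G * D)) by (apply Rmult_le_pos; auto).
    assert (0 <= B * rho ^ 2) by (apply Rmult_le_pos; auto).
    assert (0 <= G * rho ^ 2) by (apply Rmult_le_pos; lra).
    assert (0 <= A * rho ^ 2) by (apply Rmult_le_pos; lra).
    assert (0 <= B * (G * rho ^ 2)) by (apply Rmult_le_pos; lra).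
    lra. }
  intros n Hn.
  assert (HmG : mass h J K (e n) <= (G + G2) * rho ^ 2).
  { destruct (Hmass n Hn) as [Hm _]. assert (0 <= G2 * rho ^ 2) by (apply Rmult_le_pos; lra). lra. }
  split; [exact HmG |].
  assert (HN1 : (1 <= N)%nat).
  { destruct N; [| lia]. simpl in HNT. lra. }
  set (z := fun n => dirichlet h J K (e n) + 2 * Q n + 2 * P * rho ^ 2).
  assert (Hzd : forall n, (n <= N)%nat -> dirichlet h J K (e n) <= z n).
  { intros i Hi. unfold z. generalize (HQ i HN1 Hi). lra. }
  assert (Hkt : kap * tau <= / 4).
  { apply Rle_trans with (kap * (C0 * / (4 * kap * C0))).
    - apply Rmult_le_compat_l; [lra |]. eapply Rle_trans; [exact HtC |]. apply Rmult_le_compat_l; lra.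
    - apply Req_le. field. lra. }
  assert (Hgr := discrete_gronwall (2 * kap) tau (rho ^ 2) z N ltac:(lra) ltac:(lra) ltac:(lra) Hr2).
  assert (Hz0 : z 0%nat = 2 * P * rho ^ 2).
  { unfold z, Q, dirichlet.
    rewrite (gsum_ext J K (grad_dot h (e 0%nat) (e 0%nat)) (fun _ _ => 0)); auto.
    - rewrite (gsum_ext J K (fun j k => dot (Rs (pred 0) j k) (e 0%nat j k)) (fun _ _ => 0)); auto.
      + rewrite gsum_zero. ring.
      + intros. rewrite He0 by lia. unfold dot; simpl; ring.
    - intros j k Hj Hk. unfold grad_dot, dxp, dyp. rewrite !He0 by lia.
      unfold dot, Cdiv; simpl; ring. }
  apply Rle_trans with (z n); [apply Hzd; auto |].
  apply Rle_trans with ((z 0%nat + rho ^ 2) * exp (4 * (2 * kap) * (INR n * tau))).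
  - apply Hgr; auto.
    + intros i Hi. eapply Rle_trans; [apply (Hdn i) | apply Hzd; auto].
    + intros i Hi. assert (H1 := Hid i Hi). fold e in H1. fold (Rs i) in H1.
      assert (H2 := HQstep i Hi).
      assert (H3 := Hmain i Hi).
      assert (D0 := Hzd i ltac:(lia)). assert (D1 := Hzd (S i) ltac:(lia)).
      apply (Rmult_le_compat_l (2 * tau)) in H3; [| lra].
      assert (H4 : dirichlet h J K (e (S i)) + 2 * Q (S i)
                   <= dirichlet h J K (e i) + 2 * Q i
                      + 2 * tau * (kap * (dirichlet h J K (e i) + dirichlet h J K (e (S i)) + rho ^ 2))).
      { rewrite Rmult_minus_distr_l in H3. lra. }
      assert (H5 : 2 * tau * (kap * (dirichlet h J K (e i) + dirichlet h J K (e (S i)) + rho ^ 2))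
                   <= tau * (2 * kap * (z i + z (S i) + rho ^ 2))).
      { replace (tau * (2 * kap * (z i + z (S i) + rho ^ 2))) with (2 * tau * (kap * (z i + z (S i) + rho ^ 2))) by ring.
        apply Rmult_le_compat_l; [lra |]. apply Rmult_le_compat_l; lra. }
      unfold z at 1 2. lra.
  - rewrite Hz0. apply Rle_trans with (G2 * rho ^ 2).
    + unfold G2. replace (2 * P * rho ^ 2 + rho ^ 2) with ((2 * P + 1) * rho ^ 2) by ring.
      rewrite (Rmult_assoc (2 * P + 1)), (Rmult_assoc (2 * P + 1)), (Rmult_comm (rho ^ 2)).
      apply Rmult_le_compat_l; [unfold P; lra |]. apply Rmult_le_compat_r; auto.
      apply exp_monotone. apply Rmult_le_compat_l; [lra |]. rewrite <- HNT.
      apply Rmult_le_compat_r; [lra |]. apply le_INR; auto.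
    + assert (0 <= G * rho ^ 2) by (apply Rmult_le_pos; lra). lra.
Qed.

(** * One-dimensional Taylor estimates *)

Lemma mvt_bound (f f' : R -> R) (lo hi M : R) :
  (forall s, lo <= s <= hi -> is_derive f s (f' s)) ->
  (forall s, lo <= s <= hi -> Rabs (f' s) <= M) ->
  forall x y, lo <= x <= hi -> lo <= y <= hi -> Rabs (f y - f x) <= M * Rabs (y - x).
Proof.
  intros Hd Hb x y Hx Hy.
  assert (Hin : forall s, Rmin x y <= s <= Rmax x y -> lo <= s <= hi).
  { intros s Hs. generalize (Rmin_glb x y lo) (Rmax_lub x y hi). lra. }
  destruct (MVT_gen f x y f') as [c [Hc E]].
  - intros s Hs. apply Hd, Hin. lra.
  - intros s Hs. apply continuity_pt_filterlim.
    apply (ex_derive_continuous f). exists (f' s). apply Hd, Hin, Hs.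
  - rewrite E, Rabs_mult. apply Rmult_le_compat_r; [apply Rabs_pos |]. apply Hb, Hin, Hc.
Qed.

Lemma vanishing_growth (g g' : R -> R) (h B : R) :
  g 0 = 0 ->
  (forall s, 0 <= s <= h -> is_derive g s (g' s)) ->
  (forall s, 0 <= s <= h -> Rabs (g' s) <= B) ->
  forall s, 0 <= s <= h -> Rabs (g s) <= B * h.
Proof.
  intros H0 Hd Hb s Hs.
  assert (H := mvt_bound g g' 0 h B Hd Hb 0 s ltac:(lra) Hs).
  rewrite H0, !Rminus_0_r in H. rewrite (Rabs_pos_eq s) in H by lra.
  assert (0 <= B) by (eapply Rle_trans; [apply Rabs_pos | apply (Hb s Hs)]).
  eapply Rle_trans; [exact H |]. apply Rmult_le_compat_l; lra.
Qed.

Lemma is_derive_shift (f : R -> R) (x s l : R) :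
  is_derive f (x + s) l -> is_derive (fun s => f (x + s)) s l.
Proof.
  intros H. evar_last; [apply (is_derive_comp f (fun s => x + s) s l 1); [exact H | auto_derive; auto] |].
  unfold scal; simpl. apply Rmult_1_l.
Qed.

Lemma is_derive_reflect (f : R -> R) (x s l : R) :
  is_derive f (x - s) l -> is_derive (fun s => f (x - s)) s (- l).
Proof.
  intros H. evar_last; [apply (is_derive_comp f (fun s => x - s) s l (-1)); [exact H | auto_derive; auto; ring] |].
  unfold scal; simpl. unfold mult; simpl. ring.
Qed.

Lemma is_derive_minus_R (f g : R -> R) (x l m : R) :
  is_derive f x l -> is_derive g x m -> is_derive (fun s => f s - g s) x (l - m).
Proof. intros Hf Hg. apply (is_derive_minus f g x l m Hf Hg). Qed.

Lemma is_derive_plus_R (f g : R -> R) (x l m : R) :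
  is_derive f x l -> is_derive g x m -> is_derive (fun s => f s + g s) x (l + m).
Proof. intros Hf Hg. apply (is_derive_plus f g x l m Hf Hg). Qed.

Lemma is_derive_eq (f : R -> R) (x l m : R) : is_derive f x l -> l = m -> is_derive f x m.
Proof. intros H <-. exact H. Qed.

(** As a function of the step the defect vanishes to fourth order at 0; its
    fourth derivative involves only [F 4]. *)
Lemma centered_difference (F : nat -> R -> R) (x h M : R) :
  0 <= h ->
  (forall i s, (i < 4)%nat -> x - h <= s <= x + h -> is_derive (F i) s (F (S i) s)) ->
  (forall s, x - h <= s <= x + h -> Rabs (F 4%nat s) <= M) ->
  Rabs (F 0%nat (x + h) - 2 * F 0%nat x + F 0%nat (x - h) - h ^ 2 * F 2%nat x)
  <= 2 * M * h ^ 4.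
Proof.
  intros Hh Hd Hb.
  assert (Dp : forall i s, (i < 4)%nat -> 0 <= s <= h -> is_derive (fun s => F i (x + s)) s (F (S i) (x + s))).
  { intros i s Hi Hs. apply is_derive_shift, Hd; auto; lra. }
  assert (Dm : forall i s, (i < 4)%nat -> 0 <= s <= h -> is_derive (fun s => F i (x - s)) s (- F (S i) (x - s))).
  { intros i s Hi Hs. apply is_derive_reflect, Hd; auto; lra. }
  assert (B3 : forall s, 0 <= s <= h -> Rabs (F 3%nat (x + s) - F 3%nat (x - s)) <= 2 * M * h).
  { apply (vanishing_growth (fun s => F 3%nat (x + s) - F 3%nat (x - s))
            (fun s => F 4%nat (x + s) - (- F 4%nat (x - s))) h (2 * M)).
    - rewrite Rplus_0_r, Rminus_0_r. ring.
    - intros s Hs. apply is_derive_minus_R; [apply Dp | apply Dm]; auto; lia.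
    - intros s Hs. unfold Rminus at 1. rewrite Ropp_involutive. eapply Rle_trans; [apply Rabs_triang |].
      generalize (Hb (x + s) ltac:(lra)) (Hb (x - s) ltac:(lra)). lra. }
  assert (B2 : forall s, 0 <= s <= h -> Rabs (F 2%nat (x + s) + F 2%nat (x - s) - 2 * F 2%nat x) <= 2 * M * h * h).
  { apply (vanishing_growth (fun s => F 2%nat (x + s) + F 2%nat (x - s) - 2 * F 2%nat x)
            (fun s => F 3%nat (x + s) - F 3%nat (x - s)) h (2 * M * h)); auto.
    - rewrite Rplus_0_r, Rminus_0_r. ring.
    - intros s Hs. eapply is_derive_eq.
      + apply is_derive_minus_R; [apply is_derive_plus_R; [apply Dp | apply Dm]; auto; lia |].
        apply (is_derive_const (2 * F 2%nat x)).
      + unfold zero; simpl. ring. }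
  assert (B1 : forall s, 0 <= s <= h -> Rabs (F 1%nat (x + s) - F 1%nat (x - s) - 2 * s * F 2%nat x) <= 2 * M * h * h * h).
  { apply (vanishing_growth (fun s => F 1%nat (x + s) - F 1%nat (x - s) - 2 * s * F 2%nat x)
            (fun s => F 2%nat (x + s) + F 2%nat (x - s) - 2 * F 2%nat x) h (2 * M * h * h)); auto.
    - rewrite Rplus_0_r, Rminus_0_r. ring.
    - intros s Hs. eapply is_derive_eq.
      + apply is_derive_minus_R; [apply is_derive_minus_R; [apply Dp | apply Dm]; auto; lia |].
        assert (H : is_derive (fun s => 2 * s * F 2%nat x) s (2 * F 2%nat x)) by (auto_derive; auto; ring).
        exact H.
      + ring. }
  assert (B0 : forall s, 0 <= s <= h ->
     Rabs (F 0%nat (x + s) + F 0%nat (x - s) - 2 * F 0%nat x - s ^ 2 * F 2%nat x) <= 2 * M * h * h * h * h).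
  { apply (vanishing_growth (fun s => F 0%nat (x + s) + F 0%nat (x - s) - 2 * F 0%nat x - s ^ 2 * F 2%nat x)
            (fun s => F 1%nat (x + s) - F 1%nat (x - s) - 2 * s * F 2%nat x) h (2 * M * h * h * h)); auto.
    - rewrite Rplus_0_r, Rminus_0_r. ring.
    - intros s Hs. eapply is_derive_eq.
      + apply is_derive_minus_R; [apply is_derive_minus_R; [apply is_derive_plus_R; [apply Dp | apply Dm]; auto; lia |] |].
        * apply (is_derive_const (2 * F 0%nat x)).
        * assert (H : is_derive (fun s => s ^ 2 * F 2%nat x) s (2 * s * F 2%nat x)) by (auto_derive; auto; ring).
          exact H.
      + unfold zero; simpl. ring. }
  specialize (B0 h ltac:(lra)).
  replace (F 0%nat (x + h) - 2 * F 0%nat x + F 0%nat (x - h) - h ^ 2 * F 2%nat x)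
    with (F 0%nat (x + h) + F 0%nat (x - h) - 2 * F 0%nat x - h ^ 2 * F 2%nat x) by ring.
  replace (2 * M * h ^ 4) with (2 * M * h * h * h * h) by ring. exact B0.
Qed.

Lemma trapezoidal_rule (F : nat -> R -> R) (t h M : R) :
  0 <= h ->
  (forall i s, (i < 3)%nat -> t <= s <= t + h -> is_derive (F i) s (F (S i) s)) ->
  (forall s, t <= s <= t + h -> Rabs (F 3%nat s) <= M) ->
  Rabs (F 0%nat (t + h) - F 0%nat t - h / 2 * (F 1%nat (t + h) + F 1%nat t)) <= M * h ^ 3.
Proof.
  intros Hh Hd Hb.
  assert (Dp : forall i s, (i < 3)%nat -> 0 <= s <= h -> is_derive (fun s => F i (t + s)) s (F (S i) (t + s))).
  { intros i s Hi Hs. apply is_derive_shift, Hd; auto; lra. }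
  assert (HM : 0 <= M) by (eapply Rle_trans; [apply Rabs_pos | apply (Hb t ltac:(lra))]).
  assert (Dq : forall i s, (i < 3)%nat -> 0 <= s <= h ->
     is_derive (fun s => s / 2 * F i (t + s)) s (/ 2 * F i (t + s) + s / 2 * F (S i) (t + s))).
  { intros i s Hi Hs.
    assert (H1 : is_derive (fun s => s / 2) s (/ 2)) by (auto_derive; auto; field).
    assert (H := is_derive_mult (fun s => s / 2) (fun s => F i (t + s)) s _ _ H1 (Dp i s Hi Hs) Rmult_comm).
    exact H. }
  assert (B1 : forall s, 0 <= s <= h -> Rabs (/ 2 * (F 1%nat (t + s) - F 1%nat t) - s / 2 * F 2%nat (t + s)) <= M * h * h).
  { apply (vanishing_growth (fun s => / 2 * (F 1%nat (t + s) - F 1%nat t) - s / 2 * F 2%nat (t + s))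
            (fun s => - (s / 2 * F 3%nat (t + s))) h (M * h)).
    - rewrite Rplus_0_r. field.
    - intros s Hs. eapply is_derive_eq.
      + apply is_derive_minus_R; [| apply Dq; auto; lia].
        apply (is_derive_scal (fun s => F 1%nat (t + s) - F 1%nat t) s (/ 2)).
        apply is_derive_minus_R; [apply Dp; auto; lia | apply (is_derive_const (F 1%nat t))].
      + unfold zero; simpl. ring.
    - intros s Hs. rewrite Rabs_Ropp, Rabs_mult, Rabs_pos_eq by lra.
      rewrite (Rmult_comm M). apply Rmult_le_compat; try lra; [apply Rabs_pos |]. apply Hb; lra. }
  assert (B0 : forall s, 0 <= s <= h ->
     Rabs (F 0%nat (t + s) - F 0%nat t - (s / 2 * F 1%nat (t + s) + s / 2 * F 1%nat t)) <= M * h * h * h).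
  { apply (vanishing_growth (fun s => F 0%nat (t + s) - F 0%nat t - (s / 2 * F 1%nat (t + s) + s / 2 * F 1%nat t))
            (fun s => / 2 * (F 1%nat (t + s) - F 1%nat t) - s / 2 * F 2%nat (t + s)) h (M * h * h)); auto.
    - rewrite Rplus_0_r. field.
    - intros s Hs. eapply is_derive_eq.
      + apply is_derive_minus_R; [apply is_derive_minus_R; [apply Dp; auto; lia | apply (is_derive_const (F 0%nat t))] |].
        apply is_derive_plus_R; [apply Dq; auto; lia |].
        assert (H : is_derive (fun s => s / 2 * F 1%nat t) s (/ 2 * F 1%nat t)) by (auto_derive; auto; field).
        exact H.
      + unfold zero; simpl. field. }
  specialize (B0 h ltac:(lra)).
  replace (h / 2 * (F 1%nat (t + h) + F 1%nat t)) with (h / 2 * F 1%nat (t + h) + h / 2 * F 1%nat t) by ring.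
  replace (M * h ^ 3) with (M * h * h * h) by ring. exact B0.
Qed.

(** * Smooth functions on a closed box *)

Notation val V := (V 0%nat 0%nat 0%nat).
Notation dxx V := (V 2%nat 0%nat 0%nat).
Notation dyy V := (V 0%nat 2%nat 0%nat).
Notation ddt V := (V 0%nat 0%nat 1%nat).

(** [V p q r] plays the role of [d_x^p d_y^q d_t^r V]; five derivatives are
    needed because the time increment of the fourth space derivative occurs. *)
Record closed_box (a b c d T M : R) (V : nat -> nat -> nat -> R -> R -> R -> R) : Prop := {
  cb_bound : forall p q r x y t, (p + q + r <= 5)%nat ->
    a <= x <= b -> c <= y <= d -> 0 <= t <= T -> Rabs (V p q r x y t) <= M;
  cb_dx : forall p q r x y t, (p + q + r < 5)%nat ->
    a <= x <= b -> c <= y <= d -> 0 <= t <= T ->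
    is_derive (fun s => V p q r s y t) x (V (S p) q r x y t);
  cb_dy : forall p q r x y t, (p + q + r < 5)%nat ->
    a <= x <= b -> c <= y <= d -> 0 <= t <= T ->
    is_derive (fun s => V p q r x s t) y (V p (S q) r x y t);
  cb_dt : forall p q r x y t, (p + q + r < 5)%nat ->
    a <= x <= b -> c <= y <= d -> 0 <= t <= T ->
    is_derive (fun s => V p q r x y s) t (V p q (S r) x y t)
}.

Record difference_bounds (a b c d T M : R) (V : nat -> nat -> nat -> R -> R -> R -> R) : Prop := {
  db_lip_x :
    forall x x' y t, a <= x <= b -> a <= x' <= b -> c <= y <= d -> 0 <= t <= T ->
    Rabs (val V x' y t - val V x y t) <= M * Rabs (x' - x);
  db_increment :
    forall x y t tau, 0 <= tau -> a <= x <= b -> c <= y <= d -> 0 <= t -> t + tau <= T ->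
    Rabs (val V x y (t + tau) - val V x y t) <= M * tau;
  db_second_t :
    forall x y t tau, 0 <= tau -> a <= x <= b -> c <= y <= d -> 0 <= t -> t + tau + tau <= T ->
    Rabs (val V x y (t + tau + tau) - val V x y (t + tau)
          - (val V x y (t + tau) - val V x y t)) <= M * tau ^ 2;
  db_centered :
    forall x y t h, 0 <= h -> a <= x - h -> x + h <= b -> c <= y <= d -> 0 <= t <= T ->
    Rabs (val V (x + h) y t - 2 * val V x y t + val V (x - h) y t
          - h ^ 2 * dxx V x y t) <= 2 * M * h ^ 4;
  db_centered_inc :
    forall x y t h tau, 0 <= h -> 0 <= tau -> a <= x - h -> x + h <= b -> c <= y <= d ->
    0 <= t -> t + tau <= T ->
    Rabs (val V (x + h) y (t + tau) - val V (x + h) y t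
          - 2 * (val V x y (t + tau) - val V x y t)
          + (val V (x - h) y (t + tau) - val V (x - h) y t)
          - h ^ 2 * (dxx V x y (t + tau) - dxx V x y t))
    <= 2 * (M * tau) * h ^ 4;
  db_trapezoid :
    forall x y t tau, 0 <= tau -> a <= x <= b -> c <= y <= d -> 0 <= t -> t + tau <= T ->
    Rabs (val V x y (t + tau) - val V x y t
          - tau / 2 * (ddt V x y (t + tau) + ddt V x y t)) <= M * tau ^ 3;
  db_trapezoid_inc :
    forall x y t tau, 0 <= tau -> a <= x <= b -> c <= y <= d -> 0 <= t -> t + tau + tau <= T ->
    Rabs (val V x y (t + tau + tau) - val V x y (t + tau)
          - (val V x y (t + tau) - val V x y t)
          - tau / 2 * (ddt V x y (t + tau + tau) - ddt V x y (t + tau)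
                       + (ddt V x y (t + tau) - ddt V x y t)))
    <= M * tau * tau ^ 3
}.
Arguments db_lip_x {_ _ _ _ _ _ _}.
Arguments db_increment {_ _ _ _ _ _ _}.
Arguments db_second_t {_ _ _ _ _ _ _}.
Arguments db_centered {_ _ _ _ _ _ _}.
Arguments db_centered_inc {_ _ _ _ _ _ _}.
Arguments db_trapezoid {_ _ _ _ _ _ _}.
Arguments db_trapezoid_inc {_ _ _ _ _ _ _}.

Lemma closed_box_lip_t a b c d T M V : closed_box a b c d T M V ->
  forall p q r x y t t', (p + q + r < 5)%nat ->
  a <= x <= b -> c <= y <= d -> 0 <= t <= T -> 0 <= t' <= T ->
  Rabs (V p q r x y t' - V p q r x y t) <= M * Rabs (t' - t).
Proof.
  intros H p q r x y t t' Hpqr Hx Hy Ht Ht'.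
  apply (mvt_bound (fun s => V p q r x y s) (fun s => V p q (S r) x y s) 0 T M); auto.
  - intros. eapply cb_dt; eauto; lia.
  - intros. eapply cb_bound; eauto; lia.
Qed.
Arguments closed_box_lip_t {_ _ _ _ _ _ _}.

(** A time increment is again a smooth function, with a factor [tau] gained in
    the bound; the estimates for increments of defects apply the estimates for
    defects to it. *)
Lemma closed_box_increment a b c d T M V tau p q r x y t : closed_box a b c d T M V ->
  (p + q + r < 5)%nat -> 0 <= tau ->
  a <= x <= b -> c <= y <= d -> 0 <= t -> t + tau <= T ->
  Rabs (V p q r x y (t + tau) - V p q r x y t) <= M * tau.
Proof.
  intros H Hpqr Htau Hx Hy Ht Ht'.
  assert (E := closed_box_lip_t H p q r x y t (t + tau) Hpqr Hx Hy ltac:(lra) ltac:(lra)).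
  replace (t + tau - t) with tau in E by ring. rewrite (Rabs_pos_eq tau) in E; auto.
Qed.

Lemma closed_box_difference_bounds a b c d T M V :
  closed_box a b c d T M V -> difference_bounds a b c d T M V.
Proof.
  intros H. split.
  - intros x x' y t Hx Hx' Hy Ht.
    apply (mvt_bound (fun s => val V s y t) (fun s => V 1%nat 0%nat 0%nat s y t) a b M); auto.
    + intros. eapply cb_dx; eauto; lia.
    + intros. eapply cb_bound; eauto; lia.
  - intros x y t tau Htau Hx Hy Ht Ht'. eapply closed_box_increment; eauto; lia.
  - intros x y t tau Htau Hx Hy Ht Ht'.
    assert (E := mvt_bound (fun s => val V x y (tau + s) - val V x y s)
      (fun s => ddt V x y (tau + s) - ddt V x y s) 0 (T - tau) (M * tau)).
    specialize (E ltac:(intros s Hs; apply is_derive_minus_R;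
       [apply is_derive_shift; eapply cb_dt; eauto; try lia; lra | eapply cb_dt; eauto; try lia; lra])).
    specialize (E ltac:(intros s Hs; cbv beta; rewrite (Rplus_comm tau s);
       eapply closed_box_increment; eauto; try lia; lra)).
    specialize (E t (t + tau) ltac:(lra) ltac:(lra)).
    replace (t + tau - t) with tau in E by ring. rewrite (Rabs_pos_eq tau) in E by auto.
    rewrite !(Rplus_comm tau) in E. replace (M * tau ^ 2) with (M * tau * tau) by ring. exact E.
  - intros x y t h Hh Hx Hx' Hy Ht.
    apply (centered_difference (fun i s => V i 0%nat 0%nat s y t)); auto.
    + intros i s Hi Hs. eapply cb_dx; eauto; try lia; lra.
    + intros s Hs. eapply cb_bound; eauto; try lia; lra.
  - intros x y t h tau Hh Htau Hx Hx' Hy Ht Ht'.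
    apply (centered_difference (fun i s => V i 0%nat 0%nat s y (t + tau) - V i 0%nat 0%nat s y t)); auto.
    + intros i s Hi Hs. apply is_derive_minus_R; eapply cb_dx; eauto; try lia; lra.
    + intros s Hs. eapply closed_box_increment; eauto; try lia; lra.
  - intros x y t tau Htau Hx Hy Ht Ht'.
    apply (trapezoidal_rule (fun i s => V 0%nat 0%nat i x y s)); auto.
    + intros i s Hi Hs. eapply cb_dt; eauto; try lia; lra.
    + intros s Hs. eapply cb_bound; eauto; try lia; lra.
  - intros x y t tau Htau Hx Hy Ht Ht'.
    assert (E := trapezoidal_rule (fun i s => V 0%nat 0%nat i x y (tau + s) - V 0%nat 0%nat i x y s) t tau (M * tau) Htau).
    cbv beta in E. rewrite !(Rplus_comm tau) in E. apply E.
    + intros i s Hi Hs. apply is_derive_minus_R;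
        [apply is_derive_shift; eapply cb_dt; eauto; try lia; lra | eapply cb_dt; eauto; try lia; lra].
    + intros s Hs. cbv beta; rewrite (Rplus_comm tau s). eapply closed_box_increment; eauto; try lia; lra.
Qed.

(** * Passing to the closed box *)

Definition shrink (n : nat) : R := 1 - / (INR n + 2).

Definition contract (lo hi : R) (n : nat) (x : R) : R :=
  (lo + hi) / 2 + shrink n * (x - (lo + hi) / 2).

Lemma shrink_range n : 0 < shrink n < 1.
Proof.
  unfold shrink. assert (H := pos_INR n).
  assert (H1 : 0 < / (INR n + 2)) by (apply Rinv_0_lt_compat; lra).
  assert (H2 : / (INR n + 2) <= / 2) by (apply Rinv_le_contravar; lra). lra.
Qed.

Lemma contract_interior lo hi n x : lo < hi -> lo <= x <= hi -> lo < contract lo hi n x < hi.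
Proof.
  intros Hlh Hx. assert (Hs := shrink_range n). unfold contract. split; nra.
Qed.

Lemma is_lim_seq_shrink : is_lim_seq shrink 1.
Proof.
  unfold shrink. replace (Finite 1) with (Finite (1 - 0)) by (f_equal; ring).
  apply is_lim_seq_minus'; [apply is_lim_seq_const |].
  replace (Finite 0) with (Rbar_inv p_infty) by reflexivity.
  apply is_lim_seq_inv; [| discriminate].
  apply is_lim_seq_plus with p_infty 2; [apply is_lim_seq_INR | apply is_lim_seq_const | reflexivity].
Qed.

Lemma is_lim_seq_contract lo hi x : is_lim_seq (fun n => contract lo hi n x) x.
Proof.
  unfold contract.
  replace (Finite x) with (Finite ((lo + hi) / 2 + 1 * (x - (lo + hi) / 2))) by (f_equal; ring).
  apply is_lim_seq_plus'; [apply is_lim_seq_const |].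
  apply is_lim_seq_mult'; [apply is_lim_seq_shrink | apply is_lim_seq_const].
Qed.

(** Derivatives are only given in the open box.  Composed with contractions
    towards its centre, [W] becomes smooth up to the boundary with the same
    bounds, and the contractions converge to the identity. *)
Record smooth_box (a b c d T M : R) (W : nat -> nat -> nat -> R -> R -> R -> R) : Prop := {
  sb_cont : forall p q r x y t, (p + q + r <= 5)%nat ->
    a <= x <= b -> c <= y <= d -> 0 <= t <= T ->
    is_lim_seq (fun n => W p q r (contract a b n x) (contract c d n y) (contract 0 T n t)) (W p q r x y t);
  sb_bound : forall p q r x y t, (p + q + r <= 5)%nat ->
    a <= x <= b -> c <= y <= d -> 0 <= t <= T -> Rabs (W p q r x y t) <= M;
  sb_dx : forall p q r x y t, (p + q + r < 5)%nat ->
    a < x < b -> c < y < d -> 0 < t < T ->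
    is_derive (fun s => W p q r s y t) x (W (S p) q r x y t);
  sb_dy : forall p q r x y t, (p + q + r < 5)%nat ->
    a < x < b -> c < y < d -> 0 < t < T ->
    is_derive (fun s => W p q r x s t) y (W p (S q) r x y t);
  sb_dt : forall p q r x y t, (p + q + r < 5)%nat ->
    a < x < b -> c < y < d -> 0 < t < T ->
    is_derive (fun s => W p q r x y s) t (W p q (S r) x y t)
}.

Arguments sb_cont {_ _ _ _ _ _ _}.
Arguments sb_bound {_ _ _ _ _ _ _}.
Arguments sb_dx {_ _ _ _ _ _ _}.
Arguments sb_dy {_ _ _ _ _ _ _}.
Arguments sb_dt {_ _ _ _ _ _ _}.

Definition contracted (a b c d T : R) (W : nat -> nat -> nat -> R -> R -> R -> R) (n p q r : nat) (x y t : R) : R :=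
  shrink n ^ (p + q + r) * W p q r (contract a b n x) (contract c d n y) (contract 0 T n t).

Lemma is_derive_contract (f : R -> R) (lo hi : R) (n m : nat) (x l : R) :
  is_derive f (contract lo hi n x) l ->
  is_derive (fun s => shrink n ^ m * f (contract lo hi n s)) x (shrink n ^ (S m) * l).
Proof.
  intros H.
  assert (Hc : is_derive (contract lo hi n) x (shrink n)).
  { unfold contract. auto_derive; auto. ring. }
  eapply is_derive_eq.
  - apply (is_derive_scal (fun s => f (contract lo hi n s)) x (shrink n ^ m)).
    apply (is_derive_comp f (contract lo hi n) x l (shrink n) H Hc).
  - unfold scal; simpl. unfold mult; simpl. ring.
Qed.

Lemma contracted_closed_box a b c d T M W n :
  a < b -> c < d -> 0 < T -> smooth_box a b c d T M W -> closed_box a b c d T M (contracted a b c d T W n).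
Proof.
  intros Hab Hcd HT H. assert (Hs := shrink_range n).
  assert (Ix := contract_interior a b n). assert (Iy := contract_interior c d n).
  assert (It := contract_interior 0 T n).
  split; intros p q r x y t Hpqr Hx Hy Ht; unfold contracted;
    specialize (Ix x Hab Hx); specialize (Iy y Hcd Hy); specialize (It t HT Ht).
  - rewrite Rabs_mult, (Rabs_pos_eq (shrink n ^ _)) by (apply pow_le; lra).
    assert (Hb := sb_bound H p q r (contract a b n x) (contract c d n y) (contract 0 T n t)
      Hpqr ltac:(lra) ltac:(lra) ltac:(lra)).
    assert (Hp : 0 <= shrink n ^ (p + q + r) <= 1).
    { split; [apply pow_le; lra |]. rewrite <- (pow1 (p + q + r)). apply pow_incr; lra. }
    assert (H0 := Rabs_pos (W p q r (contract a b n x) (contract c d n y) (contract 0 T n t))). nra.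
  - apply (is_derive_contract (fun s => W p q r s (contract c d n y) (contract 0 T n t))).
    eapply sb_dx; eauto.
  - replace (p + S q + r)%nat with (S (p + q + r)) by lia.
    apply (is_derive_contract (fun s => W p q r (contract a b n x) s (contract 0 T n t))).
    eapply sb_dy; eauto.
  - replace (p + q + S r)%nat with (S (p + q + r)) by lia.
    apply (is_derive_contract (fun s => W p q r (contract a b n x) (contract c d n y) s)).
    eapply sb_dt; eauto.
Qed.

Lemma is_lim_seq_contracted a b c d T M W p q r x y t :
  smooth_box a b c d T M W -> (p + q + r <= 5)%nat ->
  a <= x <= b -> c <= y <= d -> 0 <= t <= T ->
  is_lim_seq (fun n => contracted a b c d T W n p q r x y t) (W p q r x y t).
Proof.
  intros H Hpqr Hx Hy Ht. unfold contracted.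
  replace (Finite (W p q r x y t)) with (Finite (1 * W p q r x y t)) by (f_equal; ring).
  apply is_lim_seq_mult'; [| eapply sb_cont; eauto].
  generalize (p + q + r)%nat. clear. intros m. induction m as [|m IH]; simpl.
  - apply is_lim_seq_const.
  - replace (Finite 1) with (Finite (1 * 1)) by (f_equal; ring).
    apply is_lim_seq_mult'; [apply is_lim_seq_shrink | exact IH].
Qed.

Lemma Rabs_lim_le (u : nat -> R) (l B : R) :
  is_lim_seq u l -> (forall n, Rabs (u n) <= B) -> Rabs l <= B.
Proof.
  intros Hu Hb.
  apply (is_lim_seq_le (fun n => Rabs (u n)) (fun _ => B) (Rabs l) B Hb).
  - apply (is_lim_seq_abs u l Hu).
  - apply is_lim_seq_const.
Qed.

(* Selecting the rule by the head symbol keeps unification from unfolding the families. *)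
Ltac lim_contracted H :=
  repeat lazymatch goal with
  | |- is_lim_seq (fun n => Rminus _ _) _ => apply is_lim_seq_minus'
  | |- is_lim_seq (fun n => Rplus _ _) _ => apply is_lim_seq_plus'
  | |- is_lim_seq (fun n => Rmult _ _) _ => apply is_lim_seq_mult'
  | |- is_lim_seq (fun n => contracted _ _ _ _ _ _ _ _ _ _ _ _ _) _ =>
      apply (is_lim_seq_contracted _ _ _ _ _ _ _ _ _ _ _ _ _ H); [lia | lra | lra | lra]
  | |- is_lim_seq (fun n => _) _ => apply is_lim_seq_const
  end.

Lemma smooth_box_difference_bounds a b c d T M W :
  a < b -> c < d -> 0 < T -> smooth_box a b c d T M W -> difference_bounds a b c d T M W.
Proof.
  intros Hab Hcd HT H.
  assert (Hn := fun n => closed_box_difference_bounds _ _ _ _ _ _ _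
                           (contracted_closed_box a b c d T M W n Hab Hcd HT H)).
  split;
    [ intros x x' y t Hx Hx' Hy Ht; eapply Rabs_lim_le; [| intros n; apply (db_lip_x (Hn n) x x' y t); assumption]
    | intros x y t tau H0 Hx Hy Ht Ht'; eapply Rabs_lim_le; [| intros n; apply (db_increment (Hn n) x y t tau); assumption]
    | intros x y t tau H0 Hx Hy Ht Ht'; eapply Rabs_lim_le; [| intros n; apply (db_second_t (Hn n) x y t tau); assumption]
    | intros x y t h H0 Hx Hx' Hy Ht; eapply Rabs_lim_le; [| intros n; apply (db_centered (Hn n) x y t h); assumption]
    | intros x y t h tau H0 H0' Hx Hx' Hy Ht Ht'; eapply Rabs_lim_le; [| intros n; apply (db_centered_inc (Hn n) x y t h tau); assumption]
    | intros x y t tau H0 Hx Hy Ht Ht'; eapply Rabs_lim_le; [| intros n; apply (db_trapezoid (Hn n) x y t tau); assumption]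
    | intros x y t tau H0 Hx Hy Ht Ht'; eapply Rabs_lim_le; [| intros n; apply (db_trapezoid_inc (Hn n) x y t tau); assumption] ];
    lim_contracted H.
Qed.

Lemma smooth_box_swap a b c d T M W :
  smooth_box a b c d T M W -> smooth_box c d a b T M (fun p q r x y t => W q p r y x t).
Proof.
  intros H. split; intros p q r x y t Hpqr Hx Hy Ht; cbv beta.
  - apply (sb_cont H q p r y x t); auto; lia.
  - apply (sb_bound H q p r y x t); auto; lia.
  - apply (sb_dy H q p r y x t); auto; lia.
  - apply (sb_dx H q p r y x t); auto; lia.
  - apply (sb_dt H q p r y x t); auto; lia.
Qed.
Arguments smooth_box_swap {_ _ _ _ _ _ _}.

(** * The exact solution on the closed cylinder *)

Definition cylinder_continuous (a b c d T : R) (f : R -> R -> R -> C) : Prop :=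
  continuous_on (closed_cylinder a b c d T)
    (fun z : R * R * R => f (fst (fst z)) (snd (fst z)) (snd z)).

Definition interior_derivatives (m : nat) (a b c d T : R) (D : nat -> nat -> nat -> R -> R -> R -> C) : Prop :=
  forall p q r : nat, (p + q + r < m)%nat ->
  forall x y t, open_rect a b c d x y -> 0 < t < T ->
    is_deriveC (fun s => D p q r s y t) x (D (S p) q r x y t) /\
    is_deriveC (fun s => D p q r x s t) y (D p (S q) r x y t) /\
    is_deriveC (fun s => D p q r x y s) t (D p q (S r) x y t).

Lemma continuous_on_cylinder (a b c d T : R) (f : R -> R -> R -> C) :
  cylinder_continuous a b c d T f ->
  forall x y t, closed_cylinder a b c d T (x, y, t) ->
  forall eps : posreal, exists delta : posreal, forall x' y' t',
    closed_cylinder a b c d T (x', y', t') ->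
    Rabs (x' - x) < delta -> Rabs (y' - y) < delta -> Rabs (t' - t) < delta ->
    Rabs (fst (f x' y' t') - fst (f x y t)) < eps
    /\ Rabs (snd (f x' y' t') - snd (f x y t)) < eps.
Proof.
  intros Hf x y t Hp eps.
  destruct (Hf (x, y, t) Hp (fun z => Rabs (fst z - fst (f x y t)) < eps
                                  /\ Rabs (snd z - snd (f x y t)) < eps)) as [delta Hdelta].
  - exists eps. intros z [H1 H2]. split; [exact H1 | exact H2].
  - exists delta. intros x' y' t' Hp' Hx Hy Ht.
    apply (Hdelta (x', y', t')); [| exact Hp'].
    split; [split |]; assumption.
Qed.

(** A finite cover of the box by neighbourhoods on which [f] varies by at most 2. *)
Lemma bounded_on_cylinder (a b c d T : R) (f : R -> R -> R -> C) :
  cylinder_continuous a b c d T f ->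
  exists M, forall x y t, closed_cylinder a b c d T (x, y, t) -> Cmod (f x y t) <= M.
Proof.
  intros Hf.
  assert (Hch : forall z : Compactness.Tn 3 R, exists delta : posreal,
    let '(x, (y, (t, _))) := z in
    closed_cylinder a b c d T (x, y, t) ->
    forall x' y' t', closed_cylinder a b c d T (x', y', t') ->
    Rabs (x' - x) < delta -> Rabs (y' - y) < delta -> Rabs (t' - t) < delta ->
    Cmod (f x' y' t') <= Cmod (f x y t) + 2).
  { intros [x [y [t u]]].
    destruct (classic (closed_cylinder a b c d T (x, y, t))) as [Hp | Hp].
    - destruct (continuous_on_cylinder a b c d T f Hf x y t Hp (mkposreal 1 Rlt_0_1)) as [delta Hdelta].
      exists delta. intros _ x' y' t' Hp' Hx Hy Ht.
      destruct (Hdelta x' y' t' Hp' Hx Hy Ht) as [H1 H2]. cbn [pos] in H1, H2.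
      replace (f x' y' t') with (f x y t + (f x' y' t' - f x y t))%C by ring.
      eapply Rle_trans; [apply Cmod_triangle |]. apply Rplus_le_compat_l.
      eapply Rle_trans; [apply Cmod_le_components |]. simpl. unfold Rminus in *. lra.
    - exists (mkposreal 1 Rlt_0_1). contradiction. }
  set (delta := fun z => proj1_sig (constructive_indefinite_description _ (Hch z))).
  assert (Hdelta := fun z => proj2_sig (constructive_indefinite_description _ (Hch z))).
  fold delta in Hdelta.
  destruct (NNPP _ (compactness_list 3 (a, (c, (0, tt))) (b, (d, (T, tt))) delta)) as [l Hl].
  assert (Hmax : exists M, forall x y t u, List.In (x, (y, (t, u))) l -> Cmod (f x y t) <= M).
  { clear Hl. induction l as [|[x0 [y0 [t0 u0]]] l [M HM]].
    - exists 0. intros x y t u [].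
    - exists (Rmax (Cmod (f x0 y0 t0)) M). intros x y t u [E | Hin].
      + injection E as -> -> -> ->. apply Rmax_l.
      + eapply Rle_trans; [apply (HM x y t u Hin) | apply Rmax_r]. }
  destruct Hmax as [M HM]. exists (M + 2). intros x y t Hp.
  destruct (Hl (x, (y, (t, tt)))) as [[x0 [y0 [t0 u0]]] (Hin & Hb & Hclose)].
  { destruct Hp as [[Hx Hy] Ht]. simpl in *. tauto. }
  specialize (Hdelta (x0, (y0, (t0, u0)))). cbv beta iota in Hdelta.
  destruct Hclose as (C1 & C2 & C3 & _). destruct Hb as (B1 & B2 & B3 & _).
  assert (H := Hdelta (conj (conj B1 B2) B3) x y t Hp C1 C2 C3).
  generalize (HM x0 y0 t0 u0 Hin). lra.
Qed.

Lemma finite_uniform_bound (P : nat -> R -> Prop) (n : nat) :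
  (forall i M M', P i M -> M <= M' -> P i M') ->
  (forall i, (i <= n)%nat -> exists M, P i M) -> exists M, forall i, (i <= n)%nat -> P i M.
Proof.
  intros Hmon. induction n as [|n IH]; intros Hex.
  - destruct (Hex 0%nat (le_n _)) as [M HM]. exists M. intros i Hi. replace i with 0%nat by lia. auto.
  - destruct IH as [M1 H1]; [intros; apply Hex; lia |].
    destruct (Hex (S n) (le_n _)) as [M2 H2].
    exists (Rmax M1 M2). intros i Hi. destruct (Nat.eq_dec i (S n)) as [->|Hne].
    + eapply Hmon; [exact H2 | apply Rmax_r].
    + eapply Hmon; [apply H1; lia | apply Rmax_l].
Qed.

Lemma derivatives_bounded (a b c d T : R) (m : nat) (D : nat -> nat -> nat -> R -> R -> R -> C) :
  (forall p q r, (p + q + r <= m)%nat -> cylinder_continuous a b c d T (D p q r)) ->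
  exists M, forall p q r x y t, (p + q + r <= m)%nat ->
    closed_cylinder a b c d T (x, y, t) -> Cmod (D p q r x y t) <= M.
Proof.
  intros Hc.
  set (P := fun p q r M => forall x y t, (p + q + r <= m)%nat ->
    closed_cylinder a b c d T (x, y, t) -> Cmod (D p q r x y t) <= M).
  assert (Hmon : forall p q r M M', P p q r M -> M <= M' -> P p q r M').
  { intros p q r M M' H HMM x y t H1 H2. generalize (H x y t H1 H2). lra. }
  destruct (finite_uniform_bound (fun p M => forall q, (q <= m)%nat -> forall r, (r <= m)%nat -> P p q r M) m)
    as [M HM]; [eauto | |].
  - intros p _. apply finite_uniform_bound; [eauto |].
    intros q _. apply finite_uniform_bound; [eauto |].
    intros r _. destruct (Nat.le_gt_cases (p + q + r) m) as [Hle | Hgt].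
    + destruct (bounded_on_cylinder a b c d T (D p q r) (Hc p q r Hle)) as [M HM].
      exists M. intros x y t _. apply HM.
    + exists 0. intros x y t Hle. lia.
  - exists M. intros p q r x y t Hr. apply HM; lia.
Qed.

Lemma is_deriveC_components (f : R -> C) (x : R) (l : C) :
  is_deriveC f x l ->
  is_derive (fun s => fst (f s)) x (fst l) /\ is_derive (fun s => snd (f s)) x (snd l).
Proof.
  intros H. split.
  - apply (filterdiff_ext_lin _ (fun y => fst (@scal R_AbsRing C_R_NormedModule y l))).
    + apply (filterdiff_comp' f fst x _ (fun z : C_R_NormedModule => fst z)); [exact H |].
      apply filterdiff_linear, is_linear_fst.
    + intros y. reflexivity.
  - apply (filterdiff_ext_lin _ (fun y => snd (@scal R_AbsRing C_R_NormedModule y l))).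
    + apply (filterdiff_comp' f snd x _ (fun z : C_R_NormedModule => snd z)); [exact H |].
      apply filterdiff_linear, is_linear_snd.
    + intros y. reflexivity.
Qed.

Lemma is_deriveC_unique (f : R -> C) (x : R) (l l' : C) :
  is_deriveC f x l -> is_deriveC f x l' -> l = l'.
Proof.
  intros H H'.
  destruct (is_deriveC_components f x l H) as [H1 H2].
  destruct (is_deriveC_components f x l' H') as [H1' H2'].
  apply injective_projections.
  - rewrite <- (is_derive_unique _ _ _ H1). apply is_derive_unique; auto.
  - rewrite <- (is_derive_unique _ _ _ H2). apply is_derive_unique; auto.
Qed.

Lemma is_deriveC_ext_loc (f g : R -> C) (x : R) (l : C) :
  locally x (fun s => f s = g s) -> is_deriveC f x l -> is_deriveC g x l.
Proof. intros H Hf. apply (is_derive_ext_loc f g x l H Hf). Qed.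

Definition C_component (i : bool) (z : C) : R := if i then fst z else snd z.

Lemma is_lim_seq_cylinder (a b c d T : R) (f : R -> R -> R -> C) (i : bool) :
  a < b -> c < d -> 0 < T ->
  cylinder_continuous a b c d T f ->
  forall x y t, closed_cylinder a b c d T (x, y, t) ->
  is_lim_seq (fun n => C_component i (f (contract a b n x) (contract c d n y) (contract 0 T n t)))
    (C_component i (f x y t)).
Proof.
  intros Hab Hcd HT Hf x y t Hp. apply is_lim_seq_spec. intros eps.
  destruct (continuous_on_cylinder a b c d T f Hf x y t Hp eps) as [delta Hdelta].
  assert (L1 := proj2 (is_lim_seq_spec _ _) (is_lim_seq_contract a b x) delta).
  assert (L2 := proj2 (is_lim_seq_spec _ _) (is_lim_seq_contract c d y) delta).
  assert (L3 := proj2 (is_lim_seq_spec _ _) (is_lim_seq_contract 0 T t) delta).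
  generalize (filter_and _ _ L1 (filter_and _ _ L2 L3)).
  apply filter_imp. intros n (G1 & G2 & G3).
  destruct Hp as [[Hx Hy] Ht]. simpl in Hx, Hy, Ht.
  assert (Ix := contract_interior a b n x Hab Hx).
  assert (Iy := contract_interior c d n y Hcd Hy).
  assert (It := contract_interior 0 T n t HT Ht).
  destruct (Hdelta (contract a b n x) (contract c d n y) (contract 0 T n t)) as [E1 E2]; auto.
  { split; [split |]; simpl; lra. }
  destruct i; assumption.
Qed.

Lemma component_smooth_box (a b c d T M : R) (D : nat -> nat -> nat -> R -> R -> R -> C) (i : bool) :
  a < b -> c < d -> 0 < T ->
  (forall p q r, (p + q + r <= 5)%nat -> cylinder_continuous a b c d T (D p q r)) ->
  interior_derivatives 5 a b c d T D ->
  (forall p q r x y t, (p + q + r <= 5)%nat ->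
    closed_cylinder a b c d T (x, y, t) -> Cmod (D p q r x y t) <= M) ->
  smooth_box a b c d T M (fun p q r x y t => C_component i (D p q r x y t)).
Proof.
  intros Hab Hcd HT Hc Hd Hb. split; intros p q r x y t Hpqr Hx Hy Ht.
  - apply (is_lim_seq_cylinder a b c d T (D p q r) i); auto.
    split; [split |]; auto.
  - eapply Rle_trans; [| apply (Hb p q r x y t Hpqr); split; [split |]; auto].
    destruct i; apply components_le_Cmod.
  - destruct (Hd p q r Hpqr x y t (conj Hx Hy) Ht) as [H _].
    apply is_deriveC_components in H. destruct i; apply H.
  - destruct (Hd p q r Hpqr x y t (conj Hx Hy) Ht) as [_ [H _]].
    apply is_deriveC_components in H. destruct i; apply H.
  - destruct (Hd p q r Hpqr x y t (conj Hx Hy) Ht) as [_ [_ H]].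
    apply is_deriveC_components in H. destruct i; apply H.
Qed.

Lemma pointwise_nonlin_equation lambda nu eps (u : C) :
  pointwise_nonlin lambda nu eps u
  = (RtoC lambda * u * RtoC (Cmod u ^ 2) - RtoC nu * RtoC (Cmod u ^ 4) * u
     + Ci * RtoC eps * u * RtoC (Cmod u ^ 2))%C.
Proof.
  unfold pointwise_nonlin. rewrite nonlin_poly, Cmod_pow4, Cmod_sqr. unfold dot.
  apply injective_projections; simpl; field.
Qed.

Lemma locally_open_interval (lo hi x : R) (P : R -> Prop) :
  lo < x < hi -> (forall s, lo < s < hi -> P s) -> locally x P.
Proof.
  intros Hx HP. apply (locally_interval P x lo hi); simpl; try lra.
  intros y H1 H2. apply HP. split; auto.
Qed.

(** Uniqueness of derivatives identifies those in the equation with [D]; the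
    derivatives of the extension and of [u] agree because [u] and [val D] agree
    near every interior point. *)
Lemma equation_open (lambda nu eps a b c d T : R) (u0 : R -> R -> C) (u : R -> R -> R -> C)
    (D : nat -> nat -> nat -> R -> R -> R -> C) :
  (forall x y t, closed_cylinder a b c d T (x, y, t) -> val D x y t = u x y t) ->
  interior_derivatives 5 a b c d T D ->
  exact_solution lambda nu eps a b c d T u0 u ->
  forall x y t, open_rect a b c d x y -> 0 < t < T ->
  (Ci * ddt D x y t + (dxx D x y t + dyy D x y t)
   + pointwise_nonlin lambda nu eps (val D x y t))%C = RtoC 0.
Proof.
  intros H0 Hd [Hpde _] x y t Hxy Ht.
  destruct (Hpde x y t Hxy Ht) as (ut & uxx & uyy & Dt & (gx & Gx & Dxx) & (gy & Gy & Dyy) & E).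
  destruct Hxy as [Hx Hy].
  assert (Hcl : forall x' y' t', a < x' < b -> c < y' < d -> 0 < t' < T ->
     u x' y' t' = val D x' y' t').
  { intros x' y' t' H1 H2 H3. symmetry. apply H0. split; [split |]; simpl; lra. }
  assert (E1 : ut = ddt D x y t).
  { apply (is_deriveC_unique (fun s => u x y s) t); auto.
    apply (is_deriveC_ext_loc (fun s => val D x y s)).
    - apply (locally_open_interval 0 T); auto. intros s Hs. symmetry. apply Hcl; auto.
    - apply Hd; [lia | split; auto | auto]. }
  assert (E2 : uxx = dxx D x y t).
  { apply (is_deriveC_unique (fun s => D 1%nat 0%nat 0%nat s y t) x).
    - apply (is_deriveC_ext_loc gx); auto.
      generalize (filter_and _ _ Gx (locally_open_interval a b x _ Hx (fun s Hs => Hs))).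
      apply filter_imp. intros s [Hs Hin].
      apply (is_deriveC_unique (fun s => u s y t) s); auto.
      apply (is_deriveC_ext_loc (fun s => val D s y t)).
      + apply (locally_open_interval a b); auto. intros s' Hs'. symmetry. apply Hcl; auto.
      + apply Hd; [lia | split; auto | auto].
    - apply Hd; [lia | split; auto | auto]. }
  assert (E3 : uyy = dyy D x y t).
  { apply (is_deriveC_unique (fun s => D 0%nat 1%nat 0%nat x s t) y).
    - apply (is_deriveC_ext_loc gy); auto.
      generalize (filter_and _ _ Gy (locally_open_interval c d y _ Hy (fun s Hs => Hs))).
      apply filter_imp. intros s [Hs Hin].
      apply (is_deriveC_unique (fun s => u x s t) s); auto.
      apply (is_deriveC_ext_loc (fun s => val D x s t)).
      + apply (locally_open_interval c d); auto. intros s' Hs'. symmetry. apply Hcl; auto.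
      + apply Hd; [lia | split; auto | auto].
    - apply Hd; [lia | split; auto | auto]. }
  rewrite pointwise_nonlin_equation, <- Hcl, <- E1, <- E2, <- E3 by auto.
  rewrite <- E. ring.
Qed.

(** The equation is a polynomial identity between continuous functions, so it
    extends from the open box by contraction towards the centre. *)
Lemma equation_closed (lambda nu eps a b c d T : R) (D : nat -> nat -> nat -> R -> R -> R -> C) :
  a < b -> c < d -> 0 < T ->
  (forall p q r, (p + q + r <= 5)%nat -> cylinder_continuous a b c d T (D p q r)) ->
  (forall x y t, open_rect a b c d x y -> 0 < t < T ->
    (Ci * ddt D x y t + (dxx D x y t + dyy D x y t)
     + pointwise_nonlin lambda nu eps (val D x y t))%C = RtoC 0) ->
  forall x y t, closed_cylinder a b c d T (x, y, t) ->
  (Ci * ddt D x y t + (dxx D x y t + dyy D x y t)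
   + pointwise_nonlin lambda nu eps (val D x y t))%C = RtoC 0.
Proof.
  intros Hab Hcd HT Hc Hpde x y t Hp.
  assert (L := fun p q r Hpqr i =>
    is_lim_seq_cylinder a b c d T (D p q r) i Hab Hcd HT (Hc p q r Hpqr) x y t Hp).
  assert (Lt := L 0%nat 0%nat 1%nat ltac:(lia)). assert (Lx := L 2%nat 0%nat 0%nat ltac:(lia)).
  assert (Ly := L 0%nat 2%nat 0%nat ltac:(lia)). assert (L0 := L 0%nat 0%nat 0%nat ltac:(lia)).
  assert (Hn : forall n, (Ci * ddt D (contract a b n x) (contract c d n y) (contract 0 T n t)
    + (dxx D (contract a b n x) (contract c d n y) (contract 0 T n t)
       + dyy D (contract a b n x) (contract c d n y) (contract 0 T n t))
    + pointwise_nonlin lambda nu eps (val D (contract a b n x) (contract c d n y) (contract 0 T n t)))%C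
    = RtoC 0).
  { intros n. destruct Hp as [[Hx Hy] Ht]. simpl in Hx, Hy, Ht.
    apply Hpde; [split |]; apply contract_interior; auto. }
  (* real and imaginary parts of the equation, as polynomials in those of the derivatives *)
  set (F := fun (i : bool) (zt zx zy z : C) =>
    let s := fst z * fst z + snd z * snd z in
    if i then 0 - snd zt + (fst zx + fst zy)
              + (lambda * (s * fst z) - nu * (s * (s * fst z)) - eps * (s * snd z))
    else fst zt + (snd zx + snd zy)
         + (lambda * (s * snd z) - nu * (s * (s * snd z)) + eps * (s * fst z))).
  assert (HF : forall i zt zx zy z,
    C_component i (Ci * zt + (zx + zy) + pointwise_nonlin lambda nu eps z)%C = F i zt zx zy z).
  { intros. rewrite pointwise_nonlin_equation, Cmod_pow4, Cmod_sqr. unfold dot, F.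
    destruct i; simpl; ring. }
  assert (Hz : forall i, F i (ddt D x y t) (dxx D x y t) (dyy D x y t) (val D x y t) = 0).
  { intros i. apply Rabs_eq_0, Rle_antisym; [| apply Rabs_pos].
    set (at_n := fun (G : R -> R -> R -> C) n => G (contract a b n x) (contract c d n y) (contract 0 T n t)).
    apply Rabs_lim_le with
      (fun n => F i (at_n (ddt D) n) (at_n (dxx D) n) (at_n (dyy D) n) (at_n (val D) n)).
    - destruct i; cbv beta iota zeta delta [F];
      repeat lazymatch goal with
      | |- is_lim_seq (fun n => Rminus _ _) _ => apply is_lim_seq_minus'
      | |- is_lim_seq (fun n => Rplus _ _) _ => apply is_lim_seq_plus'
      | |- is_lim_seq (fun n => Rmult _ _) _ => apply is_lim_seq_mult'
      | |- _ => first [ exact (Lt true) | exact (Lt false) | exact (Lx true) | exact (Lx false)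
                      | exact (Ly true) | exact (Ly false) | exact (L0 true) | exact (L0 false)
                      | apply is_lim_seq_const ]
      end.
    - intros n. rewrite <- HF. unfold at_n. rewrite Hn. destruct i; simpl; rewrite Rabs_R0; apply Rle_refl. }
  apply injective_projections; [exact (eq_trans (HF true _ _ _ _) (Hz true))
                               | exact (eq_trans (HF false _ _ _ _) (Hz false))].
Qed.

(** The bounds come in pairs, for a quantity and for its time increment, because
    the error analysis needs the residual and its time increment. *)
Record solution_estimates (lambda nu eps a b c d T M : R) (u ut uxx uyy : R -> R -> R -> C) : Prop := {
  se_bound : forall x y t, a <= x <= b -> c <= y <= d -> 0 <= t <= T -> Cmod (u x y t) <= M;
  se_dx : forall x x' y t, a <= x <= b -> a <= x' <= b -> c <= y <= d -> 0 <= t <= T ->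
    Cmod (u x' y t - u x y t) <= M * Rabs (x' - x);
  se_dy : forall x y y' t, a <= x <= b -> c <= y <= d -> c <= y' <= d -> 0 <= t <= T ->
    Cmod (u x y' t - u x y t) <= M * Rabs (y' - y);
  se_dt : forall x y t tau, 0 <= tau -> a <= x <= b -> c <= y <= d -> 0 <= t -> t + tau <= T ->
    Cmod (u x y (t + tau) - u x y t) <= M * tau;
  se_dtt : forall x y t tau, 0 <= tau -> a <= x <= b -> c <= y <= d -> 0 <= t -> t + tau + tau <= T ->
    Cmod (u x y (t + tau + tau) - u x y (t + tau) - (u x y (t + tau) - u x y t)) <= M * tau ^ 2;
  se_trapezoid : forall x y t tau, 0 <= tau -> a <= x <= b -> c <= y <= d -> 0 <= t -> t + tau <= T ->
    Cmod (u x y (t + tau) - u x y t - RtoC (tau / 2) * (ut x y (t + tau) + ut x y t)) <= M * tau ^ 3;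
  se_trapezoid_inc : forall x y t tau, 0 <= tau -> a <= x <= b -> c <= y <= d -> 0 <= t -> t + tau + tau <= T ->
    Cmod (u x y (t + tau + tau) - u x y (t + tau) - (u x y (t + tau) - u x y t)
          - RtoC (tau / 2) * (ut x y (t + tau + tau) - ut x y (t + tau) + (ut x y (t + tau) - ut x y t)))
    <= M * tau * tau ^ 3;
  se_xx : forall x y t h, 0 <= h -> a <= x - h -> x + h <= b -> c <= y <= d -> 0 <= t <= T ->
    Cmod (u (x + h) y t - RtoC 2 * u x y t + u (x - h) y t - RtoC (h ^ 2) * uxx x y t) <= M * h ^ 4;
  se_xx_inc : forall x y t h tau, 0 <= h -> 0 <= tau -> a <= x - h -> x + h <= b -> c <= y <= d ->
    0 <= t -> t + tau <= T ->
    Cmod (u (x + h) y (t + tau) - u (x + h) y t - RtoC 2 * (u x y (t + tau) - u x y t)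
          + (u (x - h) y (t + tau) - u (x - h) y t)
          - RtoC (h ^ 2) * (uxx x y (t + tau) - uxx x y t)) <= M * tau * h ^ 4;
  se_yy : forall x y t h, 0 <= h -> c <= y - h -> y + h <= d -> a <= x <= b -> 0 <= t <= T ->
    Cmod (u x (y + h) t - RtoC 2 * u x y t + u x (y - h) t - RtoC (h ^ 2) * uyy x y t) <= M * h ^ 4;
  se_yy_inc : forall x y t h tau, 0 <= h -> 0 <= tau -> c <= y - h -> y + h <= d -> a <= x <= b ->
    0 <= t -> t + tau <= T ->
    Cmod (u x (y + h) (t + tau) - u x (y + h) t - RtoC 2 * (u x y (t + tau) - u x y t)
          + (u x (y - h) (t + tau) - u x (y - h) t)
          - RtoC (h ^ 2) * (uyy x y (t + tau) - uyy x y t)) <= M * tau * h ^ 4;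
  se_equation : forall x y t, a <= x <= b -> c <= y <= d -> 0 <= t <= T ->
    (Ci * ut x y t + (uxx x y t + uyy x y t) + pointwise_nonlin lambda nu eps (u x y t))%C = RtoC 0
}.


Lemma Cmod_le_of_components (z : C) (B B' : R) :
  Rabs (C_component true z) <= B -> Rabs (C_component false z) <= B -> 2 * B <= B' -> Cmod z <= B'.
Proof.
  intros H1 H2 H3. simpl in *. generalize (Cmod_le_components z). lra.
Qed.

Lemma solution_estimates_exist (lambda nu eps a b c d T : R) (u0 : R -> R -> C) (u : R -> R -> R -> C) :
  a < b -> c < d -> 0 < T ->
  Cm_closed 5 a b c d T u -> exact_solution lambda nu eps a b c d T u0 u ->
  exists M v ut uxx uyy, 1 <= M /\
    (forall x y t, a <= x <= b -> c <= y <= d -> 0 <= t <= T -> v x y t = u x y t) /\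
    solution_estimates lambda nu eps a b c d T M v ut uxx uyy.
Proof.
  intros Hab Hcd HT (D & H0 & Hc & Hd) Hex.
  destruct (derivatives_bounded a b c d T 5 D Hc) as [M0 HM0].
  set (M := Rmax 1 M0).
  assert (HM1 : 1 <= M) by apply Rmax_l.
  assert (HM : forall p q r x y t, (p + q + r <= 5)%nat ->
    closed_cylinder a b c d T (x, y, t) -> Cmod (D p q r x y t) <= M).
  { intros. eapply Rle_trans; [apply HM0; auto | apply Rmax_r]. }
  assert (SB := fun i => component_smooth_box a b c d T M D i Hab Hcd HT Hc Hd HM).
  assert (SW := fun i => smooth_box_difference_bounds _ _ _ _ _ _ _ Hcd Hab HT (smooth_box_swap (SB i))).
  assert (SX := fun i => smooth_box_difference_bounds _ _ _ _ _ _ _ Hab Hcd HT (SB i)).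
  assert (Hpde := equation_closed lambda nu eps a b c d T D Hab Hcd HT Hc
    (equation_open lambda nu eps a b c d T u0 u D H0 Hd Hex)).
  exists (4 * M), (val D), (ddt D), (dxx D), (dyy D).
  split; [lra |]. split.
  { intros. apply H0. split; [split |]; auto. }
  assert (PC : forall i z w, C_component i (z - w)%C = C_component i z - C_component i w)
    by (intros [|] z w; simpl; ring).
  assert (PD : forall i z w, C_component i (z + w)%C = C_component i z + C_component i w)
    by (intros [|] z w; simpl; ring).
  assert (PR : forall i r w, C_component i (RtoC r * w)%C = r * C_component i w)
    by (intros [|] r w; simpl; ring).
  split; intros.
  - apply Rle_trans with M; [| lra]. apply HM; [lia |]. split; [split |]; auto.
  - assert (G := fun i => db_lip_x (SX i) x x' y t H H1 H2 H3).
    apply Cmod_le_of_components with (M * Rabs (x' - x)); rewrite ?PC; try apply (G true); try apply (G false).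
    generalize (Rabs_pos (x' - x)). nra.
  - assert (G := fun i => db_lip_x (SW i) y y' x t H1 H2 H H3).
    apply Cmod_le_of_components with (M * Rabs (y' - y)); rewrite ?PC; try apply (G true); try apply (G false).
    generalize (Rabs_pos (y' - y)). nra.
  - assert (G := fun i => db_increment (SX i) x y t tau H H1 H2 H3 H4).
    apply Cmod_le_of_components with (M * tau); rewrite ?PC; try apply (G true); try apply (G false). nra.
  - assert (G := fun i => db_second_t (SX i) x y t tau H H1 H2 H3 H4).
    apply Cmod_le_of_components with (M * tau ^ 2); rewrite ?PC; try apply (G true); try apply (G false).
    generalize (pow2_ge_0 tau). nra.
  - assert (G := fun i => db_trapezoid (SX i) x y t tau H H1 H2 H3 H4).
    apply Cmod_le_of_components with (M * tau ^ 3); rewrite ?PC, ?PR, ?PD, ?PC; try apply (G true); try apply (G false).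
    generalize (pow_le tau 3 H). nra.
  - assert (G := fun i => db_trapezoid_inc (SX i) x y t tau H H1 H2 H3 H4).
    apply Cmod_le_of_components with (M * tau * tau ^ 3); rewrite ?PC, ?PR, ?PD, ?PC; try apply (G true); try apply (G false).
    assert (0 <= M * tau * tau ^ 3) by (apply Rmult_le_pos; [nra | apply pow_le; auto]). lra.
  - assert (G := fun i => db_centered (SX i) x y t h H H1 H2 H3 H4).
    apply Cmod_le_of_components with (2 * M * h ^ 4); rewrite ?PC, ?PD, ?PC, ?PR; try apply (G true); try apply (G false).
    lra.
  - assert (G := fun i => db_centered_inc (SX i) x y t h tau H H1 H2 H3 H4 H5 H6).
    apply Cmod_le_of_components with (2 * (M * tau) * h ^ 4); rewrite ?PC, ?PD, ?PC, ?PR, ?PC; try apply (G true); try apply (G false).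
    lra.
  - assert (G := fun i => db_centered (SW i) y x t h H H1 H2 H3 H4).
    apply Cmod_le_of_components with (2 * M * h ^ 4); rewrite ?PC, ?PD, ?PC, ?PR; try apply (G true); try apply (G false).
    lra.
  - assert (G := fun i => db_centered_inc (SW i) y x t h tau H H1 H2 H3 H4 H5 H6).
    apply Cmod_le_of_components with (2 * (M * tau) * h ^ 4); rewrite ?PC, ?PD, ?PC, ?PR, ?PC; try apply (G true); try apply (G false).
    lra.
  - apply Hpde. split; [split |]; auto.
Qed.

(** * Consistency of the scheme *)

Definition scheme_residual (lambda nu eps h tau : R) (u : R -> R -> R -> C) (x y t : R) : C :=
  (Ci * ((u x y (t + tau)%R - u x y t) / RtoC tau)
   + (((u (x + h)%R y (t + tau)%R + u (x + h)%R y t) / RtoC 2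
       - RtoC 2 * ((u x y (t + tau)%R + u x y t) / RtoC 2)
       + (u (x - h)%R y (t + tau)%R + u (x - h)%R y t) / RtoC 2) / RtoC (h ^ 2)
      + ((u x (y + h)%R (t + tau)%R + u x (y + h)%R t) / RtoC 2
         - RtoC 2 * ((u x y (t + tau)%R + u x y t) / RtoC 2)
         + (u x (y - h)%R (t + tau)%R + u x (y - h)%R t) / RtoC 2) / RtoC (h ^ 2))
   + nonlin lambda nu eps (u x y (t + tau)%R) (u x y t))%C.

Definition time_defect (u ut : R -> R -> R -> C) (tau x y t : R) : C :=
  (u x y (t + tau)%R - u x y t - RtoC (tau / 2) * (ut x y (t + tau)%R + ut x y t))%C.

Definition space_defect (u uxx uyy : R -> R -> R -> C) (h x y t : R) : C :=
  ((u (x + h)%R y t - RtoC 2 * u x y t + u (x - h)%R y t - RtoC (h ^ 2) * uxx x y t)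
   + (u x (y + h)%R t - RtoC 2 * u x y t + u x (y - h)%R t - RtoC (h ^ 2) * uyy x y t))%C.

Definition nonlin_defect (lambda nu eps tau : R) (u : R -> R -> R -> C) (x y t : R) : C :=
  (nonlin lambda nu eps (u x y (t + tau)%R) (u x y t)
   - (pointwise_nonlin lambda nu eps (u x y (t + tau)%R)
      + pointwise_nonlin lambda nu eps (u x y t)) / RtoC 2)%C.

(** The average of the equation at the two time levels is subtracted; what
    remains is the defect of the trapezoidal rule in time, of the second
    differences in space, and of averaging the nonlinearity. *)
Lemma residual_decomposition lambda nu eps a b c d T M u ut uxx uyy h tau x y t :
  solution_estimates lambda nu eps a b c d T M u ut uxx uyy ->
  0 < h -> 0 < tau -> a <= x <= b -> c <= y <= d -> 0 <= t -> t + tau <= T ->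
  scheme_residual lambda nu eps h tau u x y t
  = (RtoC (/ tau) * (Ci * time_defect u ut tau x y t)
     + RtoC (/ (2 * h ^ 2)) * (space_defect u uxx uyy h x y (t + tau)%R + space_defect u uxx uyy h x y t)
     + nonlin_defect lambda nu eps tau u x y t)%C.
Proof.
  intros Hs Hh Ht Hx Hy Ht0 HtT.
  assert (Heq := fun s => se_equation _ _ _ _ _ _ _ _ _ _ _ _ _ Hs x y s Hx Hy).
  assert (E0 := Heq t ltac:(lra)). assert (E1 := Heq (t + tau) ltac:(lra)).
  unfold scheme_residual, time_defect, space_defect, nonlin_defect.
  assert (P : forall A z : C, (A + z)%C = RtoC 0 -> z = (- A)%C).
  { intros A z E. replace z with ((A + z) - A)%C by ring. rewrite E. ring. }
  apply P in E0. apply P in E1. rewrite E0, E1.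
  assert (Hh2 : h ^ 2 <> 0) by (apply pow_nonzero; lra).
  rewrite !Cdiv_RtoC by (auto; lra).
  apply injective_projections; simpl; field; split; lra.
Qed.

Lemma Cmod_RtoC_mult_le (r : R) (z : C) (B B' : R) :
  0 <= r -> Cmod z <= B -> r * B <= B' -> Cmod (RtoC r * z) <= B'.
Proof.
  intros Hr Hz HB. rewrite Cmod_mult, Cmod_R, Rabs_pos_eq by auto.
  eapply Rle_trans; [apply Rmult_le_compat_l; eauto | exact HB].
Qed.

Lemma residual_estimates lambda nu eps (a b c d T M : R) u ut uxx uyy :
  1 <= M -> solution_estimates lambda nu eps a b c d T M u ut uxx uyy ->
  exists B, 0 <= B /\ forall h tau x y t,
    0 < h -> 0 < tau -> a <= x - h -> x + h <= b -> c <= y - h -> y + h <= d -> 0 <= t ->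
    (t + tau <= T ->
       Cmod (scheme_residual lambda nu eps h tau u x y t) <= B * (tau ^ 2 + h ^ 2)) /\
    (t + tau + tau <= T ->
       Cmod (scheme_residual lambda nu eps h tau u x y (t + tau)%R
             - scheme_residual lambda nu eps h tau u x y t) <= B * tau * (tau ^ 2 + h ^ 2)).
Proof.
  intros HM Hs. destruct (nonlin_consistency lambda nu eps M) as [B0 HB0].
  assert (HB0' := Rle_abs B0). assert (HB0p := Rabs_pos B0).
  exists (2 * M + Rabs B0). split; [lra |].
  intros h tau x y t Hh Ht Hx Hx' Hy Hy' Ht0.
  assert (Ht2 := pow2_ge_0 tau). assert (Hh2 : 0 < h ^ 2) by (apply pow_lt; auto).
  assert (Hdec := fun t => residual_decomposition lambda nu eps a b c d T M u ut uxx uyy h tau x y t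
    Hs Hh Ht ltac:(lra) ltac:(lra)).
  assert (Sb : forall s, 0 <= s -> s + tau <= T ->
    Cmod (space_defect u uxx uyy h x y (s + tau)%R + space_defect u uxx uyy h x y s)
    <= (M * h ^ 4 + M * h ^ 4) + (M * h ^ 4 + M * h ^ 4)).
  { intros s H0 H1. unfold space_defect.
    apply Cmod_plus_le; apply Cmod_plus_le; first
      [ eapply se_xx | eapply se_yy ]; eauto; lra. }
  split; intros HT.
  - rewrite Hdec by lra.
    apply Rle_trans with (M * tau ^ 2 + 2 * M * h ^ 2 + Rabs B0 * tau ^ 2); [| nra].
    apply Cmod_plus_le; [apply Cmod_plus_le |].
    + apply Cmod_RtoC_mult_le with (M * tau ^ 3).
      * left; apply Rinv_0_lt_compat; auto.
      * rewrite Cmod_mult, Cmod_Ci, Rmult_1_l. eapply se_trapezoid; eauto; lra.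
      * apply Req_le. field. lra.
    + eapply Cmod_RtoC_mult_le; [| apply Sb; lra |].
      * left; apply Rinv_0_lt_compat; lra.
      * apply Req_le. field. lra.
    + unfold nonlin_defect.
      destruct (HB0 tau (u x y (t + tau)%R) (u x y (t + tau)%R) (u x y t) (u x y t)) as [H _]; [lra | | | |].
      * apply slow_refl; [lra |]. rewrite pow_O, Rmult_1_r. eapply se_bound; eauto; lra.
      * apply slow_refl; [lra |]. rewrite pow_O, Rmult_1_r. eapply se_bound; eauto; lra.
      * apply slow_refl; [lra |]. rewrite pow_1.
        replace (u x y (t + tau)%R + RtoC (-1) * u x y t)%C with (u x y (t + tau)%R - u x y t)%C by ring.
        eapply se_dt; eauto; lra.
      * eapply Rle_trans; [exact H |]. apply Rmult_le_compat_r; auto.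
  - rewrite !Hdec by lra.
    replace (RtoC (/ tau) * (Ci * time_defect u ut tau x y (t + tau)%R) +
       RtoC (/ (2 * h ^ 2)) * (space_defect u uxx uyy h x y (t + tau + tau)%R + space_defect u uxx uyy h x y (t + tau)%R) +
       nonlin_defect lambda nu eps tau u x y (t + tau)%R -
       (RtoC (/ tau) * (Ci * time_defect u ut tau x y t) +
        RtoC (/ (2 * h ^ 2)) * (space_defect u uxx uyy h x y (t + tau)%R + space_defect u uxx uyy h x y t) +
        nonlin_defect lambda nu eps tau u x y t))%C
      with (RtoC (/ tau) * (Ci * (time_defect u ut tau x y (t + tau)%R - time_defect u ut tau x y t))
       + RtoC (/ (2 * h ^ 2)) *
           ((space_defect u uxx uyy h x y (t + tau + tau)%R - space_defect u uxx uyy h x y (t + tau)%R)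
            + (space_defect u uxx uyy h x y (t + tau)%R - space_defect u uxx uyy h x y t))
       + (nonlin_defect lambda nu eps tau u x y (t + tau)%R - nonlin_defect lambda nu eps tau u x y t))%C by ring.
    assert (Si : forall s, 0 <= s -> s + tau <= T ->
      Cmod (space_defect u uxx uyy h x y (s + tau)%R - space_defect u uxx uyy h x y s)
      <= M * tau * h ^ 4 + M * tau * h ^ 4).
    { intros s H0 H1. unfold space_defect.
      match goal with |- Cmod ?z <= _ =>
        replace z with
        ((u (x + h)%R y (s + tau)%R - u (x + h)%R y s - RtoC 2 * (u x y (s + tau)%R - u x y s)
          + (u (x - h)%R y (s + tau)%R - u (x - h)%R y s)
          - RtoC (h ^ 2) * (uxx x y (s + tau)%R - uxx x y s))
         + (u x (y + h)%R (s + tau)%R - u x (y + h)%R s - RtoC 2 * (u x y (s + tau)%R - u x y s)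
          + (u x (y - h)%R (s + tau)%R - u x (y - h)%R s)
          - RtoC (h ^ 2) * (uyy x y (s + tau)%R - uyy x y s)))%C by ring end.
      apply Cmod_plus_le; [eapply se_xx_inc | eapply se_yy_inc]; eauto; lra. }
    apply Rle_trans with (M * tau * tau ^ 2 + 2 * (M * tau) * h ^ 2 + Rabs B0 * (tau * tau ^ 2)).
    2: { assert (0 <= M * tau * tau ^ 2) by (apply Rmult_le_pos; nra).
         assert (0 <= Rabs B0 * tau * h ^ 2) by (apply Rmult_le_pos; nra). lra. }
    apply Cmod_plus_le; [apply Cmod_plus_le |].
    + apply Cmod_RtoC_mult_le with (M * tau * tau ^ 3).
      * left; apply Rinv_0_lt_compat; auto.
      * rewrite Cmod_mult, Cmod_Ci, Rmult_1_l. unfold time_defect.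
        match goal with |- Cmod ?z <= _ =>
          replace z with (u x y (t + tau + tau)%R - u x y (t + tau)%R - (u x y (t + tau)%R - u x y t)
           - RtoC (tau / 2) * (ut x y (t + tau + tau)%R - ut x y (t + tau)%R + (ut x y (t + tau)%R - ut x y t)))%C
          by ring end.
        eapply se_trapezoid_inc; eauto; lra.
      * apply Req_le. field. lra.
    + eapply Cmod_RtoC_mult_le; [| apply Cmod_plus_le; apply Si; lra |].
      * left; apply Rinv_0_lt_compat; lra.
      * apply Req_le. field. lra.
    + unfold nonlin_defect.
      destruct (HB0 tau (u x y (t + tau)%R) (u x y (t + tau + tau)%R) (u x y t) (u x y (t + tau)%R)) as [_ [_ H]]; [lra | | | |].
      * repeat split; simpl; rewrite ?Rmult_1_r.
        -- eapply se_bound; eauto; lra.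
        -- eapply se_bound; eauto; lra.
        -- eapply se_dt; eauto; lra.
      * repeat split; simpl; rewrite ?Rmult_1_r.
        -- eapply se_bound; eauto; lra.
        -- eapply se_bound; eauto; lra.
        -- eapply se_dt; eauto; lra.
      * assert (E : forall z w : C, (z + RtoC (-1) * w)%C = (z - w)%C) by (intros; ring).
        rewrite !E. repeat split.
        -- rewrite pow_1. eapply se_dt; eauto; lra.
        -- rewrite pow_1. eapply se_dt; eauto; lra.
        -- eapply se_dtt; eauto; lra.
      * eapply Rle_trans; [exact H |].
        replace (tau * tau ^ 2) with (tau ^ 3) by ring. apply Rmult_le_compat_r; auto.
        apply pow_le; lra.
Qed.

Definition sample (a c h tau : R) (u : R -> R -> R -> C) (n : nat) : gridfun :=
  fun j k => u (a + INR j * h) (c + INR k * h) (INR n * tau).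

Lemma residual_sample lambda nu eps a c h tau u n j k :
  (1 <= j)%nat -> (1 <= k)%nat ->
  residual lambda nu eps h tau (sample a c h tau u) n j k
  = scheme_residual lambda nu eps h tau u (a + INR j * h) (c + INR k * h) (INR n * tau).
Proof.
  intros Hj Hk. destruct j as [|j]; [lia |]. destruct k as [|k]; [lia |].
  unfold residual, laph, midlevel, dtp, sample, scheme_residual. simpl pred.
  assert (Et : (INR (S n) * tau = INR n * tau + tau)%R) by (rewrite S_INR; ring).
  assert (Ep : forall s i, (s + INR (S (S i)) * h = s + INR (S i) * h + h)%R)
    by (intros; rewrite (S_INR (S i)); ring).
  assert (Em : forall s i, (s + INR i * h = s + INR (S i) * h - h)%R)
    by (intros; rewrite (S_INR i); ring).
  rewrite Et, (Ep a j), (Ep c k), (Em a j), (Em c k). reflexivity.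
Qed.

Lemma node_range (a b h : R) (J j : nat) :
  0 < h -> INR J * h = b - a -> (j <= J)%nat -> a <= a + INR j * h <= b.
Proof.
  intros Hh HJ Hj. assert (H := pos_INR j). assert (H' := le_INR j J Hj).
  split; [nra |]. assert (INR j * h <= INR J * h) by (apply Rmult_le_compat_r; lra). lra.
Qed.

Lemma node_interior (a b h : R) (J j : nat) :
  0 < h -> INR J * h = b - a -> (1 <= j <= J - 1)%nat ->
  a <= a + INR j * h - h /\ a + INR j * h + h <= b.
Proof.
  intros Hh HJ Hj. destruct j as [|j]; [lia |].
  assert (H1 := node_range a b h J j Hh HJ ltac:(lia)).
  assert (H2 := node_range a b h J (S (S j)) Hh HJ ltac:(lia)).
  rewrite !S_INR in *. lra.
Qed.

Lemma solution_comparison (lambda nu eps a b c d T M : R) (u0 : R -> R -> C) u v ut uxx uyy :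
  1 <= M -> a < b -> c < d -> 0 < T ->
  (forall x y, rect_boundary a b c d x y -> u0 x y = RtoC 0) ->
  exact_solution lambda nu eps a b c d T u0 u ->
  (forall x y t, a <= x <= b -> c <= y <= d -> 0 <= t <= T -> v x y t = u x y t) ->
  solution_estimates lambda nu eps a b c d T M v ut uxx uyy ->
  exists M', 1 <= M' /\
  forall (J K N : nat) (h tau : R) (U : nat -> gridfun),
    (1 <= J)%nat -> (1 <= K)%nat -> (1 <= N)%nat ->
    h = (b - a) / INR J -> h = (d - c) / INR K -> tau = T / INR N ->
    CNFD_solution lambda nu eps a c h h tau J K N u0 U ->
    comparison lambda nu eps (b - a) (d - c) T M' h tau J K N (sample a c h tau v) U.
Proof.
  intros HM Hab Hcd HT Hu0 Hex Hv Hs.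
  destruct (residual_estimates lambda nu eps a b c d T M v ut uxx uyy HM Hs) as (B & HB & Hres).
  exists (M + B). split; [lra |].
  intros J K N h tau U HJ HK HN EhJ EhK Etau (HU0 & HUX & HUs).
  destruct Hex as (_ & Hinit & Hbd).
  assert (HJ' : 0 < INR J) by (apply lt_0_INR; lia).
  assert (HK' : 0 < INR K) by (apply lt_0_INR; lia).
  assert (HN' : 0 < INR N) by (apply lt_0_INR; lia).
  assert (Hh : 0 < h) by (rewrite EhJ; apply Rdiv_lt_0_compat; lra).
  assert (Ht : 0 < tau) by (rewrite Etau; apply Rdiv_lt_0_compat; lra).
  assert (LJ : INR J * h = b - a) by (rewrite EhJ; field; lra).
  assert (LK : INR K * h = d - c) by (rewrite EhK; field; lra).
  assert (LN : INR N * tau = T) by (rewrite Etau; field; lra).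
  assert (Rx := fun j => node_range a b h J j Hh LJ).
  assert (Ry := fun k => node_range c d h K k Hh LK).
  assert (Rt : forall n, (n <= N)%nat -> 0 <= INR n * tau <= T).
  { intros n Hn. assert (R0 := node_range 0 T tau N n Ht ltac:(lra) Hn). lra. }
  assert (Bx : forall k, (k <= K)%nat -> rect_boundary a b c d (a + INR 0 * h) (c + INR k * h)
                                     /\ rect_boundary a b c d (a + INR J * h) (c + INR k * h)).
  { intros k Hk. assert (H0 := Rx 0%nat ltac:(lia)). assert (H1 := Rx J ltac:(lia)). assert (H2 := Ry k Hk).
    split; (split; [split; auto |]); intros [H3 _]; simpl in *; lra. }
  assert (By : forall j, (j <= J)%nat -> rect_boundary a b c d (a + INR j * h) (c + INR 0 * h)
                                     /\ rect_boundary a b c d (a + INR j * h) (c + INR K * h)).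
  { intros j Hj. assert (H0 := Ry 0%nat ltac:(lia)). assert (H1 := Ry K ltac:(lia)). assert (H2 := Rx j Hj).
    split; (split; [split; auto |]); intros [_ H3]; simpl in *; lra. }
  assert (XV : forall n, (n <= N)%nat -> X_JK J K (sample a c h tau v n)).
  { intros n Hn. split.
    - intros k Hk. destruct (Bx k Hk). unfold sample.
      rewrite !Hv by (try apply Rx; try apply Ry; auto; lia). split; apply Hbd; auto.
    - intros j Hj. destruct (By j Hj). unfold sample.
      rewrite !Hv by (try apply Rx; try apply Ry; auto; lia). split; apply Hbd; auto. }
  assert (Hr0 : 0 <= tau ^ 2 + h ^ 2) by (generalize (pow2_ge_0 tau) (pow2_ge_0 h); lra).
  split; auto.
  - intros n Hn. destruct n as [|n]; [| apply HUX; lia].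
    split.
    + intros k Hk. destruct (Bx k Hk). rewrite !HU0 by lia. split; apply Hu0; auto.
    + intros j Hj. destruct (By j Hj). rewrite !HU0 by lia. split; apply Hu0; auto.
  - intros n j k Hn Hj Hk. apply Rle_trans with M; [| lra].
    unfold sample. eapply se_bound; eauto.
  - intros n j k Hn Hj Hk. unfold sample.
    eapply Rle_trans; [eapply se_dx; eauto; apply Rx; lia |].
    rewrite S_INR. replace (a + (INR j + 1) * h - (a + INR j * h)) with h by ring.
    rewrite Rabs_pos_eq by lra. apply Rmult_le_compat_r; lra.
  - intros n j k Hn Hj Hk. unfold sample.
    eapply Rle_trans; [eapply se_dy; eauto; apply Ry; lia |].
    rewrite S_INR. replace (c + (INR k + 1) * h - (c + INR k * h)) with h by ring.
    rewrite Rabs_pos_eq by lra. apply Rmult_le_compat_r; lra.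
  - intros n j k Hn Hj Hk. rewrite residual_sample by lia.
    destruct (node_interior a b h J j Hh LJ Hj). destruct (node_interior c d h K k Hh LK Hk).
    assert (T0 := Rt n ltac:(lia)). assert (T1 := Rt (S n) ltac:(lia)). rewrite S_INR in T1.
    eapply Rle_trans; [apply Hres; auto; lra |]. apply Rmult_le_compat_r; lra.
  - intros n j k Hn Hj Hk. rewrite !residual_sample by lia.
    destruct (node_interior a b h J j Hh LJ Hj). destruct (node_interior c d h K k Hh LK Hk).
    assert (T0 := Rt n ltac:(lia)). assert (T1 := Rt (S (S n)) ltac:(lia)). rewrite !S_INR in T1.
    rewrite S_INR. replace ((INR n + 1) * tau) with (INR n * tau + tau) by ring.
    eapply Rle_trans; [apply Hres; auto; lra |]. apply Rmult_le_compat_r; auto.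
    apply Rmult_le_compat_r; lra.
  - intros j k Hj Hk. rewrite HU0 by auto. unfold sample.
    rewrite Hv by (auto; simpl; lra). simpl. rewrite Rmult_0_l.
    destruct (classic (open_rect a b c d (a + INR j * h) (c + INR k * h))) as [Ho | Hno].
    + symmetry. apply Hinit; auto.
    + assert (Hb : rect_boundary a b c d (a + INR j * h) (c + INR k * h)).
      { split; auto. split; auto. }
      rewrite Hu0, Hbd; auto. lra.
  - intros n j k Hn Hj Hk. rewrite <- (HUs n j k Hn Hj Hk). unfold residual, nonlin. ring.
Qed.

Lemma sqrt_le_scaled (X G rho : R) : 0 <= G -> 0 <= rho -> X <= G * rho ^ 2 -> sqrt X <= sqrt G * rho.
Proof.
  intros HG Hrho HX. apply sqrt_le_1_alt in HX.
  rewrite sqrt_mult_alt, sqrt_pow2 in HX; auto.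
Qed.

Theorem theorem3p8 :
  exists m : nat, (1 <= m)%nat /\
  forall (lambda nu eps a b c d T : R) (u0 : R -> R -> C)
    (u : R -> R -> R -> C),
    0 < nu -> 0 <= eps -> 0 < T -> a < b -> c < d ->
    (forall x y, rect_boundary a b c d x y -> u0 x y = RtoC 0) ->
    Cm_closed m a b c d T u ->
    exact_solution lambda nu eps a b c d T u0 u ->
    forall C0 : R, 0 < C0 ->
    exists h0 C1 : R, 0 < h0 /\ 0 < C1 /\
    forall (J K N : nat) (h tau : R) (U : nat -> gridfun),
      (1 <= J)%nat -> (1 <= K)%nat -> (1 <= N)%nat ->
      h = (b - a) / INR J -> h = (d - c) / INR K -> tau = T / INR N ->
      h <= h0 -> tau <= C0 * h ->
      CNFD_solution lambda nu eps a c h h tau J K N u0 U ->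
      (forall n, (1 <= n <= N)%nat ->
         norm2h h h J K (grid_error a c h h tau u U n)
           <= C1 * (tau ^ 2 + h ^ 2)) /\
      (forall n, (1 <= n <= N)%nat ->
         norm2h_grad h h J K (grid_error a c h h tau u U n)
           <= C1 * (tau ^ 2 + h ^ 2)).
Proof.
  exists 5%nat. split; [lia |].
  intros lambda nu eps a b c d T u0 u Hnu Heps HT Hab Hcd Hu0 HCm Hex C0 HC0.
  destruct (solution_estimates_exist lambda nu eps a b c d T u0 u Hab Hcd HT HCm Hex)
    as (M & v & ut & uxx & uyy & HM & Hv & Hs).
  destruct (solution_comparison lambda nu eps a b c d T M u0 u v ut uxx uyy HM Hab Hcd HT Hu0 Hex Hv Hs)
    as (M' & HM' & Hcmp).
  destruct (dirichlet_error_bound lambda nu eps (b - a) (d - c) T M' C0) as (h0 & G & Hh0 & HG & Hconv);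
    auto; try lra.
  exists h0, (sqrt G). split; [auto |]. split; [apply sqrt_lt_R0; auto |].
  intros J K N h tau U HJ HK HN EhJ EhK Etau Hh Htau HU.
  specialize (Hcmp J K N h tau U HJ HK HN EhJ EhK Etau HU).
  specialize (Hconv h tau J K N _ U Hcmp Hh Htau).
  assert (Hhp := cmp_h Hcmp).
  assert (Htp := cmp_tau Hcmp).
  assert (LJ := cmp_Lx Hcmp).
  assert (LK := cmp_Ly Hcmp).
  assert (LN := cmp_T Hcmp).
  assert (Hrho : 0 <= tau ^ 2 + h ^ 2) by (generalize (pow2_ge_0 tau) (pow2_ge_0 h); lra).
  assert (Hge : forall n j k, (n <= N)%nat -> (j <= J)%nat -> (k <= K)%nat ->
    grid_error a c h h tau u U n j k = error (sample a c h tau v) U n j k).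
  { intros n j k Hn Hj Hk. unfold grid_error, error, sample. rewrite Hv; auto.
    - apply (node_range a b h J); auto.
    - apply (node_range c d h K); auto.
    - assert (R0 := node_range 0 T tau N n Htp ltac:(lra) Hn). lra. }
  split; intros n Hn; destruct (Hconv n ltac:(lia)) as [Hm Hd].
  - rewrite norm2h_mass. apply sqrt_le_scaled; [lra | auto |].
    eapply Rle_trans; [| exact Hm]. apply Req_le. unfold mass. f_equal.
    apply gsum_ext; auto. intros. rewrite Hge by lia. auto.
  - rewrite norm2h_grad_dirichlet by auto. apply sqrt_le_scaled; [lra | auto |].
    eapply Rle_trans; [| exact Hd]. apply Req_le. unfold dirichlet. f_equal.
    apply gsum_ext; auto. intros. unfold grad_dot, dxp, dyp. rewrite !Hge by lia. auto.
Qed.
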